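(* Assume (A0)–(A3). Let $f:\mathbb R\to\mathbb R$ be bounded, with compact support $[-a,a]$, continuous at $0$ with $f(0)=1$, and let $(b_N)$ be a sequence of positive reals with $b_N\to0$ and $Nb_N^{(10+4\kappa)/\kappa}\to\infty$ as $N\to\infty$ ($\kappa$ as in (A3)). Let $T_N=\lfloor a/b_N\rfloor$ and $\hat\Psi^{HAC}(\nu)=\sum_{h=-T_N}^{T_N}f(hb_N)\hat\Lambda_h(\nu)$. Then $\hat\Psi^{HAC}(\nu)\xrightarrow{p}\Psi(\nu)$ as $N\to\infty$.
   Context: Fix integers $d,s\ge1$, $p(\nu)\ge1$. $Y_{ns+\nu}=\sum_{k=1}^{p(\nu)}\Phi_k(\nu)Y_{ns+\nu-k}+\epsilon_{ns+\nu}$ for all $n\in\mathbb Z$, $\nu\in\{1,\dots,s\}$. $\Phi_l(\nu)=0$ for $l>p(\nu)$, $p=\max p(\nu)$, $p^*=\lceil p/s\rceil$, $\epsilon_n^*=(\epsilon_{ns+s}^\top,\dots,\epsilon_{ns+1}^\top)^\top$; $\Phi_0^*$ has block $(i,j)$ ($i,j\in\{1,..,s\}$) $I_d$ if $i=j$, $-\Phi_{j-i}(s+1-i)$ if $j>i$, $0$ if $j<i$; $\Phi_k^*$ has block $(i,j)$ $\Phi_{ks+j-i}(s+1-i)$. (A0) $\mathbb E\epsilon_t=0$, $\mathrm{Var}(\epsilon_{ns+\nu})=\Sigma_\epsilon(\nu)$ nonsingular, $\mathrm{Cov}(\epsilon_t,\epsilon_{t-h})=0$, $h\ne0$; (A1)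 $\det(\Phi_0^*-\sum_{k=1}^{p^*}\Phi_k^*z^k)\neq0$ for $|z|\le1$; (A2) $(\epsilon_n^* )$ strictly stationary ergodic; (A3) $\mathbb E\|\epsilon_n^*\|^{4+2\kappa}<\infty$ and $\sum_k\alpha_{\epsilon^*}(k)^{\kappa/(2+\kappa)}<\infty$ for some $\kappa>0$ (strong mixing coefficients). $Y$ is the causal solution. $X_n(\nu)=(Y_{ns+\nu-1}^\top,\dots,Y_{ns+\nu-p(\nu)}^\top)^\top$, $X(\nu)=(X_0(\nu),\dots,X_{N-1}(\nu))$, $Z(\nu)=(Y_\nu,\dots,Y_{(N-1)s+\nu})$, $\hat B(\nu)=Z(\nu)X^\top(\nu)(X(\nu)X^\top(\nu))^{-1}$, residuals $\hat\epsilon_{ns+\nu}=Y_{ns+\nu}-\hat B(\nu)X_n(\nu)$. $W_n(\nu)=\mathrm{vec}\{\epsilon_{ns+\nu}X_n^\top(\nu)\}$, $\hat W_n(\nu)=\mathrm{vec}\{\hat\epsilon_{ns+\nu}X_n^\top(\nu)\}$, $\Lambda_h(\nu)=\mathbb E[W_n(\nu)W_{n-h}^\top(\nu)]$, $\Psi(\nu)=\sum_{h\in\mathbb Z}\Lambda_h(\nu)$. For $0\le h<N$, $\hat\Lambda_h(\nu)=\frac1N\sum_{n=h}^{N-1}\hat W_n(\nu)\hat W_{n-h}^\top(\nu)$ and $\hat\Lambda_{-h}(\nu)=\hat\Lambda_h^\top(\nu)$. *)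

(* Defs.v *)
From HB Require Import structures.
From mathcomp Require Import all_boot all_order all_algebra.
From mathcomp Require Import all_classical all_reals all_analysis.
From mathcomp.real_closed Require Import complex.
Set Implicit Arguments.
Unset Strict Implicit.
Unset Printing Implicit Defensive.
Import Order.TTheory GRing.Theory Num.Theory.
Import numFieldNormedType.Exports.
Local Open Scope ring_scope.
Local Open Scope classical_set_scope.

Definition Ex {dT} {T : measurableType dT} {R : realType}
  (P : probability T R) (X : T -> R) : R := fine ('E_P[X])%E.

Definition Emx {dT} {T : measurableType dT} {R : realType}
  (P : probability T R) m n (X : T -> 'M[R]_(m, n)) : 'M[R]_(m, n) :=
  \matrix_(i, j) Ex P (fun w => X w i j).

Definition Covmx {dT} {T : measurableType dT} {R : realType}
  (P : probability T R) m (X Z : T -> 'cV[R]_m) : 'M[R]_m :=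
  Emx P (fun w => (X w - Emx P X) *m (Z w - Emx P Z)^T).

(* the usual (column-stacking) vec operator: vec A stacks the columns of A *)
Definition vecc {R : Type} m n (A : 'M[R]_(m, n)) : 'cV[R]_(n * m) :=
  (mxvec A^T)^T.

Definition sqnorm {R : realType} m n (A : 'M[R]_(m, n)) : R :=
  \sum_i \sum_j A i j ^+ 2.

(*   seasons nu in {1,..,s}, Phi k nu = Phi_k(nu), p nu = p(nu).       *)

Definition pmax (s : nat) (p : nat -> nat) : nat := \max_(i < s) p i.+1.
Definition ceildiv (m n : nat) : nat := (m + n.-1) %/ n.
Definition pstar (s : nat) (p : nat -> nat) : nat := ceildiv (pmax s p) s.

(* Phi_0^*: block (i,j) (1-based) is I_d if i = j, -Phi_{j-i}(s+1-i) if
   j > i, 0 if j < i.  Here i, j are 0-based ordinals, so s+1-(i+1) = s-i. *)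
Definition Phistar0 {R : pzRingType} (d s : nat) (Phi : nat -> nat -> 'M[R]_d)
  : 'M[R]_(\sum_(i < s) d) :=
  \mxblock_(i < s, j < s)
     (if i == j then 1%:M else if (i < j)%N then - Phi (j - i)%N (s - i)%N
      else 0).

(* Phi_k^*: block (i,j) is Phi_{ks+j-i}(s+1-i)  (k >= 1) *)
Definition Phistar {R : pzRingType} (d s : nat) (Phi : nat -> nat -> 'M[R]_d)
  (k : nat) : 'M[R]_(\sum_(i < s) d) :=
  \mxblock_(i < s, j < s) Phi (k * s + j - i)%N (s - i)%N.

Definition Phistar_poly {R : realType} (d s : nat) (p : nat -> nat)
  (Phi : nat -> nat -> 'M[R]_d) (z : R[i]) : 'M[R[i]]_(\sum_(i < s) d) :=
  map_mx (real_complex R) (Phistar0 s Phi)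
  - \sum_(1 <= k < (pstar s p).+1) z ^+ k *: map_mx (real_complex R) (Phistar s Phi k).

(* eps*_n = (eps_{ns+s}^T, ..., eps_{ns+1}^T)^T *)
Definition estar {T : Type} {R : Type} (d s : nat) (eps : int -> T -> 'cV[R]_d)
  (n : int) (w : T) : 'cV[R]_(s * d) :=
  (mxvec (\matrix_(k < s) (eps (n * s%:Z + (s - k)%N%:Z) w)^T))^T.

Definition path_space (R : Type) (m : nat) := int -> 'cV[R]_m.

Definition cylinders (R : realType) (m : nat) : set (set (path_space R m)) :=
  [set C | exists (n : int) (i : 'I_m) (B : set R),
           measurable B /\ C = [set x : path_space R m | B (x n i ord0)]].
Arguments cylinders : clear implicits.

Definition path_sigma (R : realType) (m : nat) : set (set (path_space R m)) :=
  <<s cylinders R m >>.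
Arguments path_sigma : clear implicits.

Definition shift {R : Type} (m : nat) (x : path_space R m) : path_space R m :=
  fun n => x (n + 1).

Definition estar_path {T : Type} {R : Type} (d s : nat)
  (eps : int -> T -> 'cV[R]_d) (w : T) : path_space R (s * d) :=
  fun n => estar s eps n w.

Definition strictly_stationary {dT} {T : measurableType dT} {R : realType}
  (P : probability T R) m (Xi : T -> path_space R m) : Prop :=
  forall C, path_sigma R m C ->
    P (Xi @^-1` (shift (m:=m) @^-1` C)) = P (Xi @^-1` C).

Definition ergodic {dT} {T : measurableType dT} {R : realType}
  (P : probability T R) m (Xi : T -> path_space R m) : Prop :=
  forall C, path_sigma R m C -> shift (m:=m) @^-1` C = C ->
    P (Xi @^-1` C) = 0%E \/ P (Xi @^-1` C) = 1%E.

Definition sigma_past {dT} {T : measurableType dT} {R : realType}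
  m (X : int -> T -> 'cV[R]_m) (n : int) : set (set T) :=
  <<s [set A | exists (k : int) (i : 'I_m) (B : set R),
         (k <= n)%R /\ measurable B /\ A = (fun w => X k w i ord0) @^-1` B] >>.

Definition sigma_future {dT} {T : measurableType dT} {R : realType}
  m (X : int -> T -> 'cV[R]_m) (n : int) : set (set T) :=
  <<s [set A | exists (k : int) (i : 'I_m) (B : set R),
         (n <= k)%R /\ measurable B /\ A = (fun w => X k w i ord0) @^-1` B] >>.

Definition alpha_mixing {dT} {T : measurableType dT} {R : realType}
  (P : probability T R) m (X : int -> T -> 'cV[R]_m) (k : nat) : R :=
  sup [set r | exists (n : int) (A B : set T),
         sigma_past X n A /\ sigma_future X (n + k%:Z) B /\
         r = `| fine (P (A `&` B)) - fine (P A) * fine (P B) | ].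

(* X_n(nu) = (Y_{ns+nu-1}^T, ..., Y_{ns+nu-p(nu)}^T)^T *)
Definition Xreg {T : Type} {R : Type} (d s : nat) (p : nat -> nat)
  (Y : int -> T -> 'cV[R]_d) (nu : nat) (n : int) (w : T) : 'cV[R]_(p nu * d) :=
  (mxvec (\matrix_(k < p nu) (Y (n * s%:Z + nu%:Z - (k.+1)%:Z) w)^T))^T.

Definition Wscore {T : Type} {R : pzRingType} (d s : nat) (p : nat -> nat)
  (Y eps : int -> T -> 'cV[R]_d) (nu : nat) (n : int) (w : T)
  : 'cV[R]_(p nu * d * d) :=
  vecc (eps (n * s%:Z + nu%:Z) w *m (Xreg s p Y nu n w)^T).

(* Lambda_h(nu) = E[W_n(nu) W_{n-h}(nu)^T]  (independent of n; taken at n = 0) *)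
Definition Lambda {dT} {T : measurableType dT} {R : realType}
  (P : probability T R) (d s : nat) (p : nat -> nat)
  (Y eps : int -> T -> 'cV[R]_d) (nu : nat) (h : int) : 'M[R]_(p nu * d * d) :=
  Emx P (fun w => Wscore s p Y eps nu 0 w *m (Wscore s p Y eps nu (- h) w)^T).

Definition Psi {dT} {T : measurableType dT} {R : realType}
  (P : probability T R) (d s : nat) (p : nat -> nat)
  (Y eps : int -> T -> 'cV[R]_d) (nu : nat) : 'M[R]_(p nu * d * d) :=
  limn (fun H : nat =>
    \sum_(i < (2 * H).+1) Lambda P s p Y eps nu (i%:Z - H%:Z)).

Definition Xmat {T : Type} {R : Type} (d s : nat) (p : nat -> nat)
  (Y : int -> T -> 'cV[R]_d) (nu N : nat) (w : T) : 'M[R]_(p nu * d, N) :=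
  \matrix_(i < p nu * d, n < N) Xreg s p Y nu n%:Z w i ord0.

Definition Zmat {T : Type} {R : Type} (d s : nat)
  (Y : int -> T -> 'cV[R]_d) (nu N : nat) (w : T) : 'M[R]_(d, N) :=
  \matrix_(i < d, n < N) Y (n%:Z * s%:Z + nu%:Z) w i ord0.

(* B^(nu) = Z X^T (X X^T)^{-1}  (invmx: MathComp's inverse, = identity map on
   singular matrices, an event of vanishing probability) *)
Definition Bhat {T : Type} {R : realType} (d s : nat) (p : nat -> nat)
  (Y : int -> T -> 'cV[R]_d) (nu N : nat) (w : T) : 'M[R]_(d, p nu * d) :=
  Zmat s Y nu N w *m (Xmat s p Y nu N w)^T
    *m invmx (Xmat s p Y nu N w *m (Xmat s p Y nu N w)^T).

Definition ehat {T : Type} {R : realType} (d s : nat) (p : nat -> nat)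
  (Y : int -> T -> 'cV[R]_d) (nu N : nat) (n : int) (w : T) : 'cV[R]_d :=
  Y (n * s%:Z + nu%:Z) w - Bhat s p Y nu N w *m Xreg s p Y nu n w.

Definition What {T : Type} {R : realType} (d s : nat) (p : nat -> nat)
  (Y : int -> T -> 'cV[R]_d) (nu N : nat) (n : int) (w : T)
  : 'cV[R]_(p nu * d * d) :=
  vecc (ehat s p Y nu N n w *m (Xreg s p Y nu n w)^T).

(* Lambda^_h(nu) = 1/N sum_{n=h}^{N-1} W^_n W^_{n-h}^T for h >= 0
   (the empty sum, i.e. 0, when h >= N) *)
Definition Lambdahat_nat {T : Type} {R : realType} (d s : nat) (p : nat -> nat)
  (Y : int -> T -> 'cV[R]_d) (nu N h : nat) (w : T) : 'M[R]_(p nu * d * d) :=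
  N%:R^-1 *: \sum_(h <= n < N)
     What s p Y nu N n%:Z w *m (What s p Y nu N (n - h)%N%:Z w)^T.

Definition Lambdahat {T : Type} {R : realType} (d s : nat) (p : nat -> nat)
  (Y : int -> T -> 'cV[R]_d) (nu N : nat) (h : int) (w : T)
  : 'M[R]_(p nu * d * d) :=
  match h with
  | Posz k => Lambdahat_nat s p Y nu N k w
  | Negz k => (Lambdahat_nat s p Y nu N k.+1 w)^T
  end.

(* Psi^HAC(nu) = sum_{h=-T_N}^{T_N} f(h b_N) Lambda^_h(nu),
   T_N = floor(a / b_N) (truncn = floor on nonnegative reals) *)
Definition PsiHAC {T : Type} {R : realType} (d s : nat) (p : nat -> nat)
  (Y : int -> T -> 'cV[R]_d) (nu : nat) (f : R -> R) (a : R) (b : nat -> R)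
  (N : nat) (w : T) : 'M[R]_(p nu * d * d) :=
  let TN := Num.truncn (a / b N) in
  \sum_(i < (2 * TN).+1)
     f ((i%:Z - TN%:Z)%:~R * b N) *: Lambdahat s p Y nu N (i%:Z - TN%:Z) w.

(* Main.v *)
(* The causal coefficients tend to 0 and solve a periodic linear recursion, so
   they decay geometrically.  Hence the scores W_n = vec (eps_n X_n^T) are, up to
   a geometrically small error in r, functions of the innovations of the last r
   seasons, and Davydov's covariance inequality applied to these approximations
   gives absolutely summable autocovariances of W and of the products W_n W_(n-h).
   The Gram matrix of the regressors is a nonsingular limit of its sample version,
   so that Bhat - B is controlled by the average score.  The error of the HAC
   estimator splits into three parts.  Replacing residuals by innovations costs a
   multiple of T_N |Bhat - B|, which is o_P(1).  The fluctuation of the sample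
   autocovariances, summed over |h| <= T_N, is bounded in mean by truncating the
   scores at the level b_N ^ -(1/kappa + 1/4); the bandwidth condition is what
   makes this bound vanish.  The remaining deterministic bias vanishes by
   Tannery's theorem. *)
Require Import Defs.
From HB Require Import structures.
From mathcomp Require Import all_boot all_order all_algebra.
From mathcomp Require Import all_classical all_reals all_analysis.
From mathcomp.real_closed Require Import complex.
From mathcomp Require Import measurable_realfun ring lra zify.
Import Order.TTheory GRing.Theory Num.Theory.
Import numFieldNormedType.Exports.
Set Implicit Arguments.
Unset Strict Implicit.
Unset Printing Implicit Defensive.
Local Open Scope ring_scope.
Local Open Scope classical_set_scope.

(** The innovations have 4 + 2 kappa moments, so a score has 2 + kappa of them and a product of two
    scores only 1 + kappa / 2: in general no variance. Davydov's inequality therefore serves the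
    scores and the Gram entries, while sums of products are handled by clipping each score, bounding
    the variance of the clipped sum with the covariance inequality for bounded variables, and
    controlling the rest in mean only. The recursion of the causal coefficients is not read off the
    moving average, which is given only through almost sure convergence; it is inherited by the
    covariances E[Y_t eps_u^T], which determine the coefficients because the innovation variances
    are invertible. The same covariances show that the Gram matrix is nonsingular. The
    approximations need one random envelope with 4 + 2 kappa moments for all truncation depths at
    once; it is the l^Q norm, Q = 4 + 2 kappa, of the geometrically weighted innovations. Infinite
    moving averages are only almost sure limits, so stationarity of moments is proved for
    truncations and passed to the limit. *)

Section Expectation.
Context {dT : measure_display} {T : measurableType dT} {R : realType}.
Variable P : probability T R.
Implicit Types X Y Z : T -> R.

(** * Integrability and expectation of real random variables *)

Definition L1 X := P.-integrable setT (EFin \o X).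

Lemma L1_meas X : L1 X -> measurable_fun setT X.
Proof. by move=> /integrableP[/measurable_EFinP]. Qed.

Lemma L1_le_ae X Y : measurable_fun setT X ->
  {ae P, forall w, `|X w| <= Y w} -> L1 Y -> L1 X.
Proof.
move=> mX XY /integrableP[mY iY]; apply/integrableP; split.
  exact/measurable_EFinP.
apply: le_lt_trans iY; apply: ae_ge0_le_integral => //=.
- by apply/measurable_EFinP; exact: measurableT_comp.
- by apply/measurable_EFinP/measurableT_comp => //; exact/measurable_EFinP.
- apply: filterS XY => w h _; rewrite lee_fin.
  exact: le_trans h (ler_norm _).
Qed.

Lemma L1_le X Y : measurable_fun setT X ->
  (forall w, `|X w| <= Y w) -> L1 Y -> L1 X.
Proof. by move=> mX h; apply: L1_le_ae => //; exact: aeW. Qed.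

Lemma L1_cst c : L1 (cst c).
Proof. exact: finite_measure_integrable_cst. Qed.

Lemma L1D X Y : L1 X -> L1 Y -> L1 (fun w => X w + Y w).
Proof.
move=> iX iY; have := integrableD measurableT iX iY.
by apply: eq_integrable => // w _.
Qed.

Lemma L1N X : L1 X -> L1 (fun w => - X w).
Proof.
by move=> iX; have := integrableN iX; apply: eq_integrable => // w _.
Qed.

Lemma L1B X Y : L1 X -> L1 Y -> L1 (fun w => X w - Y w).
Proof. by move=> iX /L1N; exact: L1D. Qed.

Lemma L1Z c X : L1 X -> L1 (fun w => c * X w).
Proof.
move=> iX; have := integrableZl measurableT c iX.
by apply: eq_integrable => // w _.
Qed.

Lemma L1_norm X : L1 X -> L1 (fun w => `|X w|).
Proof. by move=> iX; have := integrable_norm iX. Qed.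

Lemma L1_sum I (r : seq I) (p : pred I) (F : I -> T -> R) :
  (forall i, p i -> L1 (F i)) -> L1 (fun w => \sum_(i <- r | p i) F i w).
Proof.
move=> h; elim: r => [|i r IH].
  by under eq_fun do rewrite big_nil; exact: L1_cst.
under eq_fun do rewrite big_cons.
by case: (p i) (h i) => // hi; apply: L1D => //; exact: hi.
Qed.

Lemma ExE X : Ex P X = (\int[P]_w X w)%R.
Proof. by rewrite /Ex unlock. Qed.

Lemma eq_Ex X Y : X =1 Y -> Ex P X = Ex P Y.
Proof. by move=> h; congr (Ex P _); exact/funext. Qed.

Lemma ExD X Y : L1 X -> L1 Y -> Ex P (fun w => X w + Y w) = Ex P X + Ex P Y.
Proof. by move=> iX iY; rewrite !ExE RintegralD. Qed.

Lemma ExB X Y : L1 X -> L1 Y -> Ex P (fun w => X w - Y w) = Ex P X - Ex P Y.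
Proof. by move=> iX iY; rewrite !ExE RintegralB. Qed.

Lemma ExZ c X : L1 X -> Ex P (fun w => c * X w) = c * Ex P X.
Proof. by move=> iX; rewrite !ExE RintegralZl. Qed.

Lemma Ex_cst c : Ex P (fun=> c) = c.
Proof. by rewrite ExE Rintegral_cst// [X in fine X]probability_setT mulr1. Qed.

Lemma Ex_sum I (r : seq I) (p : pred I) (F : I -> T -> R) :
  (forall i, p i -> L1 (F i)) ->
  Ex P (fun w => \sum_(i <- r | p i) F i w) = \sum_(i <- r | p i) Ex P (F i).
Proof.
move=> h; elim: r => [|i r IH].
  by rewrite big_nil; under eq_fun do rewrite big_nil; rewrite Ex_cst.
under eq_fun do rewrite big_cons; rewrite big_cons.
by case: ifP => // pi; rewrite ExD ?IH//; [exact: h|exact: L1_sum].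
Qed.

Lemma Ex_ae X Y : measurable_fun setT X -> measurable_fun setT Y ->
  {ae P, forall w, X w = Y w} -> Ex P X = Ex P Y.
Proof.
move=> mX mY h; rewrite !ExE /Rintegral; congr fine.
apply: ae_eq_integral => //; [exact/measurable_EFinP..|].
by apply: filterS h => w /= -> _.
Qed.

Lemma Ex_le X Y : L1 X -> L1 Y -> (forall w, X w <= Y w) -> Ex P X <= Ex P Y.
Proof. by move=> iX iY h; rewrite !ExE le_Rintegral. Qed.

(** The maximum of [X] and [Y] lies above [X] everywhere and equals [Y] almost everywhere, which
    reduces the claim to the pointwise comparison. *)
Lemma Ex_le_ae X Y : L1 X -> L1 Y -> {ae P, forall w, X w <= Y w} ->
  Ex P X <= Ex P Y.
Proof.
move=> iX iY h.
have mX := L1_meas iX; have mY := L1_meas iY.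
have mM : measurable_fun setT (fun w => Num.max (X w) (Y w)).
  exact: measurable_maxr.
have aM : {ae P, forall w, Num.max (X w) (Y w) = Y w}.
  by apply: filterS h => w /max_idPr.
have iM : L1 (fun w => Num.max (X w) (Y w)).
  apply: (L1_le_ae mM _ (L1_norm iY)).
  by apply: filterS aM => w ->.
rewrite -(Ex_ae mM mY aM); apply: Ex_le => // w.
by rewrite le_max lexx.
Qed.

Lemma Ex_ge0 X : (forall w, 0 <= X w) -> 0 <= Ex P X.
Proof. by move=> h; rewrite ExE; apply: Rintegral_ge0 => w _. Qed.

Lemma Ex_norm X : L1 X -> `|Ex P X| <= Ex P (fun w => `|X w|).
Proof. by move=> iX; rewrite !ExE; exact: le_normr_Rintegral. Qed.

Lemma Ex_norm_le_ae X Y : measurable_fun setT X -> L1 Y ->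
  {ae P, forall w, `|X w| <= Y w} -> `|Ex P X| <= Ex P Y.
Proof.
move=> mX iY h; have iX := L1_le_ae mX h iY.
apply: le_trans (Ex_norm iX) _; apply: Ex_le_ae => //; exact: L1_norm.
Qed.

Lemma EFin_Ex X : L1 X -> (Ex P X)%:E = (\int[P]_w (X w)%:E)%E.
Proof.
move=> iX; rewrite /Ex unlock fineK//.
exact: (integrable_fin_num measurableT iX).
Qed.

Lemma markov_Ex X (e : R) : L1 X -> 0 < e ->
  (P [set w | (e <= `|X w|)%R] <= (e^-1 * Ex P (fun w => `|X w|))%:E)%E.
Proof.
move=> iX e0; have mX := L1_meas iX.
rewrite EFinM EFin_Ex; last exact: L1_norm.
have h := @le_integral_comp_abse _ T R P setT measurableT (EFin \o X) e
  id (@measurable_id _ _ setT) (fun _ h => h) (fun _ _ _ _ h => h).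
have /h/(_ e0) : measurable_fun setT (EFin \o X) by exact/measurable_EFinP.
rewrite setTI /= => h'.
by rewrite lee_pdivlMl.
Qed.

(** Cauchy-Schwarz with given positive bounds in place of the norms: it is (b |X| - a |Y|)^2 >= 0
    divided by 2 a b. Neither square roots nor a degenerate case appear, and integrability of the
    product comes along. *)
Lemma Ex_CS X Y a b : 0 < a -> 0 < b ->
  measurable_fun setT X -> measurable_fun setT Y ->
  L1 (fun w => X w ^+ 2) -> L1 (fun w => Y w ^+ 2) ->
  Ex P (fun w => X w ^+ 2) <= a ^+ 2 -> Ex P (fun w => Y w ^+ 2) <= b ^+ 2 ->
  L1 (fun w => X w * Y w) /\ Ex P (fun w => `|X w * Y w|) <= a * b.
Proof.
move=> a0 b0 mX mY iX iY hX hY.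
pose Z w := (b / (2 * a)) * X w ^+ 2 + (a / (2 * b)) * Y w ^+ 2.
have XYZ w : `|X w * Y w| <= Z w.
  rewrite -subr_ge0.
  have -> : Z w - `|X w * Y w| =
      (b * `|X w| - a * `|Y w|) ^+ 2 / (2 * a * b).
    rewrite normrM /Z -[X w ^+ 2]real_normK ?num_real//.
    rewrite -[Y w ^+ 2]real_normK ?num_real//.
    by field; rewrite !gt_eqF.
  by rewrite divr_ge0 ?sqr_ge0// !mulr_ge0// ltW.
have iZ : L1 Z by apply: L1D; exact: L1Z.
have iXY : L1 (fun w => X w * Y w).
  exact: L1_le (measurable_funM mX mY) XYZ iZ.
split=> //.
apply: le_trans (Ex_le (L1_norm iXY) iZ XYZ) _.
rewrite /Z ExD; [|exact: L1Z..].
rewrite !ExZ//.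
have -> : a * b = b / (2 * a) * a ^+ 2 + a / (2 * b) * b ^+ 2.
  by field; rewrite !gt_eqF.
by apply: lerD; rewrite ler_pM2l// divr_gt0// mulr_gt0.
Qed.

End Expectation.

(** * Covariance inequality for bounded variables under strong mixing *)

Section Covariance.
Context {dT : measure_display} {T : measurableType dT} {R : realType}.
Variable P : probability T R.
Implicit Types U V W : T -> R.

Definition cov U V : R := Ex P (fun w => U w * V w) - Ex P U * Ex P V.

(** [g_sigma_algebraType G] is [T] with the sigma-algebra generated by [G], so this expresses
    measurability for a sub-sigma-algebra while [T] keeps its own structure. *)
Definition gmeas (G : set (set T)) (U : T -> R) : Prop :=
  @measurable_fun _ _ (g_sigma_algebraType G) R setT U.

Lemma gmeas_fun G U : (forall A, G A -> measurable A) ->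
  gmeas G U -> measurable_fun setT U.
Proof.
move=> hG hU _ B mB; have := hU measurableT B mB.
by rewrite setTI; apply: smallest_sub => //; exact: sigma_algebra_measurable.
Qed.

Lemma sigma_measurable (G : set (set T)) A : (forall A, G A -> measurable A) ->
  <<s G >> A -> measurable A.
Proof.
by move=> hG; apply: smallest_sub => //; exact: sigma_algebra_measurable.
Qed.

Lemma L1_bounded U M : measurable_fun setT U -> (forall w, `|U w| <= M) ->
  L1 P U.
Proof. by move=> mU h; apply: (L1_le mU h); exact: L1_cst. Qed.

Lemma Ex_bounded U M : measurable_fun setT U -> (forall w, `|U w| <= M) ->
  `|Ex P U| <= M.
Proof.
move=> mU h; rewrite -[leRHS](Ex_cst P).
by apply: Ex_norm_le_ae => //; [exact: L1_cst|exact: aeW].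
Qed.

Definition mixing_le (G H : set (set T)) (a : R) := forall A B,
  <<s G >> A -> <<s H >> B ->
  `|fine (P (A `&` B)) - fine (P A) * fine (P B)| <= a.

Lemma cov_affine a b c d U V : L1 P U -> L1 P V -> L1 P (fun w => U w * V w) ->
  cov (fun w => a * U w + b) (fun w => c * V w + d) = a * c * cov U V.
Proof.
move=> iU iV iUV; rewrite /cov.
have -> : Ex P (fun w => (a * U w + b) * (c * V w + d)) =
    Ex P (fun w => ((a * c) * (U w * V w) + (a * d) * U w) +
                   ((b * c) * V w + b * d)).
  by apply: eq_Ex => w; ring.
rewrite !ExD ?ExZ ?Ex_cst//; [ring|..];
  do ?[exact: L1_cst|exact: L1Z|apply: L1D].
Qed.

(** On [0, 1] this is floor ((K + 1) x) / (K + 1), written as an average of indicators of superlevel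
    sets so that its covariances become averages of covariances of events. *)
Definition steps (K : nat) (x : R) : R :=
  K.+1%:R^-1 * \sum_(j < K.+1) (nat_of_bool (j.+1%:R <= K.+1%:R * x)%R)%:R.

Lemma steps_approx K x : 0 <= x <= 1 ->
  0 <= steps K x <= 1 /\ `|x - steps K x| <= K.+1%:R^-1.
Proof.
move=> /andP[x0 x1].
have K0 : 0 < K.+1%:R :> R by rewrite ltr0n.
have Kx0 : 0 <= K.+1%:R * x by rewrite mulr_ge0// ltW.
set t := Num.truncn (K.+1%:R * x).
have tK : (t <= K.+1)%N.
  rewrite -(ler_nat R); apply: le_trans (_ : K.+1%:R * x <= _).
    by rewrite truncn_le.
  by rewrite ler_piMr// ltW.
have -> : steps K x = K.+1%:R^-1 * t%:R.
  rewrite /steps; congr (_ * _).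
  rewrite -natr_sum; congr _%:R.
  under eq_bigr do rewrite -truncn_ge_nat// -/t.
  rewrite -(big_mkord xpredT (fun j => (j < t)%N : nat)).
  rewrite (big_cat_nat (n := t))//= [X in (_ + X)%N]big_nat_cond.
  rewrite [X in (_ + X)%N]big1 ?addn0; last first.
    by move=> i /andP[/andP[ti _] _]; rewrite ltnNge ti.
  rewrite big_nat (eq_bigr (fun=> 1%N)); last by move=> i /andP[_ ->].
  by rewrite -big_nat sum_nat_const_nat subn0 muln1.
have h1 : t%:R <= K.+1%:R * x by rewrite truncn_le.
have h2 : K.+1%:R * x < t.+1%:R by rewrite truncnS_gt.
split.
  rewrite mulr_ge0 ?invr_ge0 ?ler0n//= mulrC ler_pdivrMr// mul1r.
  by rewrite ler_nat.
rewrite -(ler_pM2l K0) mulfV ?gt_eqF// -[X in X * `|_|]gtr0_norm//.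
rewrite -normrM mulrBr mulrA mulfV ?gt_eqF// mul1r ger0_norm ?subr_ge0//.
by rewrite lerBlDl natr1 ltW.
Qed.

Lemma Ex_indic A : measurable A -> Ex P (\1_A : T -> R) = fine (P A).
Proof. by move=> mA; rewrite ExE /Rintegral integral_indic// setIT. Qed.

(** Each variable is an average of K + 1 indicators, so the covariance is an average of (K + 1)^2
    covariances of events, each at most [a]; nothing is lost in K. *)
Lemma cov_steps K G H a U V : (forall A, G A -> measurable A) ->
  (forall A, H A -> measurable A) -> mixing_le G H a ->
  gmeas G U -> gmeas H V ->
  `|cov (fun w => steps K (U w)) (fun w => steps K (V w))| <= a.
Proof.
move=> hG hH hmix gU gV.
pose A (U : T -> R) (j : nat) := [set w | j.+1%:R <= K.+1%:R * U w].
have AE W j : A W j = W @^-1` [set x | j.+1%:R <= K.+1%:R * x] by [].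
have mB (j : nat) : measurable [set x : R | j.+1%:R <= K.+1%:R * x].
  by rewrite -[X in measurable X]setTI; apply: measurable_fun_le => //;
    exact: measurable_funM.
have mix i j : `|cov (\1_(A U i)) (\1_(A V j))| <= a.
  have hA : <<s G >> (A U i).
    by rewrite AE -[X in <<s G >> X]setTI; exact: gU.
  have hB : <<s H >> (A V j).
    by rewrite AE -[X in <<s H >> X]setTI; exact: gV.
  have mA := sigma_measurable hG hA; have mB' := sigma_measurable hH hB.
  rewrite /cov !Ex_indic//.
  have -> : Ex P (fun w => \1_(A U i) w * \1_(A V j) w) =
      Ex P (\1_(A U i `&` A V j) : T -> R).
    by apply: eq_Ex => w; rewrite indicI.
  by rewrite Ex_indic; [exact: hmix|exact: measurableI].
have L1A W j (Q : set (set T)) : (forall A, Q A -> measurable A) -> gmeas Q W ->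
    measurable (A W j).
  move=> hQ gW; apply: (sigma_measurable hQ).
  by rewrite AE -[X in <<s Q >> X]setTI; exact: gW.
have iA W j (Q : set (set T)) : (forall A, Q A -> measurable A) -> gmeas Q W ->
    L1 P (\1_(A W j) : T -> R).
  move=> hQ gW; apply: (@L1_bounded _ 1).
    by apply: measurable_indic; exact: L1A hQ gW.
  by move=> w; rewrite indicE; case: (_ \in _); rewrite ?normr1 ?normr0.
have stE W : (fun w => steps K (W w)) =
    (fun w => K.+1%:R^-1 * \sum_(j < K.+1) (\1_(A W j) w)).
  apply/funext => w; rewrite /steps; congr (_ * _); apply: eq_bigr => j _.
  rewrite indicE; congr (nat_of_bool _)%:R.
  by apply/idP/idP; rewrite inE.
have iAA i j : L1 P (fun w => \1_(A U i) w * \1_(A V j) w).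
  apply: (@L1_bounded _ 1).
    apply: measurable_funM; apply: measurable_indic.
      exact: L1A hG gU.
    exact: L1A hH gV.
  by move=> w; rewrite !indicE; do 2 case: (_ \in _);
    rewrite ?mulr0 ?mulr1 ?normr1 ?normr0.
have -> : cov (fun w => steps K (U w)) (fun w => steps K (V w)) =
    K.+1%:R^-1 ^+ 2 * \sum_(i < K.+1) \sum_(j < K.+1)
      cov (\1_(A U i)) (\1_(A V j)).
  rewrite !stE /cov.
  rewrite (ExZ _ (L1_sum _ _)); last by move=> j _; exact: iA gU.
  rewrite (ExZ _ (L1_sum _ _)); last by move=> j _; exact: iA gV.
  rewrite !Ex_sum; [|by move=> j _; exact: iA gV|by move=> j _; exact: iA gU].
  have -> : (fun w => K.+1%:R^-1 * (\sum_(j < K.+1) \1_(A U j) w) *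
       (K.+1%:R^-1 * \sum_(j < K.+1) \1_(A V j) w)) =
     (fun w => (K.+1%:R^-1 : R) ^+ 2 * \sum_(i < K.+1) \sum_(j < K.+1)
         (\1_(A U i) w * \1_(A V j) w)).
    apply/funext => w; rewrite mulrACA expr2 mulr_suml; congr (_ * _).
    by apply: eq_bigr => i _; rewrite mulr_sumr.
  rewrite ExZ; last by apply: L1_sum => i _; apply: L1_sum.
  rewrite Ex_sum; last by move=> i _; exact: L1_sum.
  rewrite mulrACA -expr2 -mulrBr; congr (_ * _).
  rewrite mulr_suml -sumrB; apply: eq_bigr => i _.
  by rewrite Ex_sum// mulr_sumr -sumrB.
have a0 : 0 <= a by exact: le_trans (normr_ge0 _) (mix 0%N 0%N).
rewrite normrM ger0_norm ?exprn_ge0 ?invr_ge0 ?ler0n//.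
have : `|\sum_(i < K.+1) \sum_(j < K.+1) cov (\1_(A U i)) (\1_(A V j))|
    <= \sum_(i < K.+1) \sum_(j < K.+1) a.
  apply: le_trans (ler_norm_sum _ _ _) _; apply: ler_sum => i _.
  by apply: le_trans (ler_norm_sum _ _ _) _; apply: ler_sum => j _.
rewrite sumr_const sumr_const card_ord -(mulr_natr (a *+ _)) -(mulr_natr a) => h.
rewrite exprVn mulrC ler_pdivrMr ?exprn_gt0 ?ltr0n//.
by rewrite expr2 mulrA.
Qed.

Lemma Ex_dist U V e : L1 P U -> L1 P V -> (forall w, `|U w - V w| <= e) ->
  `|Ex P U - Ex P V| <= e.
Proof.
move=> iU iV h; rewrite -ExB//; apply: Ex_bounded => //.
exact: L1_meas (L1B iU iV).
Qed.

(** Uniform approximation by [steps]: it moves the mean of the product and the product of the means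
    by at most 2 / (K + 1) each, and K is arbitrary. *)
Lemma cov_unit G H a U V : (forall A, G A -> measurable A) ->
  (forall A, H A -> measurable A) -> mixing_le G H a ->
  gmeas G U -> gmeas H V ->
  (forall w, 0 <= U w <= 1) -> (forall w, 0 <= V w <= 1) ->
  `|cov U V| <= a.
Proof.
move=> hG hH hmix gU gV hU hV; apply/ler_addgt0Pr => /= e e0.
have [K hK] : exists K : nat, 4 * K.+1%:R^-1 <= e.
  exists (Num.truncn (4 / e)); rewrite ler_pdivrMr ?ltr0n// mulrC.
  by rewrite -ler_pdivrMr// ltW// truncnS_gt.
apply: le_trans (_ : a + 4 * K.+1%:R^-1 <= _); last by rewrite lerD2l.
have mU := gmeas_fun hG gU; have mV := gmeas_fun hH gV.
have h1 (W : T -> R) w : (forall w, 0 <= W w <= 1) -> `|W w| <= 1 :> R.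
  by move=> /(_ w)/andP[? ?]; rewrite ger0_norm.
have ms (W : T -> R) : measurable_fun setT W -> measurable_fun setT (fun w : T => steps K (W w)).
  move=> mW; apply: measurable_funM => //; apply: measurable_sum => j.
  rewrite (_ : (fun _ => _) = \1_[set w | j.+1%:R <= K.+1%:R * W w]).
    apply: measurable_indic; rewrite -[X in measurable X]setTI.
    by apply: measurable_fun_le => //; exact: measurable_funM.
  apply/funext => w; rewrite indicE; congr (nat_of_bool _)%:R.
  by apply/idP/idP; rewrite inE.
have s1 (W : T -> R) w : (forall w, 0 <= W w <= 1) -> `|steps K (W w)| <= 1 :> R.
  by move=> /(_ w)/(steps_approx K)[/andP[? ?] _]; rewrite ger0_norm.
have sd (W : T -> R) w : (forall w, 0 <= W w <= 1) ->
  `|W w - steps K (W w)| <= K.+1%:R^-1 :> R.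
  by move=> /(_ w)/(steps_approx K)[].
have iU := L1_bounded mU (fun w => h1 U w hU).
have iV := L1_bounded mV (fun w => h1 V w hV).
have isU := L1_bounded (ms _ mU) (fun w => s1 U w hU).
have isV := L1_bounded (ms _ mV) (fun w => s1 V w hV).
have prod1 (x y : R) : `|x| <= 1 -> `|y| <= 1 -> `|x * y| <= 1.
  by move=> *; rewrite normrM mulr_ile1.
have iUV := L1_bounded (measurable_funM mU mV)
  (fun w => prod1 _ _ (h1 U w hU) (h1 V w hV)).
have isUV := L1_bounded (measurable_funM (ms _ mU) (ms _ mV))
  (fun w => prod1 _ _ (s1 U w hU) (s1 V w hV)).
have diff (x y x' y' e1 : R) : `|x| <= 1 -> `|y'| <= 1 -> `|x - x'| <= e1 ->
    `|y - y'| <= e1 -> `|x * y - x' * y'| <= 2 * e1.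
  move=> hx hy' hxx hyy.
  have -> : x * y - x' * y' = x * (y - y') + (x - x') * y' by ring.
  apply: le_trans (ler_normD _ _) _; rewrite !normrM.
  rewrite mulrDl !mul1r; apply: lerD.
    by rewrite -[leRHS]mul1r ler_pM.
  by rewrite -[leRHS]mulr1 ler_pM.
rewrite -[cov U V](subrK (cov (fun w => steps K (U w)) (fun w => steps K (V w)))).
rewrite addrC; apply: le_trans (ler_normD _ _) _; apply: lerD.
  exact: cov_steps hG hH hmix gU gV.
rewrite /cov; set p1 := Ex P (fun w => U w * V w); set q1 := _ * _.
set p2 := Ex P (fun w => steps _ _ * _); set q2 := _ * _.
have -> : p1 - q1 - (p2 - q2) = (p1 - p2) - (q1 - q2) by ring.
rewrite [4](_ : _ = 2 + 2); last by ring.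
rewrite mulrDl; apply: le_trans (ler_normB _ _) _; apply: lerD.
  apply: Ex_dist => // w; apply: diff; [exact: h1|exact: s1|exact: sd..].
apply: diff.
- by apply: Ex_bounded => // w; exact: h1.
- by apply: Ex_bounded => // [|w]; [exact: ms|exact: s1].
- by apply: Ex_dist => // w; exact: sd.
- by apply: Ex_dist => // w; exact: sd.
Qed.

(** The affine map x -> (x + M) / (2 M) brings both variables into [0, 1]; undoing it multiplies the
    covariance by (2 M)^2. *)
Lemma cov_bounded G H a U V M : (forall A, G A -> measurable A) ->
  (forall A, H A -> measurable A) -> mixing_le G H a ->
  gmeas G U -> gmeas H V -> 0 < M ->
  (forall w, `|U w| <= M) -> (forall w, `|V w| <= M) ->
  `|cov U V| <= 4 * M ^+ 2 * a.
Proof.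
move=> hG hH hmix gU gV M0 hU hV.
have sc (x : R) : `|x| <= M -> 0 <= (x + M) / (2 * M) <= 1.
  rewrite ler_norml => /andP[h1 h2]; rewrite divr_ge0 ?mulr_ge0 ?(ltW M0)//=.
    by rewrite ler_pdivrMr ?mulr_gt0// mul1r mulr_natl mulr2n lerD2r.
  by rewrite -lerBlDr sub0r.
have mU := gmeas_fun hG gU; have mV := gmeas_fun hH gV.
pose U' w := (U w + M) / (2 * M); pose V' w := (V w + M) / (2 * M).
have gs Q W : gmeas Q W -> gmeas Q (fun w => (W w + M) / (2 * M)).
  by move=> gW; apply: measurable_funM => //; exact: measurable_funD.
have hc := cov_unit hG hH hmix (gs _ _ gU) (gs _ _ gV)
  (fun w => sc _ (hU w)) (fun w => sc _ (hV w)).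
have -> : cov U V = cov (fun w => (2 * M) * U' w + - M)
                       (fun w => (2 * M) * V' w + - M).
  by congr cov; apply/funext => w; rewrite /U' /V'; field; rewrite gt_eqF.
have b1 (W : T -> R) w : (forall w, `|W w| <= M) -> `|(W w + M) / (2 * M)| <= 1 :> R.
  by move=> /(_ w)/sc/andP[? ?]; rewrite ger0_norm.
have mU' : measurable_fun setT U' by exact: gmeas_fun hG (gs _ _ gU).
have mV' : measurable_fun setT V' by exact: gmeas_fun hH (gs _ _ gV).
rewrite cov_affine; last first.
- apply: (@L1_bounded _ 1); first exact: measurable_funM.
  by move=> w; rewrite normrM mulr_ile1// b1.
- by apply: (@L1_bounded _ 1) => // w; exact: b1.
- by apply: (@L1_bounded _ 1) => // w; exact: b1.
rewrite normrM ger0_norm; last by rewrite !mulr_ge0// ltW.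
have -> : 4 * M ^+ 2 = 2 * M * (2 * M) by ring.
by rewrite ler_pM2l// !mulr_gt0.
Qed.

End Covariance.

(** * Truncation at a level M and its tail errors *)

Section Clip.
Context {R : realType}.
Implicit Types M x y k : R.

Definition clip M x : R := Num.max (- M) (Num.min x M).

Lemma clip_le M x : 0 <= M -> `|clip M x| <= M.
Proof.
move=> M0; rewrite /clip ler_norml le_max lexx/= ge_max ge_min lexx orbT andbT.
by rewrite (le_trans _ M0)// oppr_le0.
Qed.

Lemma clip_id M x : `|x| <= M -> clip M x = x.
Proof.
by rewrite ler_norml /clip => /andP[h1 h2]; rewrite (min_idPl h2); apply/max_idPr.
Qed.

Lemma clip_norm M x : 0 <= M -> `|clip M x| <= `|x|.
Proof.
move=> M0; have [h|h] := leP `|x| M; first by rewrite clip_id.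
exact: le_trans (clip_le x M0) (ltW h).
Qed.

Lemma clip_dist M x : 0 <= M -> `|x - clip M x| <= `|x|.
Proof.
move=> M0; have [h|h] := leP `|x| M; first by rewrite clip_id// subrr normr0.
rewrite /clip; have [x0|x0] := leP 0 x.
  move: h; rewrite ger0_norm// => h.
  rewrite (min_idPr (ltW h)) (max_idPr _); last by rewrite (le_trans _ M0)// oppr_le0.
  rewrite ger0_norm ?subr_ge0; [by rewrite lerBlDr lerDl|exact: ltW].
move: h; rewrite ltr0_norm// ltrNr => h.
have xM : x <= M by rewrite (le_trans (ltW x0)).
rewrite (min_idPl xM) (max_idPl (ltW h)) opprK ler0_norm.
  by rewrite opprD lerBlDr lerDl.
by rewrite -lerBrDr sub0r ltW.
Qed.

Lemma trunc_pow k M x : 0 < k -> 0 < M -> M < `|x| ->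
  `|x| ^+ 2 <= `|x| `^ (2 + k) * M `^ (- k).
Proof.
move=> k0 M0 h; have x0 : 0 < `|x| by exact: lt_trans h.
rewrite powRD; last by rewrite (gt_eqF x0) implybT.
rewrite powR_mulrn// -mulrA ler_peMr ?exprn_ge0// powRN.
rewrite ler_pdivlMr ?powR_gt0// mul1r.
by apply: ge0_ler_powR; rewrite ?nnegrE; exact: ltW.
Qed.

(** If neither value exceeds M, nothing is clipped. Otherwise the difference is at most 2 |x| |y|,
    and the larger of the two absolute values exceeds M, so its square is paid for by its power 2 +
    k. *)
Lemma clip_diff_mul k M x y : 0 < k -> 0 < M ->
  `|x * y - clip M x * clip M y| <=
    2 * M `^ (- k) * (`|x| `^ (2 + k) + `|y| `^ (2 + k)).
Proof.
move=> k0 M0; have M0' := ltW M0.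
have K0 : 0 <= M `^ (- k) by exact: powR_ge0.
have tr (z z' : R) : `|z'| <= `|z| -> M < `|z| ->
    2 * (`|z| * `|z'|) <= 2 * M `^ (- k) * (`|z| `^ (2 + k) + `|z'| `^ (2 + k)).
  move=> zz zM; rewrite -mulrA ler_pM2l//.
  apply: le_trans (_ : `|z| ^+ 2 <= _); first by rewrite expr2 ler_wpM2l.
  apply: le_trans (trunc_pow k0 M0 zM) _.
  by rewrite mulrC ler_wpM2l// lerDl powR_ge0.
have d2 : `|x * y - clip M x * clip M y| <= 2 * (`|x| * `|y|).
  have -> : x * y - clip M x * clip M y =
    x * (y - clip M y) + (x - clip M x) * clip M y by ring.
  apply: le_trans (ler_normD _ _) _; rewrite !normrM mulr_natl mulr2n.
  apply: lerD; first by rewrite ler_wpM2l// clip_dist.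
  by rewrite ler_pM// ?clip_dist ?clip_norm.
have [hx|hx] := leP `|x| M; have [hy|hy] := leP `|y| M.
- rewrite !clip_id// subrr normr0 !mulr_ge0// addr_ge0// powR_ge0//.
- apply: le_trans d2 _; rewrite [`|x| * _]mulrC [`|x| `^ _ + _]addrC; apply: tr => //.
  exact: le_trans hx (ltW hy).
- apply: le_trans d2 _; apply: tr => //; exact: le_trans hy (ltW hx).
- apply: le_trans d2 _; have [xy|xy] := leP `|y| `|x|; first exact: tr.
  by rewrite [`|x| * _]mulrC [`|x| `^ _ + _]addrC; apply: tr => //; exact: ltW.
Qed.

Lemma clip_diff k M x : 0 < k -> 1 <= M ->
  `|x - clip M x| <= M `^ (- k) * `|x| `^ (2 + k).
Proof.
move=> k0 M1; have M0 : 0 < M by rewrite (lt_le_trans _ M1).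
have [h|h] := leP `|x| M.
  by rewrite clip_id// subrr normr0 mulr_ge0// powR_ge0.
apply: le_trans (clip_dist _ (ltW M0)) _.
rewrite mulrC; apply: le_trans (trunc_pow k0 M0 h).
by rewrite expr2 ler_peMl// (le_trans M1)// ltW.
Qed.

Lemma norm_le_pow k x : 0 < k -> `|x| <= 1 + `|x| `^ (2 + k).
Proof.
move=> k0; have [h|h] := leP `|x| 1.
  by apply: le_trans h _; rewrite lerDl powR_ge0.
apply: le_trans (_ : `|x| `^ (2 + k) <= _); last by rewrite lerDr.
by rewrite le1r_powR//; [exact: ltW|lra].
Qed.

Lemma sqr_le_pow k x : 0 < k -> x ^+ 2 <= 1 + `|x| `^ (2 + k).
Proof.
move=> k0; have [h|h] := leP `|x| 1.
  apply: le_trans (_ : 1 <= _); last by rewrite lerDl powR_ge0.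
  by rewrite -real_normK ?num_real// expr_le1.
apply: le_trans (_ : `|x| `^ (2 + k) <= _); last by rewrite lerDr.
rewrite -real_normK ?num_real// -powR_mulrn//.
by rewrite ler_powR//; [exact: ltW|lra].
Qed.

End Clip.

(** * Davydov's covariance inequality *)

Section Davydov.
Context {dT : measure_display} {T : measurableType dT} {R : realType}.
Variable P : probability T R.
Implicit Types U V W : T -> R.

Lemma measurable_clip d (T' : measurableType d) (M : R) (U : T' -> R) :
  measurable_fun setT U -> measurable_fun setT (fun w => clip M (U w)).
Proof.
by move=> mU; apply: measurable_maxr => //; exact: measurable_minr.
Qed.

Lemma measurable_powR_norm (U : T -> R) k : measurable_fun setT U ->
  measurable_fun setT (fun w => `|U w| `^ k).
Proof.
move=> mU; apply: (@measurableT_comp _ _ _ _ _ _ (@powR R ^~ k)) => //.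
exact: measurableT_comp.
Qed.

Lemma L1_pow k U : 0 < k -> measurable_fun setT U ->
  L1 P (fun w => `|U w| `^ (2 + k)) -> L1 P U /\ L1 P (fun w => U w ^+ 2).
Proof.
move=> k0 mU iU; have i1 : L1 P (fun w => 1 + `|U w| `^ (2 + k)).
  by apply: L1D => //; exact: L1_cst.
split.
  by apply: (L1_le mU _ i1) => w; exact: norm_le_pow.
apply: (L1_le _ _ i1) => [|w]; first exact: measurable_funX.
by rewrite ger0_norm ?sqr_ge0//; exact: sqr_le_pow.
Qed.

Lemma L1_mul U V : measurable_fun setT U -> measurable_fun setT V ->
  L1 P (fun w => U w ^+ 2) -> L1 P (fun w => V w ^+ 2) ->
  L1 P (fun w => U w * V w).
Proof.
move=> mU mV iU iV; apply: (L1_le _ _ (L1D iU iV)).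
  exact: measurable_funM.
move=> w; rewrite normrM -[U w ^+ 2]real_normK ?num_real//.
rewrite -[V w ^+ 2]real_normK ?num_real//.
have := sqr_ge0 (`|U w| - `|V w|); rewrite sqrrB => h.
have h0 : 0 <= `|U w| * `|V w| by rewrite mulr_ge0.
lra.
Qed.

(** Both variables are clipped at M = a^(-1/(2+k)), the level at which the bounded part M^2 a and
    the tail M^(-k) agree: both equal a^(k/(2+k)). The moment bound K enters through a polynomial
    because only finiteness for a fixed K matters later. The assumption a <= 1 gives M >= 1, which
    the tail bound for a single variable requires. *)
Lemma davydov G H k a K U V : (forall A, G A -> measurable A) ->
  (forall A, H A -> measurable A) -> mixing_le P G H a ->
  0 < k -> 0 < a -> a <= 1 -> gmeas G U -> gmeas H V ->
  L1 P (fun w => `|U w| `^ (2 + k)) -> L1 P (fun w => `|V w| `^ (2 + k)) ->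
  Ex P (fun w => `|U w| `^ (2 + k)) <= K ->
  Ex P (fun w => `|V w| `^ (2 + k)) <= K ->
  `|cov P U V| <= (4 + 6 * K + 2 * K ^+ 2) * a `^ (k / (2 + k)).
Proof.
move=> hG hH hmix k0 a0 a1 gU gV iU iV hU hV.
set M := a `^ (- (2 + k)^-1).
have q0 : 0 < 2 + k by rewrite addr_gt0.
have M0 : 0 < M by rewrite powR_gt0.
have M1 : 1 <= M.
  rewrite /M powRN invf_ge1 ?powR_gt0//.
  rewrite -[leRHS](powRr0 a); apply: ger_powR; first by rewrite a0.
  by rewrite invr_ge0 ltW.
have Mk : M `^ (- k) = a `^ (k / (2 + k)).
  by rewrite /M -powRrM mulrNN mulrC.
have M2 : M ^+ 2 * a = a `^ (k / (2 + k)).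
  rewrite -powR_mulrn ?ltW// /M -powRrM -{2}(powRr1 (ltW a0)) -powRD.
    by congr (_ `^ _); field; rewrite gt_eqF.
  by rewrite (gt_eqF a0) implybT.
set t := a `^ _ in Mk M2 *.
have t0 : 0 <= t by exact: powR_ge0.
have mU := gmeas_fun hG gU; have mV := gmeas_fun hH gV.
have [iU1 iU2] := L1_pow k0 mU iU; have [iV1 iV2] := L1_pow k0 mV iV.
have iUV := L1_mul mU mV iU2 iV2.
have cb W w : `|clip M (W w)| <= M by rewrite clip_le// ltW.
have mc W : measurable_fun setT W -> measurable_fun setT (fun w => clip M (W w)).
  exact: measurable_clip.
have gc Q W : gmeas Q W -> gmeas Q (fun w => clip M (W w)).
  exact: measurable_clip.
have ic W : measurable_fun setT W -> L1 P (fun w => clip M (W w)).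
  by move=> mW; apply: (@L1_bounded _ _ _ P _ M) => //; exact: mc.
have icc : L1 P (fun w => clip M (U w) * clip M (V w)).
  apply: (@L1_bounded _ _ _ P _ (M * M)).
    by apply: measurable_funM; exact: mc.
  by move=> w; rewrite normrM ler_pM.
have K0 : 0 <= K by apply: le_trans hU; apply: Ex_ge0 => w; exact: powR_ge0.
have b0 : `|cov P (fun w => clip M (U w)) (fun w => clip M (V w))| <= 4 * t.
  rewrite -M2 mulrA; apply: (cov_bounded hG hH hmix (gc _ _ gU) (gc _ _ gV)) => //;
    by move=> w; exact: cb.
have b1 : `|Ex P (fun w => U w * V w) -
            Ex P (fun w => clip M (U w) * clip M (V w))| <= 4 * K * t.
  rewrite -ExB//.
  apply: le_trans (Ex_norm_le_ae (Y := fun w =>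
     2 * M `^ (- k) * (`|U w| `^ (2 + k) + `|V w| `^ (2 + k))) _ _ _) _.
  - exact: L1_meas (L1B iUV icc).
  - by apply: L1Z; apply: L1D.
  - by apply: aeW => w; exact: clip_diff_mul.
  rewrite ExZ ?ExD//; last exact: L1D.
  rewrite Mk; have -> : 4 * K * t = 2 * t * (K + K) by ring.
  by rewrite ler_wpM2l ?mulr_ge0// lerD.
have b2 W : measurable_fun setT W -> L1 P W -> L1 P (fun w => `|W w| `^ (2 + k)) ->
    Ex P (fun w => `|W w| `^ (2 + k)) <= K ->
    `|Ex P W - Ex P (fun w => clip M (W w))| <= K * t.
  move=> mW i1 iW hW; rewrite -ExB//; last exact: ic.
  apply: le_trans (Ex_norm_le_ae (Y := fun w =>
     M `^ (- k) * `|W w| `^ (2 + k)) _ _ _) _.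
  - exact: L1_meas (L1B i1 (ic _ mW)).
  - exact: L1Z.
  - by apply: aeW => w; exact: clip_diff.
  by rewrite ExZ// Mk mulrC ler_wpM2r.
have b3 W' W : measurable_fun setT W' -> (forall w, `|W' w| <= `|W w|) ->
    L1 P (fun w => `|W w| `^ (2 + k)) ->
    Ex P (fun w => `|W w| `^ (2 + k)) <= K -> `|Ex P W'| <= 1 + K.
  move=> mW WW iW hW.
  apply: le_trans (Ex_norm_le_ae (Y := fun w => 1 + `|W w| `^ (2 + k)) _ _ _) _.
  - exact: mW.
  - by apply: L1D => //; exact: L1_cst.
  - by apply: aeW => w; apply: le_trans (WW w) _; exact: norm_le_pow.
  by rewrite ExD ?Ex_cst ?lerD2l//; exact: L1_cst.
set cU := (fun w => clip M (U w)) in b0 b1 *.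
set cV := (fun w => clip M (V w)) in b0 b1 *.
have -> : cov P U V = cov P cU cV +
   (Ex P (fun w => U w * V w) - Ex P (fun w => cU w * cV w)) -
   ((Ex P U - Ex P cU) * Ex P V + Ex P cU * (Ex P V - Ex P cV)).
  by rewrite /cov; ring.
apply: le_trans (ler_normB _ _) _.
have -> : (4 + 6 * K + 2 * K ^+ 2) * t =
  (4 * t + 4 * K * t) + ((K * t) * (1 + K) + (1 + K) * (K * t)) by ring.
apply: lerD; first by apply: le_trans (ler_normD _ _) _; exact: lerD.
apply: le_trans (ler_normD _ _) _; rewrite !normrM; apply: lerD; apply: ler_pM => //.
- exact: b2.
- exact: (b3 V V).
- by apply: (b3 cU U) => //; [exact: mc|move=> w; rewrite clip_norm// ltW].
- exact: b2.
Qed.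

End Davydov.

(** * Variance of a sum from covariance bounds *)

Section Variance.
Context {dT : measure_display} {T : measurableType dT} {R : realType}.
Variable P : probability T R.

(** Left of [i] (with [i] itself) and right of [i] the distances run without repetition through part
    of 0, ..., N - 1; hence the factor 2. *)
Lemma sum_absdist_le (g : nat -> R) B N i : (forall k, 0 <= g k) -> (i < N)%N ->
  \sum_(k < N) g k <= B -> \sum_(j < N) g `|i - j|%N <= 2 * B.
Proof.
move=> g0 iN hB; rewrite mulr_natl mulr2n.
have h n : (n <= N)%N -> \sum_(0 <= k < n) g k <= B.
  move=> nN; apply: le_trans hB; rewrite -(big_mkord xpredT g).
  by rewrite [leRHS](big_cat_nat (n := n))//= lerDl sumr_ge0.
rewrite -(big_mkord xpredT (fun j => g `|i - j|%N)) (big_cat_nat (n := i.+1))//=.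
apply: lerD.
  rewrite big_nat_rev /= add0n big_nat.
  rewrite (eq_bigr g) -?big_nat; first exact: h.
  by move=> j /andP[_ ji]; congr g; lia.
rewrite -{1}(add0n i.+1) big_addn big_nat.
rewrite (eq_bigr (fun j => g j.+1)); last by move=> j /andP[_ _]; congr g; lia.
rewrite -big_nat; have := h (N - i)%N (leq_subr _ _).
have -> : (N - i = (N - i.+1).+1)%N by lia.
by apply: le_trans; rewrite big_nat_recl// lerDr.
Qed.

Lemma variance_sum (V : nat -> T -> R) (g : nat -> R) B N :
  (forall k, 0 <= g k) -> \sum_(k < N) g k <= B ->
  (forall n, L1 P (V n)) -> (forall n m, L1 P (fun w => V n w * V m w)) ->
  (forall n m, `|cov P (V n) (V m)| <= g `|n - m|%N) ->
  L1 P (fun w => (\sum_(n < N) V n w - \sum_(n < N) Ex P (V n)) ^+ 2) /\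
  Ex P (fun w => (\sum_(n < N) V n w - \sum_(n < N) Ex P (V n)) ^+ 2)
    <= N%:R * (2 * B).
Proof.
move=> g0 hB iV iVV hc.
pose C n w := V n w - Ex P (V n).
have CCE n m : (fun w => C n w * C m w) = (fun w =>
    (V n w * V m w - Ex P (V m) * V n w) - (Ex P (V n) * V m w - Ex P (V n) * Ex P (V m))).
  by apply/funext => w; rewrite /C; ring.
have iCC n m : L1 P (fun w => C n w * C m w).
  rewrite CCE; do ?[exact: iVV|apply: L1B|exact: L1Z|exact: L1_cst].
have ECC n m : Ex P (fun w => C n w * C m w) = cov P (V n) (V m).
  rewrite CCE !ExB ?ExZ ?Ex_cst /cov//; first ring;
  do ?[exact: iVV|apply: L1B|exact: L1Z|exact: L1_cst].
have -> : (fun w => (\sum_(n < N) V n w - \sum_(n < N) Ex P (V n)) ^+ 2) =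
    (fun w => \sum_(n < N) \sum_(m < N) C n w * C m w).
  apply/funext => w; rewrite -sumrB expr2 mulr_suml; apply: eq_bigr => n _.
  by rewrite mulr_sumr.
split; first by apply: L1_sum => n _; apply: L1_sum.
rewrite Ex_sum; last by move=> n _; exact: L1_sum.
rewrite [leRHS](_ : _ = \sum_(n < N) (2 * B)); last first.
  by rewrite sumr_const card_ord mulr_natl.
apply: ler_sum => n _; rewrite Ex_sum//.
apply: le_trans (sum_absdist_le g0 (ltn_ord n) hB).
apply: ler_sum => m _; rewrite ECC; exact: le_trans (ler_norm _) (hc _ _).
Qed.

End Variance.

Section CovarianceExtra.
Context {dT : measure_display} {T : measurableType dT} {R : realType}.
Variable P : probability T R.
Implicit Types U V : T -> R.

Lemma cov_sym U V : cov P U V = cov P V U.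
Proof.
rewrite /cov mulrC; congr (_ - _); apply: eq_Ex => w; exact: mulrC.
Qed.

Lemma gmeas_sub G G' U : G `<=` G' -> gmeas G U -> @gmeas _ T R G' U.
Proof.
move=> GG gU _ B mB; have := gU measurableT B mB.
by apply: sub_sigma_algebra2.
Qed.

End CovarianceExtra.

(** * Elementary bounds on sums *)

Section SumLemmas.
Context {R : realType}.

Lemma sum_pairs (f : nat -> R) N :
  \sum_(k < N.*2) f k = \sum_(j < N) (f j.*2 + f j.*2.+1).
Proof.
elim: N => [|N IH]; first by rewrite !big_ord0.
by rewrite doubleS !big_ord_recr /= IH addrA.
Qed.

Lemma sum_le_double (f : nat -> R) N : (forall k, 0 <= f k) ->
  \sum_(k < N) f k <= \sum_(k < N.*2) f k.
Proof.
move=> f0; rewrite -addnn big_split_ord /= lerDl sumr_ge0//.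
Qed.

(** Doubling the range only adds nonnegative terms, and then every index is hit exactly twice. *)
Lemma sum_half_le (u : nat -> R) A N : (forall k, 0 <= u k) ->
  (forall N, \sum_(k < N) u k <= A) -> \sum_(k < N) u k./2 <= 2 * A.
Proof.
move=> u0 hA; apply: le_trans (@sum_le_double (fun k => u k./2) N _) _ => //.
rewrite (sum_pairs (fun k => u k./2)) (eq_bigr (fun j : 'I_N => 2 * u j)).
  by rewrite -mulr_sumr ler_pM2l//; exact: hA.
move=> j _; have -> : (j.*2./2 = j)%N by lia.
have -> : (j.*2.+1./2 = j)%N by lia.
by rewrite mulr_natl mulr2n.
Qed.

Lemma sum_cohalf_le (u : nat -> R) A N : (forall k, 0 <= u k) ->
  (forall N, \sum_(k < N) u k <= A) -> \sum_(k < N) u (k - k./2)%N <= 2 * A.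
Proof.
move=> u0 hA; apply: le_trans (@sum_le_double (fun k => u (k - k./2)%N) N _) _ => //.
rewrite (sum_pairs (fun k => u (k - k./2)%N)).
rewrite (eq_bigr (fun j : 'I_N => u j + u j.+1)); last first.
  by move=> j _; congr (u _ + u _); lia.
rewrite big_split /= mulr_natl mulr2n; apply: lerD; first exact: hA.
by have := hA N.+1; rewrite big_ord_recl; apply: le_trans; rewrite lerDr.
Qed.

Lemma sum_shift_le (u : nat -> R) A m N : (forall k, 0 <= u k) ->
  (forall N, \sum_(k < N) u k <= A) ->
  \sum_(j < N) (if (j < m)%N then 1 else u (j - m)%N) <= m%:R + A.
Proof.
move=> u0 hA; apply: le_trans (_ :
    \sum_(j < m + N) (if (j < m)%N then 1 else u (j - m)%N) <= _).
  rewrite addnC big_split_ord /= lerDl sumr_ge0// => j _.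
  by case: ifP => // _; rewrite ler01.
rewrite big_split_ord /=; apply: lerD.
  rewrite (eq_bigr (fun=> 1)) ?sumr_const ?card_ord// => j _.
  by rewrite ltn_ord.
rewrite (eq_bigr (fun j : 'I_N => u j)); first exact: hA.
move=> j _; by rewrite ltnNge leq_addr /= addnC addnK.
Qed.

Lemma sum_geo_le (s : R) N : 0 <= s -> s < 1 -> \sum_(k < N) s ^+ k <= (1 - s)^-1.
Proof.
move=> s0 s1; have h : 0 < 1 - s by rewrite subr_gt0.
rewrite -[leRHS]mul1r ler_pdivlMr// mulrC -opprB mulNr -subrX1 opprB.
by rewrite lerBlDr lerDl exprn_ge0.
Qed.

End SumLemmas.

(** * Processes approximated by functions of finitely many blocks *)

Section ApproxProcess.
Context {dT : measure_display} {T : measurableType dT} {R : realType}.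
Variable P : probability T R.
Variables past future : int -> set (set T).
Hypothesis hpast : forall n A, past n A -> measurable A.
Hypothesis hfut : forall n A, future n A -> measurable A.
Hypothesis past_mono : forall m n : int, m <= n -> past m `<=` past n.
Hypothesis fut_anti : forall m n : int, m <= n -> future n `<=` future m.
Variable al : nat -> R.
Hypothesis al_gt0 : forall k, 0 < al k.
Hypothesis al_le1 : forall k, al k <= 1.
Hypothesis mix : forall n (k : nat), mixing_le P (past n) (future (n + k%:Z)) (al k).
Variables (k A : R).
Hypothesis k0 : 0 < k.
Let th := k / (2 + k).
Hypothesis sumal : forall N, \sum_(j < N) al j `^ th <= A.
Variables (G : int -> T -> R) (KG s : R).
Hypothesis mG : forall n, measurable_fun setT (G n).
Hypothesis G0 : forall n w, 0 <= G n w.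
Hypothesis iG : forall n, L1 P (fun w => G n w `^ (2 + k)).
Hypothesis EG : forall n, Ex P (fun w => G n w `^ (2 + k)) <= KG.
Hypothesis s0 : 0 < s.
Hypothesis s1 : s < 1.

(** A form of near-epoch dependence: [Zr r n] is measurable both for the past at n and for the
    future from n - r, and the error s^r is relative to the random envelope [G], common to all
    depths r. *)
Record approx (c : R) (Z : int -> T -> R) (Zr : nat -> int -> T -> R) : Prop := {
  ap_meas : forall n, measurable_fun setT (Z n);
  ap_past : forall r n, gmeas (past n) (Zr r n);
  ap_fut : forall r n, gmeas (future (n - r%:Z)) (Zr r n);
  ap_dom : forall n, {ae P, forall w, `|Z n w| <= c * G n w};
  ap_domr : forall r n, {ae P, forall w, `|Zr r n w| <= c * G n w};
  ap_err : forall r n, {ae P, forall w, `|Z n w - Zr r n w| <= c * s ^+ r * G n w} }.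

Arguments ap_meas {c Z Zr} _ n.
Arguments ap_past {c Z Zr} _ r n.
Arguments ap_fut {c Z Zr} _ r n.
Arguments ap_dom {c Z Zr} _ n.
Arguments ap_domr {c Z Zr} _ r n.
Arguments ap_err {c Z Zr} _ r n.

Lemma KG_ge0 : 0 <= KG.
Proof. by apply: le_trans (EG 0); apply: Ex_ge0 => w; exact: powR_ge0. Qed.

Lemma L1_G1 n : L1 P (fun w => 1 + G n w `^ (2 + k)).
Proof. by apply: L1D => //; exact: L1_cst. Qed.

Lemma G_L1 n : L1 P (G n) /\ Ex P (G n) <= 1 + KG.
Proof.
have le w : G n w <= 1 + G n w `^ (2 + k).
  by have := norm_le_pow (G n w) k0; rewrite ger0_norm.
have i1 : L1 P (G n).
  by apply: (L1_le (mG n) _ (L1_G1 n)) => w; rewrite ger0_norm.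
split=> //; apply: le_trans (Ex_le i1 (L1_G1 n) le) _.
by rewrite ExD ?Ex_cst ?lerD2l//; exact: L1_cst.
Qed.

Lemma G_GG n m : L1 P (fun w => G n w * G m w) /\
  Ex P (fun w => G n w * G m w) <= 1 + KG.
Proof.
have le w : G n w * G m w <=
    1 + 2^-1 * (G n w `^ (2 + k) + G m w `^ (2 + k)).
  have h1 := sqr_le_pow (G n w) k0; have h2 := sqr_le_pow (G m w) k0.
  rewrite ger0_norm// in h1; rewrite ger0_norm// in h2.
  have := sqr_ge0 (G n w - G m w); rewrite sqrrB => h.
  lra.
have i1 : L1 P (fun w => 1 + 2^-1 * (G n w `^ (2 + k) + G m w `^ (2 + k))).
  by apply: L1D; [exact: L1_cst|apply: L1Z; exact: L1D].
have i2 : L1 P (fun w => G n w * G m w).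
  apply: (L1_le _ _ i1) => [|w]; first exact: measurable_funM.
  by rewrite ger0_norm// mulr_ge0.
split=> //; apply: le_trans (Ex_le i2 i1 le) _.
rewrite ExD ?Ex_cst; [|exact: L1_cst|by apply: L1Z; exact: L1D].
rewrite ExZ ?ExD//; last exact: L1D.
have := EG n; have := EG m; lra.
Qed.

Lemma dom_pow c n (U : T -> R) : 0 <= c -> measurable_fun setT U ->
  {ae P, forall w, `|U w| <= c * G n w} ->
  L1 P (fun w => `|U w| `^ (2 + k)) /\
  Ex P (fun w => `|U w| `^ (2 + k)) <= c `^ (2 + k) * KG.
Proof.
move=> c0 mU hU.
have h : {ae P, forall w, `|U w| `^ (2 + k) <= c `^ (2 + k) * G n w `^ (2 + k)}.
  apply: filterS hU => w hw; rewrite -powRM//.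
  by apply: ge0_ler_powR; rewrite ?nnegrE ?addr_ge0 ?mulr_ge0// ltW.
have i : L1 P (fun w => `|U w| `^ (2 + k)).
  apply: (L1_le_ae _ _ (L1Z (c `^ (2 + k)) (iG n))).
    exact: measurable_powR_norm.
  by apply: filterS h => w hw; rewrite ger0_norm ?powR_ge0.
split=> //; apply: le_trans (Ex_le_ae i (L1Z _ (iG n)) h) _.
by rewrite ExZ// ler_wpM2l// powR_ge0.
Qed.

Lemma dom_L1 c n (U : T -> R) : measurable_fun setT U ->
  {ae P, forall w, `|U w| <= c * G n w} -> L1 P U.
Proof.
by move=> mU hU; apply: (L1_le_ae mU hU); apply: L1Z; case: (G_L1 n).
Qed.

Lemma dom_Ex c n (U : T -> R) : 0 <= c -> measurable_fun setT U ->
  {ae P, forall w, `|U w| <= c * G n w} -> `|Ex P U| <= c * (1 + KG).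
Proof.
move=> c0 mU hU; have [iGn EGn] := G_L1 n.
apply: le_trans (Ex_norm_le_ae mU (L1Z c iGn) hU) _.
by rewrite ExZ// ler_wpM2l.
Qed.

Lemma dom_mul c c' n m (U V : T -> R) : measurable_fun setT U ->
  measurable_fun setT V -> {ae P, forall w, `|U w| <= c * G n w} ->
  {ae P, forall w, `|V w| <= c' * G m w} -> L1 P (fun w => U w * V w).
Proof.
move=> mU mV hU hV; have [iGG _] := G_GG n m.
apply: (L1_le_ae (measurable_funM mU mV) _ (L1Z (c * c') iGG)).
near=> w; rewrite normrM mulrACA; apply: ler_pM => //.
  by near: w.
by near: w.
Unshelve. all: by end_near. Qed.

Section Pair.
Variables (c : R) (Z Z' : int -> T -> R) (Zr Z'r : nat -> int -> T -> R).
Hypothesis c0 : 0 <= c.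
Hypotheses (aZ : approx c Z Zr) (aZ' : approx c Z' Z'r).

Lemma apr_meas c' V Vr r n : approx c' V Vr -> measurable_fun setT (Vr r n).
Proof. by move=> aV; apply: (gmeas_fun (G := past n)); [exact: hpast|exact: ap_past aV r n]. Qed.

Lemma prod_L1 n m : L1 P (fun w => Z n w * Z' m w).
Proof. exact: dom_mul (ap_meas aZ n) (ap_meas aZ' m) (ap_dom aZ n) (ap_dom aZ' m). Qed.

Lemma prodr_L1 r n m : L1 P (fun w => Zr r n w * Z'r r m w).
Proof.
exact: dom_mul (apr_meas r n aZ) (apr_meas r m aZ') (ap_domr aZ r n) (ap_domr aZ' r m).
Qed.

Lemma prod_err r n m :
  Ex P (fun w => `|Z n w * Z' m w - Zr r n w * Z'r r m w|) <=
    2 * c ^+ 2 * s ^+ r * (1 + KG).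
Proof.
have [iGG EGG] := G_GG n m.
have i := L1B (prod_L1 n m) (prodr_L1 r n m).
apply: le_trans (Ex_le_ae (L1_norm i) (L1Z (2 * c ^+ 2 * s ^+ r) iGG) _) _.
  near=> w.
  have -> : Z n w * Z' m w - Zr r n w * Z'r r m w =
    (Z n w - Zr r n w) * Z' m w + Zr r n w * (Z' m w - Z'r r m w) by ring.
  apply: le_trans (ler_normD _ _) _; rewrite !normrM.
  have -> : 2 * c ^+ 2 * s ^+ r * (G n w * G m w) =
    (c * s ^+ r * G n w) * (c * G m w) + (c * G n w) * (c * s ^+ r * G m w) by ring.
  apply: lerD; apply: ler_pM => //.
  - by near: w; exact: (ap_err aZ).
  - by near: w; exact: (ap_dom aZ').
  - by near: w; exact: (ap_domr aZ).
  - by near: w; exact: (ap_err aZ').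
rewrite ExZ// ler_wpM2l//.
by rewrite !mulr_ge0// exprn_ge0// ltW.
Unshelve. all: by end_near. Qed.

Lemma cov_err r n m :
  `|cov P (Z n) (Z' m) - cov P (Zr r n) (Z'r r m)| <=
    4 * c ^+ 2 * s ^+ r * (1 + KG) ^+ 2.
Proof.
have K1 : 1 <= 1 + KG by rewrite lerDl KG_ge0.
have K0 : 0 <= 1 + KG by rewrite (le_trans _ K1).
have sr0 : 0 <= s ^+ r by rewrite exprn_ge0// ltW.
have i1 := dom_L1 (ap_meas aZ n) (ap_dom aZ n).
have i1' := dom_L1 (ap_meas aZ' m) (ap_dom aZ' m).
have i2 := dom_L1 (apr_meas r n aZ) (ap_domr aZ r n).
have i2' := dom_L1 (apr_meas r m aZ') (ap_domr aZ' r m).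
have -> : cov P (Z n) (Z' m) - cov P (Zr r n) (Z'r r m) =
  (Ex P (fun w => Z n w * Z' m w) - Ex P (fun w => Zr r n w * Z'r r m w)) -
  ((Ex P (Z n) - Ex P (Zr r n)) * Ex P (Z' m) +
    Ex P (Zr r n) * (Ex P (Z' m) - Ex P (Z'r r m))).
  by rewrite /cov; ring.
apply: le_trans (ler_normB _ _) _.
apply: le_trans (_ : 2 * c ^+ 2 * s ^+ r * (1 + KG) + 2 * c ^+ 2 * s ^+ r * (1 + KG) ^+ 2 <= _).
  apply: lerD.
    rewrite -ExB; [|exact: prod_L1|exact: prodr_L1].
    apply: le_trans (Ex_norm _) _; first exact: L1B (prod_L1 n m) (prodr_L1 r n m).
    exact: prod_err.
  apply: le_trans (ler_normD _ _) _; rewrite !normrM.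
  have -> : 2 * c ^+ 2 * s ^+ r * (1 + KG) ^+ 2 =
    (c * s ^+ r * (1 + KG)) * (c * (1 + KG)) +
    (c * (1 + KG)) * (c * s ^+ r * (1 + KG)) by ring.
  apply: lerD; apply: ler_pM => //.
  - rewrite -ExB//; apply: (dom_Ex _ _ (ap_err aZ r n)); first by rewrite mulr_ge0.
    exact: L1_meas (L1B i1 i2).
  - exact: dom_Ex (ap_meas aZ' m) (ap_dom aZ' m).
  - exact: dom_Ex (apr_meas r n aZ) (ap_domr aZ r n).
  - rewrite -ExB//; apply: (dom_Ex _ _ (ap_err aZ' r m)); first by rewrite mulr_ge0.
    exact: L1_meas (L1B i1' i2').
have h : 2 * c ^+ 2 * s ^+ r * (1 + KG) <= 2 * c ^+ 2 * s ^+ r * (1 + KG) ^+ 2.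
  by apply: ler_wpM2l; [rewrite !mulr_ge0// exprn_ge0|rewrite expr2 ler_peMr].
have -> : 4 * c ^+ 2 * s ^+ r * (1 + KG) ^+ 2 =
  2 * c ^+ 2 * s ^+ r * (1 + KG) ^+ 2 + 2 * c ^+ 2 * s ^+ r * (1 + KG) ^+ 2 by ring.
by rewrite lerD2r.
Qed.

End Pair.

(** The lag is shared out: h./2 is spent as depth of approximation and h - h./2 remains as mixing
    gap. The first term is Davydov's bound, the second the approximation error. *)
Definition cbound (c : R) (h : nat) : R :=
  let K := c `^ (2 + k) * KG in
  (4 + 6 * K + 2 * K ^+ 2) * al (h - h./2)%N `^ th +
  4 * c ^+ 2 * (1 + KG) ^+ 2 * s ^+ h./2.

Definition csum (c : R) : R :=
  let K := c `^ (2 + k) * KG in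
  (4 + 6 * K + 2 * K ^+ 2) * (2 * A) +
  4 * c ^+ 2 * (1 + KG) ^+ 2 * (2 * (1 - s)^-1).

Lemma cpow_ge0 (c : R) : 0 <= c `^ (2 + k) * KG.
Proof. by rewrite mulr_ge0 ?powR_ge0// KG_ge0. Qed.

Lemma dpoly_ge0 (K : R) : 0 <= K -> 0 <= 4 + 6 * K + 2 * K ^+ 2.
Proof.
by move=> K0; apply: addr_ge0; [apply: addr_ge0|]; rewrite ?mulr_ge0 ?sqr_ge0.
Qed.

Lemma cbound_ge0 c h : 0 <= cbound c h.
Proof.
have h0 := dpoly_ge0 (cpow_ge0 c); have K0 := KG_ge0.
rewrite /cbound addr_ge0//; first by rewrite mulr_ge0// powR_ge0.
have sh : 0 <= s ^+ h./2 by rewrite exprn_ge0// ltW.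
by rewrite mulr_ge0// mulr_ge0 ?sqr_ge0// mulr_ge0 ?sqr_ge0.
Qed.

Lemma cbound_sum c N : \sum_(h < N) cbound c h <= csum c.
Proof.
have h0 := dpoly_ge0 (cpow_ge0 c).
rewrite /cbound /csum big_split /= -!mulr_sumr; apply: lerD; apply: ler_wpM2l.
- exact: h0.
- by apply: (sum_cohalf_le (u := fun j => al j `^ th)) => // j; exact: powR_ge0.
- by rewrite mulr_ge0 ?sqr_ge0// mulr_ge0 ?sqr_ge0.
- apply: (sum_half_le (u := fun j => s ^+ j)) => [j|M]; first by rewrite exprn_ge0// ltW.
  by apply: sum_geo_le => //; exact: ltW.
Qed.

Lemma cov_approx c Z Zr Z' Z'r (n : int) (h : nat) : 0 <= c ->
  approx c Z Zr -> approx c Z' Z'r ->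
  `|cov P (Z (n + h%:Z)) (Z' n)| <= cbound c h.
Proof.
move=> c0 aZ aZ'.
set r := h./2.
rewrite -[cov _ _ _](subrK (cov P (Zr r (n + h%:Z)) (Z'r r n))).
rewrite addrC; apply: le_trans (ler_normD _ _) _; apply: lerD; last first.
  apply: le_trans (cov_err c0 aZ aZ' r _ _) _.
  by rewrite le_eqVlt; apply/orP; left; apply/eqP; rewrite /r; ring.
(* [mixing_le] is oriented: the factor measurable for the past has to come first. *)
rewrite cov_sym.
have [i1 E1] := dom_pow c0 (apr_meas r n aZ') (ap_domr aZ' r n).
have [i2 E2] := dom_pow c0 (apr_meas r (n + h%:Z) aZ) (ap_domr aZ r (n + h%:Z)).
apply: (davydov (G := past n) (H := future (n + (h - r)%N%:Z))
   (@hpast _) (@hfut _) (@mix _ _)) => //.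
  exact: ap_past aZ' r n.
have -> : n + (h - r)%N%:Z = n + h%:Z - r%:Z.
  by rewrite -subzn ?addrA// leq_half_double -addnn -addnS leq_addr.
exact: ap_fut aZ r _.
Qed.

Lemma cov_approx_abs c Z Zr (n m : nat) : 0 <= c -> approx c Z Zr ->
  `|cov P (Z n%:Z) (Z m%:Z)| <= cbound c `|n - m|%N.
Proof.
move=> c0 aZ; wlog mn : n m / (m <= n)%N.
  move=> H; case/orP: (leq_total m n) => h; first exact: H.
  by rewrite cov_sym distnC; exact: H.
have -> : n%:Z = m%:Z + (n - m)%N%:Z by lia.
have -> : `|(m%:Z + (n - m)%N%:Z - m%:Z)%R|%N = (n - m)%N by lia.
exact: (cov_approx _ _ c0 aZ aZ).
Qed.

Lemma variance_approx c Z Zr N : 0 <= c -> approx c Z Zr ->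
  let D w := \sum_(n < N) Z n%:Z w - \sum_(n < N) Ex P (Z n%:Z) in
  L1 P (fun w => D w ^+ 2) /\ Ex P (fun w => D w ^+ 2) <= N%:R * (2 * csum c).
Proof.
move=> c0 aZ; apply: (variance_sum (V := fun n => Z n%:Z) (g := cbound c)).
- exact: cbound_ge0.
- exact: cbound_sum.
- by move=> n; exact: dom_L1 (ap_meas aZ _) (ap_dom aZ _).
- by move=> n m; exact: (prod_L1 aZ aZ).
- by move=> n m; exact: cov_approx_abs c0 aZ.
Qed.

(** Since th <= 1, the assumed summability of the powers gives that of the coefficients themselves,
    the form in which bounded variables use it. *)
Lemma al_le_th j : al j <= al j `^ th.
Proof.
apply: ger1_powR; first by rewrite al_gt0 al_le1.
by rewrite /th ler_pdivrMr ?addr_gt0// mul1r lerDr.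
Qed.

(** The clipped products are bounded by M^2, so no moment of a product of scores is needed. [V j]
    lies in the past at j + h and in the future from j - r: up to distance h + r covariances are
    bounded trivially, beyond it by mixing over the remaining gap. *)
Lemma avg_clip c Z Zr Z' Z'r M (h r N : nat) : 0 <= c -> 0 < M ->
  approx c Z Zr -> approx c Z' Z'r ->
  let V j w := clip M (Zr r (j%:Z + h%:Z) w) * clip M (Z'r r j%:Z w) in
  let D w := \sum_(j < N) V j w - \sum_(j < N) Ex P (V j) in
  L1 P (fun w => D w ^+ 2) /\
  Ex P (fun w => D w ^+ 2) <= N%:R * (2 * (4 * M ^+ 4 * ((h + r)%:R + A))).
Proof.
move=> c0 M0 aZ aZ' V D.
pose gg j := 4 * M ^+ 4 * (if (j < h + r)%N then 1 else al (j - (h + r))%N).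
have M4 : 0 < 4 * M ^+ 4 by rewrite mulr_gt0// exprn_gt0.
have pV j : gmeas (past (j%:Z + h%:Z)) (V j).
  apply: measurable_funM; apply: measurable_clip.
    exact: ap_past aZ r _.
  have hj : j%:Z <= j%:Z + h%:Z by rewrite lerDl.
  exact: (gmeas_sub (past_mono hj) (ap_past aZ' r j%:Z)).
have fV j : gmeas (future (j%:Z - r%:Z)) (V j).
  apply: measurable_funM; apply: measurable_clip.
    have hj : j%:Z - r%:Z <= j%:Z + h%:Z - r%:Z by rewrite lerD2r lerDl.
    exact: (gmeas_sub (fut_anti hj) (ap_fut aZ r _)).
  exact: ap_fut aZ' r _.
have mV j : measurable_fun setT (V j) by exact: gmeas_fun (@hpast _) (pV j).
have M2 : 0 < M ^+ 2 by rewrite exprn_gt0.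
have bV j w : `|V j w| <= M ^+ 2.
  by rewrite normrM expr2 ler_pM// clip_le// ltW.
have bVV i j w : `|V i w * V j w| <= M ^+ 4.
  by rewrite normrM (exprD M 2 2) ler_pM.
apply: (variance_sum (g := gg)).
- move=> j; rewrite /gg mulr_ge0// ?(ltW M4)//; case: ifP => // _; exact: ltW.
- rewrite -mulr_sumr ler_pM2l//.
  apply: (sum_shift_le (u := al)) => [j|N']; first exact: ltW.
  by apply: le_trans (sumal N'); apply: ler_sum => j _; exact: al_le_th.
- by move=> j; exact: (L1_bounded P (mV j) (bV j)).
- by move=> i j; exact: (L1_bounded P (measurable_funM (mV i) (mV j)) (bVV i j)).
have cs i j : (j <= i)%N -> `|cov P (V i) (V j)| <= gg (i - j)%N.
  move=> ji; rewrite /gg; case: ltnP => hr.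
    rewrite mulr1; apply: le_trans (ler_normB _ _) _.
    apply: le_trans (_ : M ^+ 4 + M ^+ 2 * M ^+ 2 <= _).
      apply: lerD; first by apply: Ex_bounded => //; exact: measurable_funM.
      by rewrite normrM ler_pM// Ex_bounded.
    have : 0 <= M ^+ 4 by rewrite exprn_ge0// ltW.
    rewrite -exprD /=; lra.
  rewrite cov_sym.
  have -> : M ^+ 4 = (M ^+ 2) ^+ 2 by rewrite -exprM.
  apply: (cov_bounded (G := past (j%:Z + h%:Z)) (H := future (i%:Z - r%:Z))) => //.
  - exact: hpast.
  - exact: hfut.
  - have -> : i%:Z - r%:Z = j%:Z + h%:Z + (i - j - (h + r))%N%:Z by lia.
    exact: mix.
move=> i j; case/orP: (leq_total j i) => ij.
  by rewrite distnEl//; exact: cs.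
by rewrite cov_sym distnEr//; exact: cs.
Qed.

Lemma clip_err c Z Zr Z' Z'r M (r : nat) (n m : int) : 0 <= c -> 0 < M ->
  approx c Z Zr -> approx c Z' Z'r ->
  let V w := clip M (Zr r n w) * clip M (Z'r r m w) in
  L1 P (fun w => Z n w * Z' m w - V w) /\
  Ex P (fun w => `|Z n w * Z' m w - V w|) <=
    2 * c ^+ 2 * s ^+ r * (1 + KG) + 4 * (M `^ (- k) * (c `^ (2 + k) * KG)).
Proof.
move=> c0 M0 aZ aZ' V.
have [i1 E1] := dom_pow c0 (apr_meas r n aZ) (ap_domr aZ r n).
have [i2 E2] := dom_pow c0 (apr_meas r m aZ') (ap_domr aZ' r m).
have mV : measurable_fun setT V.
  by apply: measurable_funM; apply: measurable_clip;
    [exact: (apr_meas r n aZ)|exact: (apr_meas r m aZ')].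
have iV : L1 P V.
  apply: (L1_bounded P (M := M * M)) => // w.
  by rewrite normrM ler_pM// clip_le// ltW.
have iZ := prod_L1 aZ aZ' n m; have iZr := prodr_L1 aZ aZ' r n m.
have iB := L1B iZ iV.
split=> //.
pose B w := `|Z n w * Z' m w - Zr r n w * Z'r r m w| +
  2 * M `^ (- k) * (`|Zr r n w| `^ (2 + k) + `|Z'r r m w| `^ (2 + k)).
have iBB : L1 P B.
  by apply: L1D; [exact: L1_norm (L1B iZ iZr)|apply: L1Z; exact: L1D].
have h w : `|Z n w * Z' m w - V w| <= B w.
  rewrite -(subrKA (Zr r n w * Z'r r m w)).
  by apply: le_trans (ler_normD _ _) _; rewrite lerD2l; exact: clip_diff_mul.
apply: le_trans (Ex_le (L1_norm iB) iBB h) _.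
rewrite ExD; [|exact: L1_norm (L1B iZ iZr)|by apply: L1Z; exact: L1D].
apply: lerD; first exact: prod_err.
rewrite ExZ ?ExD//; last exact: L1D.
set q := M `^ _; have q0 : 0 <= q by exact: powR_ge0.
have := ler_wpM2l q0 E1; have := ler_wpM2l q0 E2; lra.
Qed.

(** The centred sum is the clipped centred sum plus the clipping errors plus their means. The first
    is bounded in mean by its standard deviation, at most [a]; the other two cost [e] per term each,
    hence the factor 2. *)
Lemma avg_prod c Z Zr Z' Z'r M (h r N : nat) a : 0 <= c -> 0 < M -> 0 < a ->
  approx c Z Zr -> approx c Z' Z'r ->
  N%:R * (2 * (4 * M ^+ 4 * ((h + r)%:R + A))) <= a ^+ 2 ->
  let W j w := Z (j%:Z + h%:Z) w * Z' j%:Z w in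
  L1 P (fun w => \sum_(j < N) W j w - \sum_(j < N) Ex P (W j)) /\
  Ex P (fun w => `|\sum_(j < N) W j w - \sum_(j < N) Ex P (W j)|) <=
    a + N%:R * (2 * (2 * c ^+ 2 * s ^+ r * (1 + KG) +
                     4 * (M `^ (- k) * (c `^ (2 + k) * KG)))).
Proof.
move=> c0 M0 a0 aZ aZ' ha W; set e := _ + 4 * _.
pose V (j : nat) w := clip M (Zr r (j%:Z + h%:Z) w) * clip M (Z'r r j%:Z w).
have [iD ED] := avg_clip h r N c0 M0 aZ aZ'.
rewrite /= -/V in iD ED.
have iW (j : nat) : L1 P (W j) by exact: (prod_L1 aZ aZ').
have iWV (j : nat) : L1 P (fun w => W j w - V j w) /\
    Ex P (fun w => `|W j w - V j w|) <= e by exact: clip_err.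
have iV (j : nat) : L1 P (V j).
  have := L1B (iW j) (iWV j).1; congr L1; apply/funext => w; ring.
have iSW : L1 P (fun w => \sum_(j < N) W j w - \sum_(j < N) Ex P (W j)).
  by apply: L1B; [exact: L1_sum|exact: L1_cst].
split=> //.
set DV := fun w => \sum_(j < N) V j w - \sum_(j < N) Ex P (V j).
have iDV : L1 P DV by apply: L1B; [exact: L1_sum|exact: L1_cst].
have EDV : Ex P (fun w => `|DV w|) <= a.
  have [] := @Ex_CS _ _ _ P DV (cst 1) a 1 a0 ltr01 (L1_meas iDV)
    (measurable_cst _) iD.
  - by under eq_fun do rewrite expr1n; exact: L1_cst.
  - exact: le_trans ED ha.
  - by under eq_fun do rewrite /cst expr1n; rewrite Ex_cst expr1n.
  by move=> _; rewrite mulr1; apply: le_trans; rewrite le_eqVlt; apply/orP; left;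
    apply/eqP; apply: eq_Ex => w /=; rewrite mulr1.
pose B w := `|DV w| + (\sum_(j < N) `|W j w - V j w| + N%:R * e).
have iS : L1 P (fun w => \sum_(j < N) `|W j w - V j w|).
  by apply: L1_sum => j _; apply: L1_norm; exact: (iWV j).1.
have iB : L1 P B.
  by apply: L1D; [exact: L1_norm|apply: L1D => //; exact: L1_cst].
have EWV (j : nat) : `|Ex P (V j) - Ex P (W j)| <= e.
  rewrite distrC -ExB//; apply: le_trans (iWV j).2; exact: Ex_norm (iWV j).1.
have hB w : `|\sum_(j < N) W j w - \sum_(j < N) Ex P (W j)| <= B w.
  have -> : \sum_(j < N) W j w - \sum_(j < N) Ex P (W j) =
    DV w + (\sum_(j < N) (W j w - V j w) + \sum_(j < N) (Ex P (V j) - Ex P (W j))).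
    by rewrite /DV !sumrB; ring.
  apply: le_trans (ler_normD _ _) _; rewrite /B lerD2l.
  apply: le_trans (ler_normD _ _) _; apply: lerD.
    exact: ler_norm_sum.
  apply: le_trans (ler_norm_sum _ _ _) _.
  apply: le_trans (_ : \sum_(j < N) e <= _).
    by apply: ler_sum => j _.
  by rewrite sumr_const card_ord mulr_natl.
apply: le_trans (Ex_le (L1_norm iSW) iB hB) _.
rewrite ExD; [|exact: L1_norm|apply: L1D => //; exact: L1_cst].
apply: lerD => //.
rewrite ExD//; last exact: L1_cst.
rewrite Ex_cst Ex_sum; last by move=> j _; apply: L1_norm; exact: (iWV j).1.
rewrite [leRHS](_ : _ = N%:R * e + N%:R * e); last by ring.
rewrite lerD2r.
apply: le_trans (_ : \sum_(j < N) e <= _).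
  by apply: ler_sum => j _; exact: (iWV j).2.
by rewrite sumr_const card_ord mulr_natl.
Qed.

End ApproxProcess.

(** * Null solutions of constant linear recursions decay geometrically *)

Section GeometricDecay.
Context {R : realType}.
Local Notation C := R[i].
Implicit Types (u v : nat -> C) (K r : R).

Local Notation nc := (@Normc.normc R).

Lemma nc_ge0 (x : C) : 0 <= nc x.
Proof. by case: x => a b; exact: sqrtr_ge0. Qed.

Lemma nc_real (a : R) : nc (real_complex R a) = `|a|.
Proof. by rewrite /Normc.normc /= expr0n addr0 sqrtr_sqr. Qed.

Lemma nc_sum I (s : seq I) (F : I -> C) :
  nc (\sum_(i <- s) F i) <= \sum_(i <- s) nc (F i).
Proof.
elim: s => [|i s IH]; first by rewrite !big_nil Normc.normc0.
rewrite !big_cons; apply: le_trans (le_normcD _ _) _.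
by rewrite lerD2l.
Qed.

Definition geo (n : nat -> R) := exists K r, [/\ 0 <= K, 0 <= r, r < 1 &
  forall k, n k <= K * r ^+ k].

(** A dichotomy on z. If |z| < 1 the recursion u_(n+1) = z u_n + v_n is contracting and is solved
    forwards; if |z| >= 1 it is solved backwards from infinity, where u vanishes. *)
Lemma geo_scalar u v (z : C) : (forall n, v n = u n.+1 - z * u n) ->
  geo (fun n => nc (v n)) ->
  (forall e, 0 < e -> exists N, forall n, (N <= n)%N -> nc (u n) <= e) ->
  geo (fun n => nc (u n)).
Proof.
move=> uv [K [r [K0 r0 r1 hv]]] u0.
have [z1|z1] := ltP (nc z) 1.
  have zz := nc_ge0 z.
  have d0 : 0 < (1 - r) * (1 - nc z) by rewrite mulr_gt0// subr_gt0.
  (* This rate is at least (1 + r) / 2 and at least (1 + |z|) / 2, so it exceeds both r and |z| and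
     is still below 1. *)
  pose r' := 1 - (1 - r) * (1 - nc z) / 2.
  have d1 : (1 - r) * (1 - nc z) <= 1 - r by rewrite mulrBr mulr1 lerBlDr lerDl mulr_ge0 ?subr_ge0 ?(ltW r1).
  have d2 : (1 - r) * (1 - nc z) <= 1 - nc z by rewrite mulrBl mul1r lerBlDr lerDl mulr_ge0 ?subr_ge0 ?(ltW z1).
  have rr' : r <= r' by rewrite /r'; lra.
  have zr' : nc z < r' by rewrite /r'; lra.
  have r'1 : r' < 1 by rewrite /r'; lra.
  have w0 : 0 < r' - nc z by rewrite subr_gt0.
  pose K' := K / (r' - nc z) + nc (u 0%N).
  have K'0 : 0 <= K' by rewrite addr_ge0 ?nc_ge0// divr_ge0// ltW.
  exists K', r'; split => //; first exact: le_trans r0 rr'.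
  elim=> [|n IH].
    by rewrite expr0 mulr1 /K' lerDr divr_ge0// ltW.
  have -> : u n.+1 = z * u n + v n by rewrite uv addrC subrK.
  apply: le_trans (le_normcD _ _) _.
  rewrite Normc.normcM.
  have h1 : nc z * nc (u n) <= nc z * (K' * r' ^+ n) by rewrite ler_wpM2l.
  have h2 : nc (v n) <= K * r' ^+ n.
    apply: le_trans (hv n) _; rewrite ler_wpM2l// lerXn2r// nnegrE//.
    exact: le_trans rr'.
  have h3 : K <= K' * (r' - nc z).
    by rewrite /K' mulrDl divfK ?gt_eqF// lerDl mulr_ge0 ?nc_ge0// ltW.
  have r'n : 0 <= r' ^+ n by rewrite exprn_ge0// (le_trans r0).
  have h4 := ler_wpM2r r'n h3.
  rewrite exprS; apply: le_trans (lerD h1 h2) _.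
  have -> : K' * (r' * r' ^+ n) = nc z * (K' * r' ^+ n) + K' * (r' - nc z) * r' ^+ n by ring.
  by rewrite lerD2l.
have r1' : 0 < 1 - r by rewrite subr_gt0.
exists (K / (1 - r)), r; split => //; first by rewrite divr_ge0// ltW.
move=> n; apply/ler_addgt0Pr => /= e /u0[N hN].
(* From |z| >= 1: |u_n| <= |z u_n| <= |u_(n+1)| + |v_n|, iterated m times. *)
have step m : nc (u n) <= nc (u (n + m)%N) + K * r ^+ n * \sum_(j < m) r ^+ j.
  elim: m => [|m IH]; first by rewrite addn0 big_ord0 mulr0 addr0.
  apply: le_trans IH _; rewrite big_ord_recr /= mulrDr [X in _ <= _ + X]addrC addrA.
  rewrite lerD2r -mulrA -exprD.
  apply: le_trans (_ : nc z * nc (u (n + m)%N) <= _).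
    by rewrite ler_peMl ?nc_ge0.
  rewrite -Normc.normcM.
  have -> : z * u (n + m)%N = u (n + m.+1)%N - v (n + m)%N.
    by rewrite uv addnS opprB addrCA subrr addr0.
  apply: le_trans (le_normcD _ _) _.
  by rewrite normcN lerD.
apply: le_trans (step N) _; rewrite addrC; apply: lerD; last first.
  by apply: hN; exact: leq_addl.
rewrite -!mulrA ler_wpM2l// mulrC ler_wpM2r ?exprn_ge0//.
exact: sum_geo_le.
Qed.

Lemma geo_fin (I : finType) (f : I -> nat -> R) : (forall i, geo (f i)) ->
  exists K r, [/\ 0 <= K, 0 <= r, r < 1 & forall i k, f i k <= K * r ^+ k].
Proof.
move=> h.
have [Kf hK] := fin_all_exists h; have [rf hf] := fin_all_exists hK.
exists (\sum_i Kf i), (\big[Num.max/0]_i rf i); split.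
- by apply: sumr_ge0 => i _; case: (hf i).
- exact: bigmax_ge_id.
- by apply/bigmax_ltP; split=> // i _; case: (hf i).
move=> i k; have [K0 r0 r1 /(_ k) hk] := hf i.
apply: le_trans hk _; apply: ler_pM => //; first exact: exprn_ge0.
  by rewrite (bigD1 i)//= lerDl sumr_ge0// => j _; case: (hf j).
by rewrite lerXn2r// ?nnegrE ?bigmax_ge_id// le_bigmax.
Qed.

Definition to0 (f : nat -> R) := forall e : R, 0 < e ->
  exists N, forall n, (N <= n)%N -> f n <= e.

Lemma to0_sum (I : finType) (f : I -> nat -> R) (c : I -> R) :
  (forall i, 0 <= c i) -> (forall i n, 0 <= f i n) -> (forall i, to0 (f i)) ->
  to0 (fun n => \sum_i f i n * c i).
Proof.
move=> c0 f0 h e e0.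
pose S := 1 + \sum_i c i.
have S0 : 0 < S by rewrite ltr_wpDr// sumr_ge0.
have eS : 0 < e / S by rewrite divr_gt0.
have [Nf hN] := fin_all_exists (fun i => h i _ eS).
exists (\max_i Nf i)%N => n hn.
apply: le_trans (_ : \sum_i e / S * c i <= _).
  apply: ler_sum => i _; rewrite ler_wpM2r//; apply: hN.
  exact: leq_trans (leq_bigmax i) hn.
by rewrite -mulr_sumr mulrAC ler_pdivrMr// ler_pM2l// /S lerDr.
Qed.

(** The characteristic polynomial splits over the complex numbers, and by Cayley-Hamilton the
    product of the AC - z over its roots vanishes. The factors are removed one at a time by
    [geo_scalar], so no Jordan form or spectral radius enters. *)
Lemma geo_vec D (x : nat -> 'rV[R]_D) (A : 'M[R]_D) :
  (forall n, x n.+1 = x n *m A) -> (forall j, to0 (fun n => `|x n 0 j|)) ->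
  exists K r, [/\ 0 <= K, 0 <= r, r < 1 & forall n j, `|x n 0 j| <= K * r ^+ n].
Proof.
case: D x A => [|D] x A hx x0.
  by exists 0, 0; split=> // n [].
pose f := real_complex R; pose AC := map_mx f A.
pose X n := map_mx f (x n).
have XS n : X n.+1 = X n *m AC by rewrite /X hx map_mxM.
have ncX n j : nc (X n 0 j) = `|x n 0 j| by rewrite mxE nc_real.
(* Generalizing over the right factor [B] makes the induction work: the factor of the head root is
   moved into [B], and [geo_scalar] takes the decay back from (AC - z) B to B. *)
have key (s : seq C) (B : 'M[C]_D.+1) :
    horner_mx AC (\prod_(z <- s) ('X - z%:P)) *m B = 0 ->
    forall j, geo (fun n => nc ((X n *m B) 0 j)).
  elim: s B => [|z s IH] B hB j.
    move: hB; rewrite big_nil rmorph1 mul1mx => ->.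
    exists 0, 0; split=> // n.
    by rewrite mulmx0 mxE Normc.normc0 mul0r.
  apply: (@geo_scalar _ (fun n => (X n *m ((AC - z%:M) *m B)) 0 j) z).
  - move=> n; rewrite XS mulmxBl mulmxBr mul_scalar_mx -scalemxAr !mulmxA.
    by rewrite [in LHS]mxE [X in _ + X = _]mxE [X in _ - X = _]mxE.
  - apply: IH; move: hB; rewrite big_cons mulrC rmorphM/= rmorphB/=.
    by rewrite horner_mx_X horner_mx_C mulmxA.
  - move=> e e0.
    have [N hN] := @to0_sum _ (fun i n => `|x n 0 i|) (fun i => nc (B i j))
      (fun i => nc_ge0 _) (fun i n => normr_ge0 _) x0 e e0.
    exists N => n /hN; apply: le_trans; rewrite mxE.
    apply: le_trans (nc_sum _ _) _; apply: ler_sum => i _.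
    by rewrite Normc.normcM ncX.
have [s hs] := closed_field_poly_normal (char_poly AC).
have := Cayley_Hamilton AC; rewrite hs (monicP (char_poly_monic _)) scale1r => CH.
have [|K [r [K0 r0 r1 h]]] := @geo_fin _ (fun j n => nc ((X n *m 1%:M) 0 j)).
  by apply: (key s); rewrite CH mul0mx.
exists K, r; split=> // n j.
by have := h j n; rewrite mulmx1 ncX.
Qed.

End GeometricDecay.

(** * Recursions with periodic coefficients *)

Section PeriodicRecursion.
Context {R : realType} (d q : nat).
Implicit Types (M : 'I_q -> 'M[R]_d) (X : 'M[R]_(q, d)).

(* Row k of X is the state at lag k. *)
Definition companion M X : 'M[R]_(q, d) :=
  \matrix_(k, j) if val k is k'.+1 then \sum_(m < q | val m == k') X m j
                 else \sum_(m < q) (row m X *m M m) 0 j.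

Fact companion_is_linear M : linear (companion M).
Proof.
move=> a X Y; apply/matrixP => k j; rewrite !mxE.
case: (val k) => [|k'].
  rewrite mulr_sumr -big_split; apply: eq_bigr => m _.
  by rewrite linearP /= mulmxDl -scalemxAl !mxE.
by rewrite mulr_sumr -big_split; apply: eq_bigr => m _; rewrite !mxE.
Qed.

HB.instance Definition _ M :=
  GRing.isLinear.Build R 'M[R]_(q, d) 'M[R]_(q, d) _ (companion M)
    (companion_is_linear M).

Variables (s : nat) (Psi : 'I_q -> int -> 'M[R]_d) (h : int -> 'rV[R]_d).
Hypothesis s_gt0 : (0 < s)%N.
Hypothesis sq : (s < q)%N.
Hypothesis Psi_per : forall k t, Psi k (t + s%:Z) = Psi k t.
Hypothesis h_rec : forall t : int, 0 < t ->
  h t = \sum_(k < q) h (t - k.+1%:Z) *m Psi k t.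
Hypothesis h_to0 : forall j, to0 (fun n : nat => `|h n%:Z 0 j|).

Let st (t : int) : 'M[R]_(q, d) := \matrix_(k, j) h (t - k%:Z) 0 j.

Let st_step (t : int) : 0 < t -> st t = companion (Psi ^~ t) (st (t - 1)).
Proof.
move=> t0; apply/matrixP => k j; rewrite !mxE.
case: k => -[|k'] hk /=.
  rewrite subr0 h_rec// summxE; apply: eq_bigr => m _.
  congr ((_ *m _) _ _); apply/rowP => i; rewrite !mxE.
  by congr (h _ _ _); rewrite -addrA -opprD; congr (_ - _); lia.
have hk' : (k' < q)%N by exact: ltnW.
rewrite (eq_bigl (pred1 (Ordinal hk'))); last first.
  by move=> m /=; apply/eqP/eqP => [e|->//]; exact: val_inj.
rewrite big_pred1_eq.
by rewrite mxE /=; congr (h _ _ _); lia.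
Qed.

Let per t (n : nat) k : Psi k (t + n%:Z * s%:Z) = Psi k t.
Proof.
elim: n => [|n IH]; first by rewrite mul0r addr0.
have -> : t + n.+1%:Z * s%:Z = t + n%:Z * s%:Z + s%:Z by lia.
by rewrite Psi_per.
Qed.

(** For m = s this is the monodromy matrix. It is built from the times 1, ..., m; by periodicity it
    applies from any multiple of s. *)
Let prod (m : nat) : 'M[R]_(q * d) :=
  iteri m (fun i B => B *m lin_mx (companion (Psi ^~ i.+1%:Z))) 1%:M.

Let st_prod (n m : nat) :
  mxvec (st (n%:Z * s%:Z + m%:Z)) = mxvec (st (n%:Z * s%:Z)) *m prod m.
Proof.
elim: m => [|m IH]; first by rewrite addr0 mulmx1.
rewrite st_step; last by lia.
have -> : n%:Z * s%:Z + m.+1%:Z - 1 = n%:Z * s%:Z + m%:Z by lia.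
rewrite /prod iteriS -/(prod m) mulmxA -IH mul_vec_lin /=.
congr (mxvec (companion _ _)); apply/funext => k.
by rewrite addrC per.
Qed.

(** Sampled once per period, the state follows the constant matrix [prod s], so [geo_vec] applies.
    As q > s, the states at multiples of s contain every value of [h] at nonnegative times, and
    r^(1/s) is the rate per time step. *)
Lemma geo_periodic :
  exists K r, [/\ 0 <= K, 0 <= r, r < 1 & forall (n : nat) j, `|h n%:Z 0 j| <= K * r ^+ n].
Proof.
have [||K [r [K0 r0 r1 hK]]] :=
    @geo_vec _ _ (fun n : nat => mxvec (st (n%:Z * s%:Z))) (prod s).
- move=> n; rewrite -st_prod; congr (mxvec (st _)); lia.
- move=> j e e0; case/mxvec_indexP: j => k j.
  have [N hN] := h_to0 j e0; exists (N + q)%N => n hn.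
  rewrite mxvecE mxE.
  have hk := ltn_ord k.
  have le : (n <= n * s)%N by rewrite leq_pmulr.
  have -> : n%:Z * s%:Z - k%:Z = (n * s - k)%N%:Z by lia.
  by apply: hN; lia.
pose r' := r `^ (s%:R^-1).
have r's : r' ^+ s = r.
  rewrite -powR_mulrn ?powR_ge0// -powRrM mulVf ?powRr1//.
  by rewrite pnatr_eq0 -lt0n.
have r'0 : 0 <= r' by exact: powR_ge0.
have r'1 : r' < 1.
  by rewrite -(expr_lt1 s_gt0)// r's.
exists K, r'; split=> // t j.
(* n s is the first multiple of s strictly above t, and i <= s is the lag of t in the state at that
   time. *)
pose n := (t %/ s).+1; pose i := (n * s - t)%N.
have nst : (t < n * s)%N by rewrite /n mulnC {1}(divn_eq t s) mulnC mulnS addnC ltn_add2r ltn_mod.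
have ti : (n * s - s <= t)%N by rewrite /n mulSn addKn leq_trunc_div.
have iq : (i < q)%N.
  apply: leq_ltn_trans sq; rewrite /i; lia.
have := hK n (mxvec_index (Ordinal iq) j); rewrite mxvecE mxE /=.
have -> : n%:Z * s%:Z - i%:Z = t%:Z by rewrite /i; lia.
move/le_trans; apply; rewrite ler_wpM2l// -r's -exprM.
by apply: ler_wiXn2l; rewrite ?r'0 ?(ltW r'1)// mulnC ltnW.
Qed.

End PeriodicRecursion.

(** * Times as pairs of a block and a season *)

Section Seasons.
Context {R : realType} (d s : nat).
Hypothesis hs : (0 < s)%N.

(** Subtracting 1 before dividing makes the season run from 1 to s instead of 0 to s - 1. *)
Definition blk (t : int) : int := ((t - 1) %/ s%:Z)%Z.
Definition sea (t : int) : nat := (absz ((t - 1) %% s%:Z)%Z).+1.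

Lemma sea_bound t : (1 <= sea t <= s)%N.
Proof.
rewrite /sea /=.
have h1 : 0 <= ((t - 1) %% s%:Z)%Z by apply: modz_ge0; lia.
have h2 : ((t - 1) %% s%:Z)%Z < s%:Z by apply: ltz_pmod; lia.
lia.
Qed.

Lemma blk_sea t : t = blk t * s%:Z + (sea t)%:Z.
Proof.
have h1 : 0 <= ((t - 1) %% s%:Z)%Z by apply: modz_ge0; lia.
have h := divz_eq (t - 1) s%:Z.
by rewrite /blk /sea -addn1 PoszD gez0_abs// addrA -h subrK.
Qed.

Lemma blkD t n : blk (n * s%:Z + t) = n + blk t.
Proof.
rewrite /blk -addrA divzMDl//; lia.
Qed.

Lemma blk1 nu : (1 <= nu <= s)%N -> blk nu%:Z = 0.
Proof. by move=> h; rewrite /blk divz_small//; apply/andP; split; lia. Qed.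

Lemma sea_nu nu n : (1 <= nu <= s)%N -> sea (n * s%:Z + nu%:Z) = nu.
Proof.
move=> h; have := blk_sea (n * s%:Z + nu%:Z); rewrite blkD blk1// addr0.
by move/addrI => [].
Qed.

Lemma sea_per t n : sea (n * s%:Z + t) = sea t.
Proof.
by rewrite {1}(blk_sea t) addrA -mulrDl sea_nu// sea_bound.
Qed.

Lemma blk_le nu l : (1 <= nu <= s)%N -> blk (nu%:Z - l%:Z) <= 0.
Proof.
move=> h; rewrite -(blk1 h) /blk; apply: lez_pdiv2r; lia.
Qed.

Lemma blk_ge nu l : (1 <= nu <= s)%N -> - l%:Z <= blk (nu%:Z - l%:Z).
Proof.
move=> h; rewrite /blk.
rewrite [leLHS](_ : _ = ((- l%:Z * s%:Z) %/ s%:Z)%Z); last by rewrite mulzK//; lia.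
apply: lez_pdiv2r; first lia.
by have : (l <= l * s)%N by [rewrite leq_pmulr]; lia.
Qed.

Lemma pos_subproof t : (s - sea t < s)%N.
Proof. have := sea_bound t; lia. Qed.

(** [estar] stacks the seasons of a block in decreasing order, so season s has position 0. *)
Definition pos t : 'I_s := Ordinal (pos_subproof t).

Definition ecoord (t : int) (i : 'I_d) (x : path_space R (s * d)) : R :=
  x (blk t) (mxvec_index (pos t) i) ord0.

Lemma ecoordE T (eps : int -> T -> 'cV[R]_d) t i w :
  eps t w i ord0 = ecoord t i (estar_path s eps w).
Proof.
rewrite /ecoord /estar_path /estar mxE mxvecE !mxE /=; congr (eps _ _ _ _).
have := sea_bound t; rewrite [LHS]blk_sea => h; congr (_ + _); lia.
Qed.

Local Notation PS := (g_sigma_algebraType (cylinders R (s * d))).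

Lemma measurable_ecoord t i : measurable_fun setT (ecoord t i : PS -> R).
Proof.
move=> _ B mB; rewrite setTI; apply: sub_sigma_algebra.
by exists (blk t), (mxvec_index (pos t) i), B.
Qed.

Lemma measurable_shift : measurable_fun setT (@Defs.shift R (s * d) : PS -> PS).
Proof.
apply: (@measurability _ _ PS PS setT _ (cylinders R (s * d)) erefl).
move=> _ [_ [n [i [B [mB ->]]] <-]]; rewrite setTI; apply: sub_sigma_algebra.
by exists (n + 1), i, B.
Qed.

End Seasons.

(** * Strict stationarity as invariance of expectations on path space *)

Section Stationarity.
Context {R : realType} {dT : measure_display} {T : measurableType dT}.
Variables (P : probability T R) (d s : nat).
Hypothesis hs : (0 < s)%N.
Variable eps : int -> T -> 'cV[R]_d.
Hypothesis meps : forall t i j, measurable_fun setT (fun w => eps t w i j).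
Hypothesis stat : strictly_stationary P (estar_path s eps).

Local Notation PS := (g_sigma_algebraType (cylinders R (s * d))).
Local Notation Xi := (estar_path s eps : T -> PS).

Lemma measurable_estar n i j : measurable_fun setT (fun w => estar s eps n w i j).
Proof.
rewrite /estar; case/mxvec_indexP: i => k i; rewrite (ord1 j).
rewrite (_ : (fun w => _) =
    (fun w => eps (n * s%:Z + (s - k)%N%:Z) w i ord0)); first exact: meps.
by apply/funext => w; rewrite mxE mxvecE !mxE.
Qed.

Lemma measurable_Xi : measurable_fun setT Xi.
Proof.
apply: (@measurability _ _ T PS setT _ (cylinders R (s * d)) erefl).
move=> _ [_ [n [i [B [mB ->]]] <-]].
exact: measurable_estar.
Qed.

(** Both sides are integrals of [F] against laws on path space, that of the process and that of the
    shifted process; stationarity says that these laws agree. *)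
Lemma integral_shift (F : PS -> \bar R) : measurable_fun setT F ->
  (forall x, 0 <= F x)%E ->
  (\int[P]_w F (Xi w) = \int[P]_w F (Defs.shift (Xi w)))%E.
Proof.
move=> mF F0.
have mX := measurable_Xi.
have mSX : measurable_fun setT (@Defs.shift R (s * d) \o Xi : T -> PS).
  exact: (measurableT_comp (@measurable_shift R d s) mX).
have F0' : {in [set: PS], forall x, 0 <= F x}%E by move=> x _.
have E1 := ge0_integral_pushforward mX P measurableT mF F0'.
have E2 := ge0_integral_pushforward mSX P measurableT mF F0'.
rewrite preimage_setT in E1; rewrite preimage_setT in E2.
rewrite -[LHS]E1 -[RHS]E2.
apply: eq_measure_integral => A mA _.
by rewrite /pushforward; symmetry; apply: stat.
Qed.

(** Positive and negative parts are shifted separately, so that integrability of [F] need not be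
    established beforehand. *)
Lemma Ex_shift (F : PS -> R) : measurable_fun setT F ->
  Ex P (fun w => F (Xi w)) = Ex P (fun w => F (Defs.shift (Xi w))).
Proof.
move=> mF; rewrite !ExE /Rintegral; congr fine.
have mE : measurable_fun setT (EFin \o F) by exact/measurable_EFinP.
rewrite integralE [in RHS]integralE; congr (_ - _)%E.
  have E := integral_shift (measurable_funepos mE) (funepos_ge0 (EFin \o F)).
  transitivity (\int[P]_w ((EFin \o F)^\+ (Xi w)))%E.
    by apply: eq_integral => w _; rewrite !funeposE.
  by rewrite E; apply: eq_integral => w _; rewrite !funeposE.
have E := integral_shift (measurable_funeneg mE) (funeneg_ge0 (EFin \o F)).
transitivity (\int[P]_w ((EFin \o F)^\- (Xi w)))%E.
  by apply: eq_integral => w _; rewrite !funenegE.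
by rewrite E; apply: eq_integral => w _; rewrite !funenegE.
Qed.

End Stationarity.

Section StationarityExtra.
Context {R : realType} {dT : measure_display} {T : measurableType dT}.
Variables (P : probability T R) (d s : nat).
Hypothesis hs : (0 < s)%N.
Variable eps : int -> T -> 'cV[R]_d.
Hypothesis meps : forall t i j, measurable_fun setT (fun w => eps t w i j).
Hypothesis stat : strictly_stationary P (estar_path s eps).

Local Notation PS := (g_sigma_algebraType (cylinders R (s * d))).
Local Notation Xi := (estar_path s eps : T -> PS).

Definition shiftn (k : int) (x : path_space R (s * d)) : path_space R (s * d) :=
  fun n => x (n + k).

Lemma measurable_pcoord n i j : measurable_fun setT (fun x : PS => x n i j).
Proof.
rewrite (ord1 j) => _ B mB; rewrite setTI; apply: sub_sigma_algebra.
by exists n, i, B.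
Qed.

Lemma measurable_shiftn k : measurable_fun setT (shiftn k : PS -> PS).
Proof.
apply: (@measurability _ _ PS PS setT _ (cylinders R (s * d)) erefl).
move=> _ [_ [n [i [B [mB ->]]] <-]]; rewrite setTI; apply: sub_sigma_algebra.
by exists (n + k), i, B.
Qed.

Lemma ecoord_shiftn t k i x :
  ecoord hs (k * s%:Z + t) i x = ecoord hs t i (shiftn k x).
Proof.
rewrite /ecoord /shiftn (blkD hs).
have -> : pos hs (k * s%:Z + t) = pos hs t.
  by apply: val_inj => /=; rewrite (sea_per hs).
by rewrite addrC.
Qed.

Lemma Ex_shiftn (F : PS -> R) (k : int) : measurable_fun setT F ->
  Ex P (fun w => F (shiftn k (Xi w))) = Ex P (fun w => F (Xi w)).
Proof.
move=> mF.
have step k' : Ex P (fun w => F (shiftn k' (Xi w))) =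
    Ex P (fun w => F (shiftn (k' + 1) (Xi w))).
  have mFk : measurable_fun setT (F \o shiftn k' : PS -> R).
    exact: (measurableT_comp mF (measurable_shiftn k')).
  rewrite (Ex_shift meps stat mFk); apply: eq_Ex => w.
  congr (F _); apply/funext => n /=.
  by rewrite /shiftn /Defs.shift addrA.
have k0 : Ex P (fun w => F (shiftn 0 (Xi w))) = Ex P (fun w => F (Xi w)).
  by apply: eq_Ex => w; congr (F _); apply/funext => n; rewrite /shiftn addr0.
elim/int_rect: k => [//|n IH|n IH].
  by have -> : n.+1%:Z = n%:Z + 1 by [lia]; rewrite -step.
by rewrite step; have -> : - n.+1%:Z + 1 = - n%:Z by lia.
Qed.

Variable kappa : R.
Hypothesis kappa_gt0 : 0 < kappa.
Hypothesis mom : forall n : int,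
  (\int[P]_w ((sqnorm (estar s eps n w)) `^ (2 + kappa))%:E < +oo)%E.

Lemma measurable_sqnorm {d'} {T' : measurableType d'} m n (X : T' -> 'M[R]_(m, n)) :
  (forall i j, measurable_fun setT (fun w => X w i j)) ->
  measurable_fun setT (fun w => sqnorm (X w)).
Proof.
move=> mX; apply: measurable_sum => i; apply: measurable_sum => j.
exact: measurable_funX.
Qed.

Lemma sqnorm_ge0 m n (X : 'M[R]_(m, n)) : 0 <= sqnorm X.
Proof. by apply: sumr_ge0 => i _; apply: sumr_ge0 => j _; exact: sqr_ge0. Qed.

Lemma mom_stat : exists K, forall n,
  L1 P (fun w => sqnorm (estar s eps n w) `^ (2 + kappa)) /\
  Ex P (fun w => sqnorm (estar s eps n w) `^ (2 + kappa)) = K.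
Proof.
exists (Ex P (fun w => sqnorm (estar s eps 0 w) `^ (2 + kappa))) => n; split.
  apply/integrableP; split.
    apply/measurable_EFinP.
    apply: (@measurableT_comp _ _ _ _ _ _ (@powR R ^~ (2 + kappa))) => //.
    by apply: measurable_sqnorm => i j; exact: measurable_estar.
  under eq_integral do rewrite /= ger0_norm ?powR_ge0//.
  exact: mom.
pose F (x : PS) := sqnorm (x 0) `^ (2 + kappa).
have mF : measurable_fun setT F.
  apply: (@measurableT_comp _ _ _ _ _ _ (@powR R ^~ (2 + kappa))) => //.
  by apply: measurable_sqnorm => i j; exact: measurable_pcoord.
transitivity (Ex P (fun w => F (shiftn n (Xi w)))).
  by apply: eq_Ex => w; rewrite /F /shiftn add0r.
exact: Ex_shiftn n mF.
Qed.

Definition mt (t : int) (w : T) : R := \sum_i `|eps t w i ord0|.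

Lemma mt_ge0 t w : 0 <= mt t w.
Proof. by apply: sumr_ge0. Qed.

Lemma measurable_mt t : measurable_fun setT (mt t).
Proof. by apply: measurable_sum => i; exact: measurableT_comp. Qed.

Lemma eps_le_mt t w i : `|eps t w i ord0| <= mt t w.
Proof. by rewrite /mt (bigD1 i)//= lerDl sumr_ge0. Qed.

Local Notation Q := (4 + 2 * kappa).

(** [sqnorm] is a squared norm, hence its power 2 + kappa is the power 4 + 2 kappa of the norm; the
    factor d compares the sum of d entries with one Euclidean norm. *)
Lemma mt_pow t w : mt t w `^ Q <=
  d%:R `^ Q * sqnorm (estar s eps (blk s t) w) `^ (2 + kappa).
Proof.
set S := sqnorm _.
have S0 : 0 <= S by exact: sqnorm_ge0.
have h i : `|eps t w i ord0| <= Num.sqrt S.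
  rewrite -sqrtr_sqr ler_sqrt ?sqr_ge0// (ecoordE hs) /ecoord /S /sqnorm.
  rewrite (bigD1 (mxvec_index (pos hs t) i))//= big_ord1 lerDl sumr_ge0// => j _.
  by apply: sumr_ge0 => k _; exact: sqr_ge0.
have -> : S `^ (2 + kappa) = Num.sqrt S `^ Q.
  rewrite -powR12_sqrt// -powRrM; congr (_ `^ _); by field.
rewrite -powRM ?sqrtr_ge0// ge0_ler_powR ?nnegrE ?mt_ge0 ?mulr_ge0 ?sqrtr_ge0//.
  by rewrite addr_ge0// mulr_ge0// ltW.
apply: le_trans (_ : \sum_(i < d) Num.sqrt S <= _); first exact: ler_sum.
by rewrite sumr_const card_ord mulr_natl.
Qed.

Lemma mt_mom : exists2 K, 0 <= K & forall t, L1 P (fun w => mt t w `^ Q) /\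
  Ex P (fun w => mt t w `^ Q) <= K.
Proof.
have [K hK] := mom_stat; exists (d%:R `^ Q * K).
  have [_ <-] := hK 0; rewrite mulr_ge0 ?powR_ge0//.
  by apply: Ex_ge0 => w; exact: powR_ge0.
move=> t; have [i E] := hK (blk s t).
have i1 : L1 P (fun w => mt t w `^ Q).
  apply: (L1_le _ _ (L1Z (d%:R `^ Q) i)).
    apply: (@measurableT_comp _ _ _ _ _ _ (@powR R ^~ Q)) => //.
    exact: measurable_mt.
  by move=> w; rewrite ger0_norm ?powR_ge0//; exact: mt_pow.
split=> //; rewrite -E -ExZ//; apply: Ex_le => //; first exact: L1Z.
by move=> w; exact: mt_pow.
Qed.

End StationarityExtra.

(** * A random envelope for geometrically weighted innovations *)

Section Dominating.
Context {R : realType} {dT : measure_display} {T : measurableType dT}.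
Variables (P : probability T R) (m : int -> T -> R) (Q K s : R).
Hypothesis m_ge0 : forall t w, 0 <= m t w.
Hypothesis mm : forall t, measurable_fun setT (m t).
Hypothesis Q1 : 1 <= Q.
Hypothesis im : forall t, L1 P (fun w => m t w `^ Q).
Hypothesis Em : forall t, Ex P (fun w => m t w `^ Q) <= K.
Hypothesis s0 : 0 < s.
Hypothesis s1 : s < 1.

Definition domterm (t : int) (l : nat) (w : T) : R := (s ^+ l * m (t - l%:Z) w) `^ Q.

Definition domser (t : int) (w : T) : \bar R :=
  (\sum_(0 <= l <oo) (domterm t l w)%:E)%E.

(* Where the series diverges (a null set), dom is 0 by the convention on fine *)
Definition dom (t : int) (w : T) : R := (fine (domser t w)) `^ Q^-1.

Lemma domterm_ge0 t l w : 0 <= domterm t l w. Proof. exact: powR_ge0. Qed.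

Lemma Q_gt0 : 0 < Q. Proof. exact: lt_le_trans ltr01 Q1. Qed.

Lemma measurable_domterm t l : measurable_fun setT (domterm t l).
Proof.
apply: (@measurableT_comp _ _ _ _ _ _ (@powR R ^~ Q)) => //.
exact: measurable_funM.
Qed.

Lemma measurable_domser t : measurable_fun setT (domser t).
Proof.
apply: ge0_emeasurable_sum => [l w _ _|l _]; first by rewrite lee_fin domterm_ge0.
by apply/measurable_EFinP; exact: measurable_domterm.
Qed.

Lemma domser_ge0 t w : (0 <= domser t w)%E.
Proof. by apply: nneseries_ge0 => l _ _; rewrite lee_fin domterm_ge0. Qed.

Lemma domterm_L1 t l : L1 P (domterm t l) /\ Ex P (domterm t l) <= K * s ^+ l.
Proof.
have e : domterm t l = (fun w => (s ^+ l) `^ Q * m (t - l%:Z) w `^ Q).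
  by apply/funext => w; rewrite /domterm powRM// exprn_ge0// ltW.
rewrite e; split; first exact: L1Z.
rewrite ExZ// mulrC; apply: ler_pM; rewrite ?powR_ge0//.
  by apply: Ex_ge0 => w; exact: powR_ge0.
apply: ge1r_powR => //; rewrite exprn_gt0//= exprn_ile1 ?ltW//.
Qed.

Lemma K_ge0 : 0 <= K.
Proof. by apply: le_trans (Em 0); apply: Ex_ge0 => w; exact: powR_ge0. Qed.

Lemma domser_int t : (\int[P]_w domser t w <= (K * (1 - s)^-1)%:E)%E.
Proof.
rewrite /domser integral_nneseries//; last 2 first.
- by move=> l; apply/measurable_EFinP; exact: measurable_domterm.
- by move=> l w _; rewrite lee_fin domterm_ge0.
apply: lime_le.
  apply: is_cvg_nneseries => l _ _; apply: integral_ge0 => w _.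
  by rewrite lee_fin domterm_ge0.
apply: nearW => N; apply: le_trans (_ : (\sum_(0 <= l < N) (K * s ^+ l)%:E <= _)%E).
  apply: lee_sum => l _; have [i E] := domterm_L1 t l.
  by rewrite -EFin_Ex// lee_fin.
rewrite sumEFin lee_fin -mulr_sumr ler_wpM2l ?K_ge0// big_mkord.
by apply: sum_geo_le => //; exact: ltW.
Qed.

Lemma domser_integrable t : P.-integrable setT (domser t).
Proof.
apply/integrableP; split; first exact: measurable_domser.
under eq_integral do rewrite gee0_abs ?domser_ge0//.
exact: le_lt_trans (domser_int t) (ltry _).
Qed.

Lemma domser_fin t : {ae P, forall w, domser t w \is a fin_num}.
Proof.
by have := integrable_ae measurableT (domser_integrable t); apply: filterS => w; apply.
Qed.

Lemma dom_ge0 t w : 0 <= dom t w. Proof. exact: powR_ge0. Qed.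

Lemma measurable_dom t : measurable_fun setT (dom t).
Proof.
apply: (@measurableT_comp _ _ _ _ _ _ (@powR R ^~ Q^-1)) => //.
by apply: measurableT_comp => //; exact: measurable_domser.
Qed.

Lemma dom_powE t w : dom t w `^ Q = fine (domser t w).
Proof.
by rewrite /dom -powRrM mulVf ?gt_eqF ?Q_gt0// powRr1// fine_ge0// domser_ge0.
Qed.

Lemma dom_mom t : L1 P (fun w => dom t w `^ Q) /\
  Ex P (fun w => dom t w `^ Q) <= K * (1 - s)^-1.
Proof.
have e : (fun w => dom t w `^ Q) = fine \o domser t.
  by apply/funext => w /=; rewrite dom_powE.
have mf : measurable_fun setT (fine \o domser t).
  by apply: measurableT_comp => //; exact: measurable_domser.
have ae : (\int[P]_w (fine (domser t w))%:E = \int[P]_w domser t w)%E.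
  apply: ae_eq_integral => //.
  - exact/measurable_EFinP.
  - exact: measurable_domser.
  - by apply: filterS (domser_fin t) => w h _; rewrite fineK.
have i : L1 P (fine \o domser t).
  apply/integrableP; split; first exact/measurable_EFinP.
  under eq_integral do rewrite /= ger0_norm ?fine_ge0 ?domser_ge0//.
  by rewrite ae; exact: le_lt_trans (domser_int t) (ltry _).
rewrite e; split=> //.
by rewrite -lee_fin EFin_Ex// /comp ae domser_int.
Qed.

(** An l^Q norm dominates the supremum of the weighted sequence, and its moment of order Q is a
    termwise sum of moments. *)
Lemma dom_dominates t : {ae P, forall w, forall l : nat,
  s ^+ l * m (t - l%:Z) w <= dom t w}.
Proof.
apply: filterS (domser_fin t) => w h l.
have Q0 := Q_gt0.
have sm : 0 <= s ^+ l * m (t - l%:Z) w by rewrite mulr_ge0// exprn_ge0// ltW.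
have : domterm t l w <= fine (domser t w).
  rewrite -lee_fin fineK//.
  apply: le_trans (nneseries_lim_ge l.+1 _); last first.
    by move=> j _ _; rewrite lee_fin domterm_ge0.
  rewrite sumEFin lee_fin big_nat_recr//= lerDr sumr_ge0// => j _.
  exact: domterm_ge0.
rewrite -dom_powE /domterm => hh.
rewrite leNgt; apply/negP => lt.
have := gt0_ltr_powR Q0 (x := dom t w) (y := s ^+ l * m (t - l%:Z) w).
by rewrite !nnegrE dom_ge0 sm => /(_ isT isT lt); rewrite ltNge hh.
Qed.

End Dominating.

(** * Causal moving averages of the innovations at a fixed season *)

Section LinearProcess.
Context {R : realType} {dT : measure_display} {T : measurableType dT}.
Variables (P : probability T R) (d s : nat).
Hypothesis hs : (0 < s)%N.
Variable eps : int -> T -> 'cV[R]_d.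
Hypothesis meps : forall t i j, measurable_fun setT (fun w => eps t w i j).
Hypothesis stat : strictly_stationary P (estar_path s eps).
Variable nu : nat.
Hypothesis hnu : (1 <= nu <= s)%N.
Variables (D : int -> T -> R) (sg : R).
Hypothesis D0 : forall t w, 0 <= D t w.
Hypothesis Ddom : forall t : int, {ae P, forall w, forall l : nat,
  sg ^+ l * mt eps (t - l%:Z) w <= D t w}.
Hypothesis sg0 : 0 < sg.
Hypothesis sg1 : sg < 1.

Local Notation tm n := (n * s%:Z + nu%:Z).
Local Notation PS := (g_sigma_algebraType (cylinders R (s * d))).
Local Notation Xi := (estar_path s eps : T -> PS).

Definition past_gen (n : int) : set (set T) :=
  [set A | exists (k : int) (i : 'I_(s * d)) (B : set R), (k <= n)%R /\
     measurable B /\ A = (fun w => estar s eps k w i ord0) @^-1` B].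

Definition future_gen (n : int) : set (set T) :=
  [set A | exists (k : int) (i : 'I_(s * d)) (B : set R), (n <= k)%R /\
     measurable B /\ A = (fun w => estar s eps k w i ord0) @^-1` B].

Definition Gdom (n : int) (w : T) : R := D (tm n) w ^+ 2.

Definition lin (c : nat -> 'I_d -> R) (r : nat) (n : int) (w : T) : R :=
  \sum_(l < r) \sum_i c l i * eps (tm n - l%:Z) w i ord0.

(** The coefficients carry the square of sg^l: one factor is spent on bounding sg^l |eps| by [D],
    the other one is summed to 1 / (1 - sg). *)
Record linproc (C : R) (L : int -> T -> R) (c : nat -> 'I_d -> R) : Prop := {
  lp_meas : forall n, measurable_fun setT (L n);
  lp_coef : forall l i, `|c l i| <= C * (sg ^+ l) ^+ 2;
  lp_cvg : forall n, {ae P, forall w, (fun r => lin c r n w) @ \oo --> L n w} }.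

Lemma past_gen_measurable n A : past_gen n A -> measurable A.
Proof.
move=> [k [i [B [_ [mB ->]]]]]; rewrite -[X in measurable X]setTI.
exact: (measurable_estar meps).
Qed.

Lemma future_gen_measurable n A : future_gen n A -> measurable A.
Proof.
move=> [k [i [B [_ [mB ->]]]]]; rewrite -[X in measurable X]setTI.
exact: (measurable_estar meps).
Qed.

Lemma past_gen_mono (m n : int) : m <= n -> past_gen m `<=` past_gen n.
Proof.
move=> mn A [k [i [B [km h]]]]; exists k, i, B; split=> //.
exact: le_trans km mn.
Qed.

Lemma future_gen_anti (m n : int) : m <= n -> future_gen n `<=` future_gen m.
Proof.
move=> mn A [k [i [B [nk h]]]]; exists k, i, B; split=> //.
exact: le_trans mn nk.
Qed.

Lemma eps_past t i n : blk s t <= n -> gmeas (past_gen n) (fun w => eps t w i ord0).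
Proof.
move=> h _ B mB; rewrite setTI; apply: sub_sigma_algebra.
exists (blk s t), (mxvec_index (pos hs t) i), B; split=> //; split=> //.
by rewrite (_ : (fun w => _) = (fun w => estar s eps (blk s t) w
  (mxvec_index (pos hs t) i) ord0))//; apply/funext => w; rewrite (ecoordE hs).
Qed.

Lemma eps_future t i n : n <= blk s t -> gmeas (future_gen n) (fun w => eps t w i ord0).
Proof.
move=> h _ B mB; rewrite setTI; apply: sub_sigma_algebra.
exists (blk s t), (mxvec_index (pos hs t) i), B; split=> //; split=> //.
by rewrite (_ : (fun w => _) = (fun w => estar s eps (blk s t) w
  (mxvec_index (pos hs t) i) ord0))//; apply/funext => w; rewrite (ecoordE hs).
Qed.

Lemma measurable_lin_gen (Gn : set (set T)) c r n :
  (forall (l : 'I_r) i, gmeas Gn (fun w => eps (tm n - l%:Z) w i ord0)) ->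
  gmeas Gn (lin c r n).
Proof.
move=> h; apply: measurable_sum => l; apply: measurable_sum => i.
by apply: measurable_funM => //; exact: h.
Qed.

Lemma lin_past c r n : gmeas (past_gen n) (lin c r n).
Proof.
apply: measurable_lin_gen => l i; apply: eps_past.
rewrite -addrA (blkD hs) -[leRHS]addr0 lerD2l; exact: blk_le.
Qed.

(** Going back l time steps goes back at most l blocks. This is crude when s > 1, but depth is only
    ever measured up to a geometric rate. *)
Lemma lin_future c r n : gmeas (future_gen (n - r%:Z)) (lin c r n).
Proof.
apply: measurable_lin_gen => l i; apply: eps_future.
rewrite -addrA (blkD hs) lerD2l; apply: le_trans (blk_ge hs l hnu).
by rewrite lerN2; have := ltn_ord l; lia.
Qed.

Lemma lin_diff C c n w r r' : 0 <= C -> (r <= r')%N ->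
  (forall l i, `|c l i| <= C * (sg ^+ l) ^+ 2) ->
  (forall l : nat, sg ^+ l * mt eps (tm n - l%:Z) w <= D (tm n) w) ->
  `|lin c r' n w - lin c r n w| <= C / (1 - sg) * sg ^+ r * D (tm n) w.
Proof.
move=> C0 rr hc hD.
have sl l : 0 <= sg ^+ l by rewrite exprn_ge0// ltW.
have term l : `|\sum_i c l i * eps (tm n - l%:Z) w i ord0| <= C * sg ^+ l * D (tm n) w.
  apply: le_trans (_ : C * (sg ^+ l) ^+ 2 * mt eps (tm n - l%:Z) w <= _).
    rewrite /mt mulr_sumr; apply: le_trans (ler_norm_sum _ _ _) _.
    by apply: ler_sum => i _; rewrite normrM ler_wpM2r.
  by rewrite expr2 mulrA -[leLHS]mulrA ler_wpM2l// mulr_ge0.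
rewrite /lin -(subnKC rr) big_split_ord /= [X in X - _]addrC addrK.
apply: le_trans (ler_norm_sum _ _ _) _.
apply: le_trans (_ : \sum_(l < r' - r) C * sg ^+ (r + l) * D (tm n) w <= _).
  by apply: ler_sum => l _; exact: term.
rewrite -mulr_suml ler_wpM2r//.
under eq_bigr do rewrite exprD mulrA.
rewrite -mulr_sumr -[leRHS]mulrA [X in _ <= _ * X]mulrC mulrA ler_wpM2l ?mulr_ge0//.
by apply: sum_geo_le => //; exact: ltW.
Qed.

(** One Cauchy estimate, [lin_diff], yields all three bounds: its limit in the larger depth is the
    third, and since the truncation of depth 0 is the empty sum, the case r = 0 gives the other
    two. *)
Lemma lin_bounds C L c : 0 <= C -> linproc C L c -> forall n,
  {ae P, forall w, [/\ `|L n w| <= C / (1 - sg) * D (tm n) w,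
    (forall r, `|lin c r n w| <= C / (1 - sg) * D (tm n) w) &
    (forall r, `|L n w - lin c r n w| <= C / (1 - sg) * sg ^+ r * D (tm n) w)]}.
Proof.
move=> C0 hL n; near=> w.
have hD : forall l : nat, sg ^+ l * mt eps (tm n - l%:Z) w <= D (tm n) w.
  by near: w; exact: Ddom.
have hcv : (fun r => lin c r n w) @ \oo --> L n w.
  by near: w; exact: (lp_cvg hL).
have hd r r' : (r <= r')%N -> `|lin c r' n w - lin c r n w| <=
    C / (1 - sg) * sg ^+ r * D (tm n) w.
  by move=> rr; apply: lin_diff => //; exact: lp_coef hL.
have hlim r : `|L n w - lin c r n w| <= C / (1 - sg) * sg ^+ r * D (tm n) w.
  have cv : (fun r' => `|lin c r' n w - lin c r n w|) @ \oo -->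
      `|L n w - lin c r n w|.
    by apply: cvg_norm; apply: cvgB => //; exact: cvg_cst.
  rewrite -(cvg_lim _ cv)//; apply: limr_le; first exact: (cvgP _ cv).
  by near=> r'; apply: hd; near: r'; exact: nbhs_infty_ge.
split=> // [|r].
  by have := hlim 0%N; rewrite /lin big_ord0 subr0 expr0 mulr1.
by have := hd 0%N r (leq0n r); rewrite /lin big_ord0 subr0 expr0 mulr1.
Unshelve. all: by end_near. Qed.

Lemma prod_approx C L L' c c' : 0 <= C -> linproc C L c -> linproc C L' c' ->
  approx P past_gen future_gen Gdom sg (2 * (C / (1 - sg)) ^+ 2)
    (fun n w => L n w * L' n w) (fun r n w => lin c r n w * lin c' r n w).
Proof.
move=> C0 hL hL'; set C1 := C / (1 - sg).
have C10 : 0 <= C1 by rewrite divr_ge0// subr_ge0 ltW.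
have dbl x y (z : R) : `|x| <= C1 * z -> `|y| <= C1 * z -> 0 <= z ->
    `|x * y| <= 2 * C1 ^+ 2 * z ^+ 2.
  move=> hx hy z0; rewrite normrM; apply: le_trans (ler_pM _ _ hx hy) _ => //.
  have : 0 <= (C1 * z) ^+ 2 by exact: sqr_ge0.
  rewrite exprMn; nra.
split.
- by move=> n; apply: measurable_funM; [exact: (lp_meas hL)|exact: (lp_meas hL')].
- by move=> r n; apply: measurable_funM; exact: lin_past.
- by move=> r n; apply: measurable_funM; exact: lin_future.
- move=> n; near=> w; rewrite /Gdom.
  have [h1 _ _] : [/\ `|L n w| <= C1 * D (tm n) w, (forall r, `|lin c r n w| <= C1 * D (tm n) w) &
    (forall r, `|L n w - lin c r n w| <= C1 * sg ^+ r * D (tm n) w)].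
    by near: w; exact: lin_bounds.
  have [h2 _ _] : [/\ `|L' n w| <= C1 * D (tm n) w, (forall r, `|lin c' r n w| <= C1 * D (tm n) w) &
    (forall r, `|L' n w - lin c' r n w| <= C1 * sg ^+ r * D (tm n) w)].
    by near: w; exact: lin_bounds.
  exact: dbl.
- move=> r n; near=> w; rewrite /Gdom.
  have [_ h1 _] : [/\ `|L n w| <= C1 * D (tm n) w, (forall r, `|lin c r n w| <= C1 * D (tm n) w) &
    (forall r, `|L n w - lin c r n w| <= C1 * sg ^+ r * D (tm n) w)].
    by near: w; exact: lin_bounds.
  have [_ h2 _] : [/\ `|L' n w| <= C1 * D (tm n) w, (forall r, `|lin c' r n w| <= C1 * D (tm n) w) &
    (forall r, `|L' n w - lin c' r n w| <= C1 * sg ^+ r * D (tm n) w)].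
    by near: w; exact: lin_bounds.
  exact: dbl.
- move=> r n; near=> w; rewrite /Gdom.
  have [_ h1 h1'] : [/\ `|L n w| <= C1 * D (tm n) w, (forall r, `|lin c r n w| <= C1 * D (tm n) w) &
    (forall r, `|L n w - lin c r n w| <= C1 * sg ^+ r * D (tm n) w)].
    by near: w; exact: lin_bounds.
  have [h2 _ h2'] : [/\ `|L' n w| <= C1 * D (tm n) w, (forall r, `|lin c' r n w| <= C1 * D (tm n) w) &
    (forall r, `|L' n w - lin c' r n w| <= C1 * sg ^+ r * D (tm n) w)].
    by near: w; exact: lin_bounds.
  have -> : L n w * L' n w - lin c r n w * lin c' r n w =
    (L n w - lin c r n w) * L' n w + lin c r n w * (L' n w - lin c' r n w) by ring.
  apply: le_trans (ler_normD _ _) _; rewrite !normrM.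
  have -> : 2 * C1 ^+ 2 * sg ^+ r * D (tm n) w ^+ 2 =
    (C1 * sg ^+ r * D (tm n) w) * (C1 * D (tm n) w) +
    (C1 * D (tm n) w) * (C1 * sg ^+ r * D (tm n) w) by ring.
  by apply: lerD; apply: ler_pM.
Unshelve. all: by end_near. Qed.

(** The truncated moving average as a measurable function on path space, the form to which
    stationarity applies; the almost sure limit does not come in this form. *)
Definition linF (c : nat -> 'I_d -> R) (r : nat) (n : int) (x : PS) : R :=
  \sum_(l < r) \sum_i c l i * ecoord hs (tm n - l%:Z) i x.

Lemma measurable_linF c r n : measurable_fun setT (linF c r n).
Proof.
apply: measurable_sum => l; apply: measurable_sum => i.
by apply: measurable_funM => //; exact: measurable_ecoord.
Qed.

Lemma lin_shift c r n k w : lin c r (n + k) w = linF c r n (shiftn k (Xi w)).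
Proof.
rewrite /lin /linF; apply: eq_bigr => l _; apply: eq_bigr => i _.
rewrite (ecoordE hs) -ecoord_shiftn; congr (_ * ecoord _ _ _ _).
by rewrite mulrDl -addrA [X in X + _]addrC !addrA.
Qed.

Lemma linFE c r n w : lin c r n w = linF c r n (Xi w).
Proof.
rewrite -[n in LHS]addr0 lin_shift; congr (linF _ _ _ _).
by apply/funext => m; rewrite /shiftn addr0.
Qed.

Lemma Ex_lin2_shift c1 c2 r n k :
  Ex P (fun w => lin c1 r (n + k) w * lin c2 r (n + k) w) =
  Ex P (fun w => lin c1 r n w * lin c2 r n w).
Proof.
pose F x := linF c1 r n x * linF c2 r n x.
have mF : measurable_fun setT F by apply: measurable_funM; exact: measurable_linF.
transitivity (Ex P (fun w => F (shiftn k (Xi w)))).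
  by apply: eq_Ex => w; rewrite !lin_shift.
rewrite (Ex_shiftn hs meps stat k mF).
by apply: eq_Ex => w; rewrite !linFE.
Qed.

Lemma Ex_lin4_shift c1 c2 c3 c4 r n m k :
  Ex P (fun w => (lin c1 r (n + k) w * lin c2 r (n + k) w) *
                 (lin c3 r (m + k) w * lin c4 r (m + k) w)) =
  Ex P (fun w => (lin c1 r n w * lin c2 r n w) * (lin c3 r m w * lin c4 r m w)).
Proof.
pose F x := (linF c1 r n x * linF c2 r n x) * (linF c3 r m x * linF c4 r m x).
have mF : measurable_fun setT F.
  by apply: measurable_funM; apply: measurable_funM; exact: measurable_linF.
transitivity (Ex P (fun w => F (shiftn k (Xi w)))).
  by apply: eq_Ex => w; rewrite !lin_shift.
rewrite (Ex_shiftn hs meps stat k mF).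
by apply: eq_Ex => w; rewrite !linFE.
Qed.

End LinearProcess.

(** * The causal coefficients, recovered from covariances with the innovations *)

Section Identification.
Context {R : realType} {dT : measure_display} {T : measurableType dT}.
Variables (P : probability T R) (d s : nat).
Hypothesis hs : (0 < s)%N.
Variables (p : nat -> nat) (Phi : nat -> nat -> 'M[R]_d).
Variables (Y eps : int -> T -> 'cV[R]_d).
Hypothesis meps : forall t i j, measurable_fun setT (fun w => eps t w i j).
Hypothesis mY : forall t i j, measurable_fun setT (fun w => Y t w i j).
Hypothesis hrec : forall (n : int) (nu : nat), (1 <= nu <= s)%N ->
  {ae P, forall w, Y (n * s%:Z + nu%:Z) w =
    \sum_(1 <= k < (p nu).+1) Phi k nu *m Y (n * s%:Z + nu%:Z - k%:Z) w
    + eps (n * s%:Z + nu%:Z) w}.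
Variable PsiC : nat -> nat -> 'M[R]_d.
Hypothesis hsum : forall nu, (1 <= nu <= s)%N ->
  cvgn (series (fun j => `|PsiC j nu|)).
Hypothesis hcv : forall (n : int) (nu : nat), (1 <= nu <= s)%N ->
  {ae P, forall w,
    (fun J => \sum_(j < J) PsiC j nu *m eps (n * s%:Z + nu%:Z - j%:Z) w)
      @ \oo --> Y (n * s%:Z + nu%:Z) w}.
Hypothesis hmean : forall t, Emx P (eps t) = 0.
Variable Sigma : nat -> 'M[R]_d.
Hypothesis hvar : forall nu, (1 <= nu <= s)%N -> forall n : int,
  Covmx P (eps (n * s%:Z + nu%:Z)) (eps (n * s%:Z + nu%:Z)) = Sigma nu.
Hypothesis huncorr : forall t h : int, h != 0 -> Covmx P (eps t) (eps (t - h)) = 0.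
Variable K2 : R.
Hypothesis imt : forall t, L1 P (fun w => mt eps t w ^+ 2).
Hypothesis Emt : forall t, Ex P (fun w => mt eps t w ^+ 2) <= K2.

Lemma mx_entry_le m n (A : 'M[R]_(m, n)) i j : `|A i j| <= `|A|.
Proof.
rewrite [leRHS]mx_normrE.
exact: (le_bigmax _ (fun ij : 'I_m * 'I_n => `|A ij.1 ij.2|) (i, j)).
Qed.

Lemma L1_eps2 t u i j : L1 P (fun w => eps t w i ord0 * eps u w j ord0).
Proof.
have h v k : L1 P (fun w => eps v w k ord0 ^+ 2).
  apply: (L1_le _ _ (imt v)) => [|w]; first exact: measurable_funX.
  rewrite ger0_norm ?sqr_ge0// -[leLHS]real_normK ?num_real//.
  by rewrite lerXn2r ?nnegrE ?mt_ge0 ?eps_le_mt.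
exact: L1_mul.
Qed.

Lemma Covmx_eps t u i j : Covmx P (eps t) (eps u) i j =
  Ex P (fun w => eps t w i ord0 * eps u w j ord0).
Proof.
rewrite /Covmx !hmean mxE; apply: eq_Ex => w.
by rewrite !subr0 mxE big_ord1 !mxE.
Qed.

Definition Sg (t : int) : 'M[R]_d := Sigma (sea s t).

Lemma Ex_eps2 t u i j : Ex P (fun w => eps t w i ord0 * eps u w j ord0) =
  if t == u then Sg t i j else 0.
Proof.
rewrite -Covmx_eps; case: eqVneq => [<-|tu].
  by rewrite {1 2}(blk_sea hs t) hvar// sea_bound.
have -> : u = t - (t - u) by rewrite opprB addrC subrK.
by rewrite huncorr ?mxE// subr_eq0.
Qed.

(** These covariances stand in for the causal coefficients: [HH (u + n) u] is the n-th coefficient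
    times the variance at u, and it inherits the model recursion. *)
Definition HH (t u : int) (a b : 'I_d) : R :=
  Ex P (fun w => Y t w a ord0 * eps u w b ord0).

Lemma K2_ge0 : 0 <= K2.
Proof. by apply: le_trans (Emt 0); apply: Ex_ge0 => w; exact: sqr_ge0. Qed.

Lemma mt_mul t u : L1 P (fun w => mt eps t w * mt eps u w) /\
  Ex P (fun w => mt eps t w * mt eps u w) <= K2.
Proof.
have i : L1 P (fun w => mt eps t w * mt eps u w).
  by apply: L1_mul => //; exact: measurable_mt.
split=> //.
apply: le_trans (_ : Ex P (fun w => 2^-1 * (mt eps t w ^+ 2 + mt eps u w ^+ 2)) <= _).
  apply: Ex_le => // [|w]; first by apply: L1Z; exact: L1D.
  have := sqr_ge0 (mt eps t w - mt eps u w); rewrite sqrrB; lra.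
rewrite ExZ ?ExD//; last exact: L1D.
have := Emt t; have := Emt u; lra.
Qed.

Definition ser_dom (t u : int) (j : nat) (w : T) : R :=
  `|PsiC j (sea s t)| * (mt eps (t - j%:Z) w * mt eps u w).

Lemma ser_dom_ge0 t u j w : 0 <= ser_dom t u j w.
Proof. by rewrite /ser_dom !mulr_ge0 ?mt_ge0. Qed.

Lemma measurable_ser_dom t u j : measurable_fun setT (ser_dom t u j).
Proof.
by apply: measurable_funM => //; apply: measurable_funM; exact: measurable_mt.
Qed.

Lemma ser_dom_integrable t u :
  P.-integrable setT (fun w => \sum_(0 <= j <oo) (ser_dom t u j w)%:E)%E.
Proof.
have nn w : (0 <= \sum_(0 <= j <oo) (ser_dom t u j w)%:E)%E.
  by apply: nneseries_ge0 => j _ _; rewrite lee_fin ser_dom_ge0.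
apply/integrableP; split.
  apply: ge0_emeasurable_sum => [j w _ _|j _]; first by rewrite lee_fin ser_dom_ge0.
  by apply/measurable_EFinP; exact: measurable_ser_dom.
under eq_integral do rewrite gee0_abs//.
rewrite integral_nneseries//; last 2 first.
- by move=> j; apply/measurable_EFinP; exact: measurable_ser_dom.
- by move=> j w _; rewrite lee_fin ser_dom_ge0.
have hb := sea_bound hs t.
set nrm := fun j => `|PsiC j (sea s t)|.
apply: (@le_lt_trans _ _ (limn (series nrm) * K2)%:E); last exact: ltry.
apply: lime_le.
  apply: is_cvg_nneseries => j _ _; apply: integral_ge0 => w _.
  by rewrite lee_fin ser_dom_ge0.
apply: nearW => N; apply: (@le_trans _ _ (\sum_(0 <= j < N) (nrm j * K2)%:E)%E).
  apply: lee_sum => j _; have [i E] := mt_mul (t - j%:Z) u.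
  rewrite -EFin_Ex; last exact: L1Z.
  by rewrite lee_fin /ser_dom ExZ// ler_wpM2l.
rewrite sumEFin lee_fin -mulr_suml ler_wpM2r ?K2_ge0//.
apply: nondecreasing_cvgn_le (hsum hb) N.
by apply: nondecreasing_series => j _ _; exact: normr_ge0.
Qed.

Definition Spart (t : int) (J : nat) (a : 'I_d) (w : T) : R :=
  \sum_(j < J) \sum_i PsiC j (sea s t) a i * eps (t - j%:Z) w i ord0.

Lemma Spart_cvg t a : {ae P, forall w, (fun J => Spart t J a w) @ \oo --> Y t w a ord0}.
Proof.
have := hcv (blk s t) (sea_bound hs t); rewrite -blk_sea//.
apply: filterS => w h.
have -> : (fun J => Spart t J a w) =
    (fun J => (\sum_(j < J) PsiC j (sea s t) *m eps (t - j%:Z) w) a ord0).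
  apply/funext => J; rewrite /Spart summxE; apply: eq_bigr => j _.
  by rewrite mxE.
exact: (cvg_comp _ _ h (@coord_continuous _ _ _ _ _ _)).
Qed.

Lemma Spart_bound t u J a b w : `|Spart t J a w * eps u w b ord0| <=
  \sum_(j < J) ser_dom t u j w.
Proof.
rewrite /Spart mulr_suml; apply: le_trans (ler_norm_sum _ _ _) _.
apply: ler_sum => j _; rewrite normrM /ser_dom mulrA.
apply: ler_pM => //; last exact: eps_le_mt.
rewrite /mt mulr_sumr; apply: le_trans (ler_norm_sum _ _ _) _.
by apply: ler_sum => i _; rewrite normrM ler_wpM2r// mx_entry_le.
Qed.

(** The causal series converges only almost surely; dominated convergence, with the absolutely
    convergent series of [ser_dom] as majorant, carries it over to covariances. *)
Lemma HH_lim t u a b : L1 P (fun w => Y t w a ord0 * eps u w b ord0) /\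
  (fun J => Ex P (fun w => Spart t J a w * eps u w b ord0)) @ \oo --> HH t u a b.
Proof.
have mS J : measurable_fun setT (fun w => Spart t J a w * eps u w b ord0).
  apply: measurable_funM => //; apply: measurable_sum => j.
  by apply: measurable_sum => i; exact: measurable_funM.
have mYe : measurable_fun setT (fun w => Y t w a ord0 * eps u w b ord0).
  exact: measurable_funM.
have [] := @dominated_convergence _ T R P setT measurableT
  (fun J w => (Spart t J a w * eps u w b ord0)%:E)
  (fun w => (Y t w a ord0 * eps u w b ord0)%:E)
  (fun w => \sum_(0 <= j <oo) (ser_dom t u j w)%:E)%E.
- by move=> J; apply/measurable_EFinP.
- exact/measurable_EFinP.
- apply: filterS (Spart_cvg t a) => w h _.
  by apply: cvg_EFin; [exact: nearW|apply: cvgM => //; exact: cvg_cst].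
- exact: ser_dom_integrable.
- apply: aeW => w J _; rewrite abse_EFin.
  apply: le_trans (nneseries_lim_ge J _); last first.
    by move=> j _ _; rewrite lee_fin ser_dom_ge0.
  by rewrite sumEFin lee_fin big_mkord Spart_bound.
move=> i _ cv; split; first exact: i.
rewrite /HH ExE /Rintegral.
have E J : Ex P (fun w => Spart t J a w * eps u w b ord0) =
    fine (\int[P]_w (Spart t J a w * eps u w b ord0)%:E)%E by rewrite ExE.
under eq_fun do rewrite E.
apply: fine_cvg; rewrite fineK//.
exact: (integrable_fin_num measurableT i).
Qed.

Lemma Ex_Spart t u J a b : Ex P (fun w => Spart t J a w * eps u w b ord0) =
  \sum_(j < J) if t - j%:Z == u then (PsiC j (sea s t) *m Sg u) a b else 0.
Proof.
have -> : (fun w => Spart t J a w * eps u w b ord0) = (fun w =>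
    \sum_(j < J) \sum_i PsiC j (sea s t) a i * (eps (t - j%:Z) w i ord0 * eps u w b ord0)).
  apply/funext => w; rewrite mulr_suml; apply: eq_bigr => j _.
  by rewrite mulr_suml; apply: eq_bigr => i _; rewrite mulrA.
rewrite Ex_sum; last first.
  by move=> j _; apply: L1_sum => i _; apply: L1Z; exact: L1_eps2.
apply: eq_bigr => j _; rewrite Ex_sum; last by move=> i _; apply: L1Z; exact: L1_eps2.
rewrite (eq_bigr (fun i => PsiC j (sea s t) a i *
    (if t - j%:Z == u then Sg (t - j%:Z) i b else 0))); last first.
  by move=> i _; rewrite ExZ ?Ex_eps2//; exact: L1_eps2.
case: eqVneq => [->|_]; first by rewrite mxE.
by under eq_bigr do rewrite mulr0; rewrite big1.
Qed.

Lemma HH_future t u a b : t < u -> HH t u a b = 0.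
Proof.
move=> tu; have [_ h] := HH_lim t u a b.
rewrite -(cvg_lim _ h)//; apply/cvg_lim => //.
have e J : Ex P (fun w => Spart t J a w * eps u w b ord0) = 0.
  by rewrite Ex_Spart big1// => j _; case: eqP => // e; lia.
by under eq_fun do rewrite e; exact: cvg_cst.
Qed.

Lemma HH_past u (n : nat) a b : HH (u + n%:Z) u a b =
  (PsiC n (sea s (u + n%:Z)) *m Sg u) a b.
Proof.
have [_ h] := HH_lim (u + n%:Z) u a b.
rewrite -(cvg_lim _ h)//; apply/cvg_lim => //.
apply: cvg_near_cst; exists n.+1 => // J /= nJ.
rewrite Ex_Spart (bigD1 (Ordinal nJ))//= addrK eqxx big1 ?addr0// => j jn.
case: eqP => // e; exfalso; move/eqP: jn; apply; apply: val_inj => /=; lia.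
Qed.

(** The model equation is multiplied by an entry of the innovation at u and integrated. *)
Lemma HH_rec t u a b : HH t u a b =
  \sum_(1 <= k < (p (sea s t)).+1) \sum_i Phi k (sea s t) a i * HH (t - k%:Z) u i b +
  (if t == u then Sg t a b else 0).
Proof.
have iYe v i c : L1 P (fun w => Y v w i ord0 * eps u w c ord0) by have [] := HH_lim v u i c.
rewrite -Ex_eps2 /HH.
pose F w := \sum_(1 <= k < (p (sea s t)).+1) \sum_i Phi k (sea s t) a i *
  (Y (t - k%:Z) w i ord0 * eps u w b ord0).
have iF : L1 P F.
  by apply: L1_sum => k _; apply: L1_sum => i _; apply: L1Z.
have -> : \sum_(1 <= k < (p (sea s t)).+1) \sum_i Phi k (sea s t) a i *
    Ex P (fun w => Y (t - k%:Z) w i ord0 * eps u w b ord0) = Ex P F.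
  rewrite Ex_sum; last by move=> k _; apply: L1_sum => i _; apply: L1Z.
  apply: eq_bigr => k _; rewrite Ex_sum; last by move=> i _; apply: L1Z.
  by apply: eq_bigr => i _; rewrite ExZ.
rewrite -ExD//; last exact: L1_eps2.
apply: Ex_ae.
- exact: measurable_funM.
- by apply: L1_meas (L1D iF (L1_eps2 _ _ _ _)).
have := hrec (blk s t) (sea_bound hs t); rewrite -blk_sea//.
apply: filterS => w ->; rewrite mxE mulrDl; congr (_ + _).
rewrite summxE mulr_suml /F; apply: eq_bigr => k _.
by rewrite mxE mulr_suml; apply: eq_bigr => i _; rewrite mulrA.
Qed.

Hypothesis hPhi0 : forall l nu, (p nu < l)%N -> Phi l nu = 0.
Hypothesis hunit : forall nu, (1 <= nu <= s)%N -> Sigma nu \in unitmx.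

Lemma PsiC_to0 nu : (1 <= nu <= s)%N -> to0 (fun j => `|PsiC j nu|).
Proof.
move=> h e e0; have /cvgrPdist_le /(_ e e0) := cvg_series_cvg_0 (hsum h).
move=> [N _ hN]; exists N => n /hN /=.
by rewrite sub0r normrN normr_id.
Qed.

(** At times after u the innovation term drops out of [HH_rec], so each column solves the
    homogeneous periodic recursion; it tends to 0 because the causal coefficients are summable. *)
Lemma HH_geo u : exists K r, [/\ 0 <= K, 0 <= r, r < 1 &
  forall (ab : 'I_d * 'I_d) (n : nat), `|HH (u + n%:Z) u ab.1 ab.2| <= K * r ^+ n].
Proof.
(* This q exceeds the period and every order, so one state holds a full period and all lags; missing
   lags have zero coefficients. *)
pose q := (s + pmax s p).+1.
have pq nu : (1 <= nu <= s)%N -> (p nu <= q)%N.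
  move=> /andP[h1 h2]; apply: leq_trans (_ : pmax s p <= q)%N; last by rewrite /q; lia.
  have hn : (nu.-1 < s)%N by lia.
  have := leq_bigmax (F := fun i : 'I_s => p i.+1) (Ordinal hn).
  by rewrite /= prednK.
pose h b (t : int) : 'rV[R]_d := \row_a HH (u + t) u a b.
pose M (k : 'I_q) (t : int) := (Phi k.+1 (sea s (u + t)))^T.
have per k t : M k (t + s%:Z) = M k t.
  rewrite /M; congr (Phi _ _)^T.
  by rewrite addrA -[X in _ + X]mul1r addrC (sea_per hs).
have rec b t : 0 < t -> h b t = \sum_(k < q) h b (t - k.+1%:Z) *m M k t.
  move=> t0; apply/rowP => a; rewrite mxE HH_rec.
  have -> : (u + t == u) = false by lia.
  rewrite addr0 summxE.
  set pt := p (sea s (u + t)).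
  have ppt : (pt <= q)%N by apply: pq; exact: sea_bound.
  rewrite big_add1 /= big_mkord (big_ord_widen _ (fun k => \sum_i Phi k.+1 (sea s (u + t)) a i *
    HH (u + t - k.+1%:Z) u i b) ppt).
  rewrite big_mkcond /=; apply: eq_bigr => k _; rewrite mxE.
  case: ifPn => [_|]; last first.
    rewrite -leqNgt => hk; rewrite big1// => i _.
    by rewrite /M hPhi0 ?ltnS// trmx0 [X in _ * X]mxE mulr0.
  by apply: eq_bigr => i _; rewrite !mxE mulrC addrA.
have h0 b a : to0 (fun n : nat => `|h b n%:Z 0 a|).
  move=> e e0.
  pose S := 1 + \sum_i `|Sg u i b|.
  have S0 : 0 < S by rewrite ltr_wpDr// sumr_ge0.
  have eS : 0 < e / S by rewrite divr_gt0.
  have [Nf hN] := fin_all_exists (fun i : 'I_s => PsiC_to0 (nu := i.+1) (ltn_ord i) eS).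
  exists (\max_i Nf i)%N => n hn; rewrite mxE HH_past.
  have hb := sea_bound hs (u + n%:Z).
  have hi : ((sea s (u + n%:Z)).-1 < s)%N by lia.
  have hP : `|PsiC n (sea s (u + n%:Z))| <= e / S :=
    hN (Ordinal hi) n (leq_trans (leq_bigmax (Ordinal hi)) hn).
  rewrite mxE; apply: le_trans (ler_norm_sum _ _ _) _.
  apply: le_trans (_ : \sum_i e / S * `|Sg u i b| <= _).
    apply: ler_sum => i _; rewrite normrM ler_wpM2r//.
    exact: le_trans (mx_entry_le _ _ _) hP.
  by rewrite -mulr_sumr mulrAC ler_pdivrMr// ler_pM2l// /S lerDr.
have sq : (s < q)%N by rewrite /q; lia.
have [|K [r [K0 r0 r1 hK]]] := @geo_fin _ _ (fun (ab : 'I_d * 'I_d) (n : nat) =>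
    `|HH (u + n%:Z) u ab.1 ab.2|).
  move=> [a b].
  have [K [r [K0 r0 r1 hK]]] := geo_periodic hs sq per (rec b) (h0 b).
  by exists K, r; split=> // n; have := hK n a; rewrite mxE.
by exists K, r.
Qed.

(** The coefficient of order n at season nu is [HH (u + n) u] times an inverse variance, for any u
    with u + n in season nu. One u in 0, ..., s - 1 can always be found, so finitely many decay
    rates are involved. *)
Lemma PsiC_geo : exists K r, [/\ 0 <= K, 0 < r, r < 1 &
  forall nu, (1 <= nu <= s)%N -> forall n a b, `|PsiC n nu a b| <= K * r ^+ n].
Proof.
have [Kf hKf] := fin_all_exists (fun u : 'I_s => HH_geo u%:Z).
have [|K [r [K0 r0 r1 hK]]] := @geo_fin _ _ (fun (x : 'I_s * ('I_d * 'I_d)) (n : nat) =>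
    `|HH (x.1%:Z + n%:Z) x.1%:Z x.2.1 x.2.2|).
  move=> [u ab]; have [r [K0 r0 r1 h]] := hKf u.
  by exists (Kf u), r; split.
(* [r] may be 0; a strictly positive rate is needed where the rate is inverted later. *)
pose r' := (1 + r) / 2.
have rr' : r <= r' by rewrite /r'; lra.
have r'0 : 0 < r' by rewrite /r'; lra.
have r'1 : r' < 1 by rewrite /r'; lra.
pose C := \sum_(u < s) \sum_(i < d) \sum_(b < d) `|invmx (Sg u%:Z) i b|.
have C0 : 0 <= C by do 3 apply: sumr_ge0 => ? _.
exists (K * C), r'; split=> // [|nu hnu n a b]; first by rewrite mulr_ge0.
pose u0 := ((nu%:Z - n%:Z) %% s%:Z)%Z.
have u00 : 0 <= u0 by apply: modz_ge0; lia.
have u0s : u0 < s%:Z by apply: ltz_pmod; lia.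
have hu : (absz u0 < s)%N by lia.
pose u := Ordinal hu.
have uE : u%:Z = u0 by rewrite /u /= gez0_abs.
have seaE : sea s (u%:Z + n%:Z) = nu.
  have := divz_eq (nu%:Z - n%:Z) s%:Z; rewrite -/u0 -uE => e.
  rewrite -(sea_per hs (u%:Z + n%:Z) ((nu%:Z - n%:Z) %/ s%:Z)%Z) addrA -e subrK.
  by have := sea_nu hs 0 hnu; rewrite mul0r add0r.
have -> : PsiC n nu a b = \sum_i HH (u%:Z + n%:Z) u%:Z a i * invmx (Sg u%:Z) i b.
  have uS : Sg u%:Z \in unitmx by apply: hunit; exact: sea_bound.
  rewrite -{1}(mulmxK uS (PsiC n nu)) mxE.
  by apply: eq_bigr => i _; rewrite HH_past seaE.
apply: le_trans (ler_norm_sum _ _ _) _.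
apply: le_trans (_ : \sum_i (K * r' ^+ n) * `|invmx (Sg u%:Z) i b| <= _).
  apply: ler_sum => i _; rewrite normrM ler_wpM2r//.
  apply: le_trans (hK (u, (a, i)) n) _; rewrite ler_wpM2l//.
  by rewrite lerXn2r// nnegrE// ltW.
have -> : \sum_i K * r' ^+ n * `|invmx (Sg u%:Z) i b| =
    K * (\sum_i `|invmx (Sg u%:Z) i b|) * r' ^+ n.
  by rewrite mulr_sumr mulr_suml; apply: eq_bigr => i _; ring.
rewrite ler_wpM2r ?exprn_ge0 ?(ltW r'0)//.
rewrite ler_wpM2l// /C (bigD1 u)//=.
apply: le_trans (_ : \sum_(i < d) \sum_(b0 < d) `|invmx (Sg u%:Z) i b0| <= _); last first.
  by rewrite lerDl; do 3 apply: sumr_ge0 => ? _.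
by apply: ler_sum => i _; rewrite (bigD1 b)//= lerDl sumr_ge0.
Qed.

End Identification.

Section GeoUnique.
Context {R : realType}.

(** Meant for expectations: if two of them are approximated by the same truncated expectations, they
    agree. This is how stationarity reaches the almost sure limits. *)
Lemma geo_unique (a b K s : R) (x : nat -> R) : 0 < s -> s < 1 ->
  (forall r, `|a - x r| <= K * s ^+ r) -> (forall r, `|b - x r| <= K * s ^+ r) ->
  a = b.
Proof.
move=> s0 s1 ha hb; apply/eqP; rewrite -subr_eq0 -normr_le0.
apply/ler_addgt0Pr => /= e e0; rewrite add0r.
have : (fun r => 2 * K * s ^+ r) @ \oo --> 2 * K * 0.
  by apply: cvgMr; apply: cvg_expr; rewrite gtr0_norm.
rewrite mulr0 => /cvgrPdist_le /(_ e e0) [N _ /(_ N (leqnn _))].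
rewrite sub0r normrN => h; apply: le_trans (le_trans (ler_norm _) h).
rewrite -(subrKA (x N)); apply: le_trans (ler_normD _ _) _.
rewrite mulr_natl mulr2n mulrDl; apply: lerD => //.
by rewrite distrC.
Qed.

End GeoUnique.

(** * Strong mixing coefficients of the stacked innovations *)

Section Mixing.
Context {R : realType} {dT : measure_display} {T : measurableType dT}.
Variables (P : probability T R) (m : nat) (X : int -> T -> 'cV[R]_m).
Hypothesis mX : forall n i j, measurable_fun setT (fun w => X n w i j).
Variable kappa : R.
Hypothesis k0 : 0 < kappa.
Hypothesis hmix : cvgn (series (fun k => alpha_mixing P X k `^ (kappa / (2 + kappa)))).

Let th := kappa / (2 + kappa).

Lemma sigma_past_measurable n A : sigma_past X n A -> measurable A.
Proof.
apply: sigma_measurable => {}A [k [i [B [_ [mB ->]]]]].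
by rewrite -[X in measurable X]setTI; exact: mX.
Qed.

Lemma sigma_future_measurable n A : sigma_future X n A -> measurable A.
Proof.
apply: sigma_measurable => {}A [k [i [B [_ [mB ->]]]]].
by rewrite -[X in measurable X]setTI; exact: mX.
Qed.

Lemma prob01 (A : set T) : measurable A -> 0 <= fine (P A) <= 1.
Proof.
move=> mA; rewrite fine_ge0//= -lee_fin fineK ?fin_num_measure//.
exact: probability_le1.
Qed.

Lemma mixing_dist_le1 n k A B : sigma_past X n A -> sigma_future X (n + k%:Z) B ->
  `|fine (P (A `&` B)) - fine (P A) * fine (P B)| <= 1.
Proof.
move=> /sigma_past_measurable mA /sigma_future_measurable mB.
have /andP[a0 a1] := prob01 mA; have /andP[b0 b1] := prob01 mB.
have /andP[c0 c1] := prob01 (measurableI _ _ mA mB).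
have ab : 0 <= fine (P A) * fine (P B) <= 1 by rewrite mulr_ge0//= mulr_ile1.
rewrite ler_norml; lra.
Qed.

Lemma alpha_le n k A B : sigma_past X n A -> sigma_future X (n + k%:Z) B ->
  `|fine (P (A `&` B)) - fine (P A) * fine (P B)| <= alpha_mixing P X k.
Proof.
move=> hA hB; apply: ub_le_sup; last by exists n, A, B.
by exists 1 => _ [n' [A' [B' [hA' [hB' ->]]]]]; exact: mixing_dist_le1 hA' hB'.
Qed.

Lemma alpha_le1 k : alpha_mixing P X k <= 1.
Proof.
apply: ge_sup.
  by exists `|fine (P (set0 `&` set0)) - fine (P set0) * fine (P set0)|, 0, set0, set0;
    do ?split; exact: sigma_algebra0.
by move=> _ [n' [A' [B' [hA' [hB' ->]]]]]; exact: mixing_dist_le1 hA' hB'.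
Qed.

(* The geometric floor keeps the bound positive, so that it can be raised to
   a negative power when choosing truncation levels. *)
Definition al (k : nat) : R := Num.max (alpha_mixing P X k) (2^-1 ^+ k).

Lemma al_gt0 k : 0 < al k.
Proof. by rewrite /al lt_max exprn_gt0 ?orbT// invr_gt0. Qed.

Lemma al_le1 k : al k <= 1.
Proof.
rewrite /al ge_max alpha_le1 exprn_ile1 ?invr_ge0//.
by rewrite invf_le1// ler1n.
Qed.

Lemma al_mix n (k : nat) : mixing_le P
  [set A | exists (j : int) (i : 'I_m) (B : set R), (j <= n)%R /\
     measurable B /\ A = (fun w => X j w i ord0) @^-1` B]
  [set A | exists (j : int) (i : 'I_m) (B : set R), (n + k%:Z <= j)%R /\
     measurable B /\ A = (fun w => X j w i ord0) @^-1` B] (al k).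
Proof.
move=> A B hA hB; apply: le_trans (alpha_le hA hB) _.
by rewrite /al le_max lexx.
Qed.

(** A power of a maximum is at most the sum of the powers, and the geometric floor contributes a
    convergent geometric series. *)
Lemma al_sum : exists2 A, 0 <= A & forall N, \sum_(j < N) al j `^ th <= A.
Proof.
have th0 : 0 < th by rewrite divr_gt0// addr_gt0.
pose u := (2^-1 : R) `^ th.
have u0 : 0 <= u by exact: powR_ge0.
have u1 : u < 1.
  have <- : (1 : R) `^ th = 1 by rewrite powR1.
  apply: gt0_ltr_powR; rewrite ?nnegrE//.
  by rewrite invf_lt1// ltr1n.
have h k : al k `^ th <= alpha_mixing P X k `^ th + u ^+ k.
  have e : (2^-1 ^+ k) `^ th = u ^+ k.
    by rewrite -powR_mulrn// powRAC powR_mulrn// powR_ge0.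
  rewrite /al -e /Num.max; case: ifP => _; first by rewrite lerDr powR_ge0.
  by rewrite lerDl powR_ge0.
exists (limn (series (fun k => alpha_mixing P X k `^ th)) + (1 - u)^-1).
  rewrite addr_ge0 ?invr_ge0 ?subr_ge0 ?(ltW u1)//.
  apply: limr_ge; first exact: hmix.
  by apply: nearW => N; apply: sumr_ge0 => k _; exact: powR_ge0.
move=> N; apply: (@le_trans _ _ (\sum_(j < N) (alpha_mixing P X j `^ th + u ^+ j))).
  by apply: ler_sum => j _; exact: h.
rewrite big_split /=; apply: lerD; last exact: sum_geo_le.
rewrite -(big_mkord xpredT (fun k => alpha_mixing P X k `^ th)).
apply: (nondecreasing_cvgn_le _ hmix N).
by apply: nondecreasing_series => k _ _; exact: powR_ge0.
Qed.

End Mixing.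

Arguments ap_meas {dT T R P past future G s c Z Zr} _ n.
Arguments ap_past {dT T R P past future G s c Z Zr} _ r n.
Arguments ap_fut {dT T R P past future G s c Z Zr} _ r n.
Arguments ap_dom {dT T R P past future G s c Z Zr} _ n.
Arguments ap_domr {dT T R P past future G s c Z Zr} _ r n.
Arguments ap_err {dT T R P past future G s c Z Zr} _ r n.

(** * The regression at season nu: score and Gram processes *)

Section Model.
Context {R : realType} {dT : measure_display} {T : measurableType dT}.
Variables (P : probability T R) (d s : nat).
Hypothesis hs : (0 < s)%N.
Variables (p : nat -> nat) (Phi : nat -> nat -> 'M[R]_d).
Variables (Y eps : int -> T -> 'cV[R]_d).
Hypothesis meps : forall t i j, measurable_fun setT (fun w => eps t w i j).
Hypothesis mY : forall t i j, measurable_fun setT (fun w => Y t w i j).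
Hypothesis hPhi0 : forall l nu, (p nu < l)%N -> Phi l nu = 0.
Hypothesis hrec : forall (n : int) (nu : nat), (1 <= nu <= s)%N ->
  {ae P, forall w, Y (n * s%:Z + nu%:Z) w =
    \sum_(1 <= k < (p nu).+1) Phi k nu *m Y (n * s%:Z + nu%:Z - k%:Z) w
    + eps (n * s%:Z + nu%:Z) w}.
Variable PsiC : nat -> nat -> 'M[R]_d.
Hypothesis hsum : forall nu, (1 <= nu <= s)%N ->
  cvgn (series (fun j => `|PsiC j nu|)).
Hypothesis hcv : forall (n : int) (nu : nat), (1 <= nu <= s)%N ->
  {ae P, forall w,
    (fun J => \sum_(j < J) PsiC j nu *m eps (n * s%:Z + nu%:Z - j%:Z) w)
      @ \oo --> Y (n * s%:Z + nu%:Z) w}.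
Hypothesis hmean : forall t, Emx P (eps t) = 0.
Variable Sigma : nat -> 'M[R]_d.
Hypothesis hunit : forall nu, (1 <= nu <= s)%N -> Sigma nu \in unitmx.
Hypothesis hvar : forall nu, (1 <= nu <= s)%N -> forall n : int,
  Covmx P (eps (n * s%:Z + nu%:Z)) (eps (n * s%:Z + nu%:Z)) = Sigma nu.
Hypothesis huncorr : forall t h : int, h != 0 -> Covmx P (eps t) (eps (t - h)) = 0.
Hypothesis stat : strictly_stationary P (estar_path s eps).
Variable kappa : R.
Hypothesis k0 : 0 < kappa.
Hypothesis mom : forall n : int,
  (\int[P]_w ((sqnorm (estar s eps n w)) `^ (2 + kappa))%:E < +oo)%E.
Hypothesis hmix : cvgn (series (fun k =>
  (alpha_mixing P (estar s eps) k) `^ (kappa / (2 + kappa)))).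
Variable nu : nat.
Hypothesis hnu : (1 <= nu <= s)%N.

Local Notation tm n := (n * s%:Z + nu%:Z).
Local Notation Q := (4 + 2 * kappa).
Local Notation q := (p nu * d)%N.

(** Innovation and regressor coordinates share one index type, so that scores, Gram entries and
    squares are all instances of [procZ]. *)
Definition procV (a : 'I_d + 'I_q) (n : int) (w : T) : R :=
  match a with
  | inl i => eps (tm n) w i ord0
  | inr x => Xreg s p Y nu n w x ord0
  end.

Definition procZ a b n w := procV a n w * procV b n w.

Lemma Q1 : 1 <= Q. Proof. by have := k0; lra. Qed.

Lemma mt2 : exists K2, forall t, L1 P (fun w => mt eps t w ^+ 2) /\
  Ex P (fun w => mt eps t w ^+ 2) <= K2.
Proof.
have [K K0 hK] := mt_mom hs meps stat k0 mom; exists (1 + K) => t.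
have [i E] := hK t.
have eQ : Q = 2 + (2 + 2 * kappa) by ring.
have k2 : 0 < 2 + 2 * kappa by have := k0; lra.
have nE : (fun w => mt eps t w `^ Q) = (fun w => `|mt eps t w| `^ (2 + (2 + 2 * kappa))).
  by apply/funext => w; rewrite ger0_norm ?mt_ge0// eQ.
have [_ i2] := L1_pow (P := P) k2 (measurable_mt meps t) (ltac:(rewrite -nE; exact: i)).
split=> //; apply: le_trans (_ : Ex P (fun w => 1 + mt eps t w `^ Q) <= _).
  apply: Ex_le => // [|w]; first by apply: L1D => //; exact: L1_cst.
  have := sqr_le_pow (mt eps t w) k2.
  by rewrite ger0_norm ?mt_ge0// eQ.
by rewrite ExD ?Ex_cst ?lerD2l//; exact: L1_cst.
Qed.

(** Regressor block k is Y at lag k + 1, so its causal series starts with the innovation of lag k +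
    1 and the earlier coefficients vanish. The [enum_val] terms invert [mxvec_index]. *)
Definition coefV (a : 'I_d + 'I_q) : nat -> 'I_d -> R :=
  match a with
  | inl i => fun l i' => if (l == 0%N) && (i == i') then 1 else 0
  | inr x => fun l i' => let k := (enum_val (cast_ord (esym (mxvec_cast (p nu) d)) x)).1 in
      let j := (enum_val (cast_ord (esym (mxvec_cast (p nu) d)) x)).2 in
      if (l < k.+1)%N then 0 else PsiC (l - k.+1) (sea s (nu%:Z - k.+1%:Z)) j i'
  end.

Lemma coefV_index k j l i' : coefV (inr (mxvec_index k j)) l i' =
  if (l < k.+1)%N then 0 else PsiC (l - k.+1) (sea s (nu%:Z - k.+1%:Z)) j i'.
Proof. by rewrite /coefV /mxvec_index /= cast_ordK enum_rankK. Qed.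

Lemma procV_index k j n w : procV (inr (mxvec_index k j)) n w = Y (tm n - k.+1%:Z) w j ord0.
Proof. by rewrite /procV /Xreg mxE mxvecE !mxE. Qed.

Local Arguments coefV : simpl never.

Lemma linproc_V : exists C sg, [/\ 0 <= C, 0 < sg, sg < 1 &
  forall a, linproc P s eps nu sg C (procV a) (coefV a)].
Proof.
have [K2 hK2] := mt2.
have [K [r [K0 r0 r1 hP]]] := PsiC_geo hs meps mY hrec hsum hcv hmean hvar huncorr
  (fun t => (hK2 t).1) (fun t => (hK2 t).2) hPhi0 hunit.
(* [linproc] asks for coefficients bounded by the square of its rate. *)
pose sg := Num.sqrt r.
have sg2 l : (sg ^+ l) ^+ 2 = r ^+ l.
  by rewrite exprAC sqr_sqrtr// ltW.
have sg0 : 0 < sg by rewrite sqrtr_gt0.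
have sg1 : sg < 1 by rewrite -sqrtr1 ltr_sqrt.
(* The 1 serves the innovation coordinates; the inverse power of r pays for the delay of at most p
   nu steps in the regressors. *)
pose C := 1 + K * r ^- (p nu).
have rn n : 0 < r ^+ n by rewrite exprn_gt0.
have Kr : 0 <= K * r ^- (p nu) by rewrite mulr_ge0// invr_ge0 ltW.
have C0 : 0 <= C by rewrite addr_ge0.
exists C, sg; split=> // -[i|x]; split.
- by move=> n; exact: meps.
- move=> l i'; rewrite /coefV sg2; case: ifPn => [/andP[/eqP -> _]|_].
    by rewrite normr1 expr0 mulr1 lerDl.
  by rewrite normr0 mulr_ge0// ltW.
- move=> n; apply: aeW => w; apply: cvg_near_cst; exists 1%N => // J /= J1.
  rewrite /lin (bigD1 (Ordinal J1))//= [X in _ + X]big1 ?addr0.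
    rewrite /coefV (bigD1 i)//= eqxx mul1r big1 ?addr0 ?subr0// => j ji.
    by rewrite eq_sym (negbTE ji) mul0r.
  move=> l l0; rewrite big1// => j _; rewrite /coefV; case: eqP => [l00|_]; last by rewrite mul0r.
  by move: l0; rewrite -val_eqE /= l00.
- case/mxvec_indexP: x => k j n.
  rewrite (_ : procV _ n = fun w => Y (tm n - k.+1%:Z) w j ord0).
    exact: mY.
  by apply/funext => w; rewrite procV_index.
- case/mxvec_indexP: x => k j l i'; rewrite coefV_index sg2.
  case: ltnP => [_|kl]; first by rewrite normr0 mulr_ge0// ltW.
  apply: le_trans (hP _ _ _ _ _) _; first exact: sea_bound.
  apply: le_trans (_ : K * r ^- (p nu) * r ^+ l <= _); last first.
    by rewrite ler_wpM2r ?(ltW (rn _))// lerDr.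
  rewrite -mulrA ler_wpM2l// mulrC ler_pdivlMr// -exprD.
  by apply: ler_wiXn2l; rewrite ?(ltW r0) ?(ltW r1)//; have := ltn_ord k; lia.
- case/mxvec_indexP: x => k j n.
  have := Spart_cvg hs hcv (tm n - k.+1%:Z) j.
  apply: filterS => w h; rewrite procV_index.
  rewrite -(cvg_shiftn k.+1).
  rewrite (_ : (fun r => _) = (fun J => Spart s eps PsiC (tm n - k.+1%:Z) J j w))//.
  apply/funext => J; rewrite /lin addnC big_split_ord /= big1 ?add0r.
    apply: eq_bigr => l _; apply: eq_bigr => i _.
    rewrite coefV_index ltnNge leq_addr /= addKn.
    have -> : sea s (tm n - k.+1%:Z) = sea s (nu%:Z - k.+1%:Z).
      by rewrite -addrA (sea_per hs).
    congr (_ * eps _ _ _ _).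
    by rewrite PoszD opprD !addrA.
  by move=> l _; rewrite big1// => i _; rewrite coefV_index ltn_ord mul0r.
Qed.

(** The interface between the probabilistic estimates and the HAC argument, with one constant for
    all of them. In [mf_avg] the clipping level M, the depth r and the accuracy x stay free, to be
    tuned to the bandwidth. *)
Record model_facts (B sg : R) (g : nat -> R) : Prop := {
  mf_B : 1 <= B;
  mf_sg0 : 0 < sg;
  mf_sg1 : sg < 1;
  mf_g0 : forall h, 0 <= g h;
  mf_gsum : forall N, \sum_(h < N) g h <= B;
  mf_L1 : forall a b n, L1 P (procZ a b n);
  mf_L1Z : forall a b c e n m, L1 P (fun w => procZ a b n w * procZ c e m w);
  mf_stat : forall a b n, Ex P (procZ a b n) = Ex P (procZ a b 0);
  mf_statZ : forall a b c e n m k,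
    Ex P (fun w => procZ a b (n + k) w * procZ c e (m + k) w) =
    Ex P (fun w => procZ a b n w * procZ c e m w);
  mf_var : forall a b (N : nat),
    let D w := \sum_(n < N) procZ a b n%:Z w - N%:R * Ex P (procZ a b 0) in
    L1 P (fun w => D w ^+ 2) /\ Ex P (fun w => D w ^+ 2) <= N%:R * B;
  mf_cov : forall a b c e (h : nat),
    `|cov P (procZ a b h%:Z) (procZ c e 0)| <= g h;
  mf_avg : forall a b c e M (h r N : nat) x, 0 < M -> 0 < x ->
    N%:R * (B * M ^+ 4 * ((h + r)%:R + B)) <= x ^+ 2 ->
    let D w := \sum_(j < N) procZ a b (j%:Z + h%:Z) w * procZ c e j%:Z w -
      N%:R * Ex P (fun w => procZ a b h%:Z w * procZ c e 0 w) in
    L1 P D /\ Ex P (fun w => `|D w|) <= x + N%:R * (B * (sg ^+ r + M `^ (- kappa)));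
  mf_sqr : forall a b n, Ex P (fun w => procZ a b n w * procZ a b n w) <= B }.

Lemma model_factsP : exists B sg g, model_facts B sg g.
Proof.
have [C [sg [C0 sg0 sg1 hL]]] := linproc_V.
have [K K0 hK] := mt_mom hs meps stat k0 mom.
have mK1 t := (hK t).1; have mK2 t := (hK t).2.
have [A A0 hA] := al_sum k0 hmix.
pose D := dom (mt eps) Q sg.
have D0 t w : 0 <= D t w by exact: dom_ge0.
have Ddom := dom_dominates (mt_ge0 eps) (measurable_mt meps) Q1 mK1 mK2 sg0 sg1.
pose G := Gdom s nu D; pose KG := K / (1 - sg).
have mG n : measurable_fun setT (G n).
  by apply: measurable_funX; apply: measurable_dom; exact: measurable_mt.
have G0 n w : 0 <= G n w by exact: sqr_ge0.
have GE n w : G n w `^ (2 + kappa) = D (tm n) w `^ Q.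
  have -> : Q = 2%:R * (2 + kappa) by ring.
  by rewrite powRrM (powR_mulrn 2 (D0 _ _)).
have hD t := dom_mom (mt_ge0 eps) (measurable_mt meps) Q1 mK1 mK2 sg0 sg1 t.
have iG n : L1 P (fun w => G n w `^ (2 + kappa)).
  by under eq_fun do rewrite GE; have [] := hD (tm n).
have EG n : Ex P (fun w => G n w `^ (2 + kappa)) <= KG.
  by under eq_fun do rewrite GE; have [] := hD (tm n).
have KG0 : 0 <= KG by rewrite divr_ge0// subr_ge0 ltW.
set c := 2 * (C / (1 - sg)) ^+ 2.
have c0 : 0 <= c by rewrite mulr_ge0 ?sqr_ge0.
have aZ a b : approx P (past_gen s eps) (future_gen s eps) G sg c (procZ a b)
    (fun r n w => lin s eps nu (coefV a) r n w * lin s eps nu (coefV b) r n w).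
  exact (prod_approx hs hnu D0 Ddom sg0 sg1 C0 (hL a) (hL b)).
have hp := past_gen_measurable (s := s) meps.
have hf := future_gen_measurable (s := s) meps.
have pm := @past_gen_mono R _ T d s eps; have fa := @future_gen_anti R _ T d s eps.
pose al' := al P (estar s eps).
have al0 k : 0 < al' k by exact: al_gt0.
have mE := measurable_estar meps (s := s).
have al1 k : al' k <= 1 by exact: al_le1.
have hm n (k : nat) : mixing_le P (past_gen s eps n) (future_gen s eps (n + k%:Z)) (al' k).
  exact: al_mix.
pose g := cbound al' kappa KG sg c.
pose q' := c `^ (2 + kappa) * KG.
have q'0 : 0 <= q' by rewrite mulr_ge0 ?powR_ge0.
pose cs := csum kappa A KG sg c.
have gs N : \sum_(h < N) g h <= cs by exact (cbound_sum hA EG sg0 sg1 c N).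
have cs0 : 0 <= cs by have := gs 0%N; rewrite big_ord0.
(* The sum of what the fields ask for: 2 cs for [mf_var] and [mf_gsum], the last summand for
   [mf_sqr], the others for [mf_avg]. *)
pose B := 8 + A + 2 * cs + 4 * c ^+ 2 * (1 + KG) + 8 * q' + c ^+ 2 * (1 + KG).
have t1 : 0 <= c ^+ 2 * (1 + KG) by rewrite mulr_ge0 ?sqr_ge0// addr_ge0.
have errZ a b n r : `|Ex P (procZ a b n) -
    Ex P (fun w => lin s eps nu (coefV a) r n w * lin s eps nu (coefV b) r n w)| <=
    c * (1 + KG) * sg ^+ r.
  have i1 := dom_L1 k0 mG G0 iG EG (ap_meas (aZ a b) n) (ap_dom (aZ a b) n).
  have i2 := dom_L1 k0 mG G0 iG EG (apr_meas hp r n (aZ a b)) (ap_domr (aZ a b) r n).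
  have cr0 : 0 <= c * sg ^+ r by rewrite mulr_ge0// exprn_ge0// ltW.
  rewrite -(ExB i1 i2) mulrAC.
  exact (dom_Ex k0 mG G0 iG EG cr0 (L1_meas (L1B i1 i2)) (ap_err (aZ a b) r n)).
have stZ a b n : Ex P (procZ a b n) = Ex P (procZ a b 0).
  apply: (@geo_unique _ _ _ (c * (1 + KG)) sg
    (fun r => Ex P (fun w => lin s eps nu (coefV a) r 0 w * lin s eps nu (coefV b) r 0 w))) => // r.
  have := Ex_lin2_shift hs meps stat nu (coefV a) (coefV b) r 0 n; rewrite add0r => <-.
  exact: errZ.
have LZ a b n : L1 P (procZ a b n).
  exact (dom_L1 k0 mG G0 iG EG (ap_meas (aZ a b) n) (ap_dom (aZ a b) n)).
have LZZ a b e f n m : L1 P (fun w => procZ a b n w * procZ e f m w).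
  exact (prod_L1 k0 mG G0 iG EG (aZ a b) (aZ e f) n m).
have stZZ a b e f n m k : Ex P (fun w => procZ a b (n + k) w * procZ e f (m + k) w) =
    Ex P (fun w => procZ a b n w * procZ e f m w).
  apply: (@geo_unique _ _ _ (2 * c ^+ 2 * (1 + KG)) sg
    (fun r => Ex P (fun w =>
      (lin s eps nu (coefV a) r n w * lin s eps nu (coefV b) r n w) *
      (lin s eps nu (coefV e) r m w * lin s eps nu (coefV f) r m w)))) => // r.
    rewrite -(Ex_lin4_shift hs meps stat nu _ _ _ _ r n m k).
    have iB := prodr_L1 hp k0 mG G0 iG EG (aZ a b) (aZ e f) r (n + k) (m + k).
    rewrite -ExB//; apply: le_trans (Ex_norm (L1B (LZZ _ _ _ _ _ _) iB)) _.
    rewrite mulrAC.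
    exact: (prod_err hp k0 mG G0 iG EG sg0 c0 (aZ a b) (aZ e f) r (n + k) (m + k)).
  have iB := prodr_L1 hp k0 mG G0 iG EG (aZ a b) (aZ e f) r n m.
  rewrite -ExB//; apply: le_trans (Ex_norm (L1B (LZZ _ _ _ _ _ _) iB)) _.
  rewrite mulrAC.
  exact: (prod_err hp k0 mG G0 iG EG sg0 c0 (aZ a b) (aZ e f) r n m).
exists B, sg, g; split => //.
- by rewrite /B; have := A0; lra.
- by move=> h; apply: cbound_ge0 => //; exact: (KG_ge0 EG).
- by move=> N; apply: le_trans (gs N) _; rewrite /B; lra.
- move=> a b N D'.
  have := variance_approx hp hf al0 al1 hm k0 hA mG G0 iG EG sg0 sg1 N c0 (aZ a b).
  have -> : \sum_(n < N) Ex P (procZ a b n%:Z) = N%:R * Ex P (procZ a b 0).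
    by rewrite (eq_bigr (fun=> Ex P (procZ a b 0)))// sumr_const card_ord mulr_natl.
  move=> [i E]; split=> //; apply: le_trans E _; rewrite ler_wpM2l//.
  by rewrite /B -/cs; lra.
- move=> a b e f h.
  have := cov_approx hp hf al0 al1 hm k0 mG G0 iG EG sg0 0 h c0 (aZ a b) (aZ e f).
  by rewrite add0r.
- move=> a b e f M h r N x M0 x0 hx D'.
  have [|i E] := avg_prod hp hf pm fa al0 al1 hm k0 hA mG G0 iG EG sg0 sg1 c0 M0 x0
    (aZ a b) (aZ e f) (h := h) (r := r) (N := N).
    apply: le_trans hx; rewrite ler_wpM2l//.
    have hA' : (h + r)%:R + A <= (h + r)%:R + B by rewrite lerD2l /B; lra.
    have hB : 8 <= B by rewrite /B; lra.
    have hr0 : 0 <= (h + r)%:R + A by rewrite addr_ge0.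
    have M4 : 0 <= M ^+ 4 by rewrite exprn_ge0// ltW.
    have -> : 2 * (4 * M ^+ 4 * ((h + r)%:R + A)) = 8 * ((h + r)%:R + A) * M ^+ 4 by ring.
    have -> : B * M ^+ 4 * ((h + r)%:R + B) = B * ((h + r)%:R + B) * M ^+ 4 by ring.
    by apply: ler_wpM2r => //; apply: ler_pM.
  have eS : \sum_(j < N) Ex P (fun w => procZ a b (j%:Z + h%:Z) w * procZ e f j%:Z w) =
      N%:R * Ex P (fun w => procZ a b h%:Z w * procZ e f 0 w).
    rewrite (eq_bigr (fun=> Ex P (fun w => procZ a b h%:Z w * procZ e f 0 w))).
      by rewrite sumr_const card_ord mulr_natl.
    by move=> j _; rewrite -(stZZ a b e f h%:Z 0 j%:Z) add0r addrC.
  rewrite eS in i E; split; first exact: i.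
  apply: le_trans E _; rewrite lerD2l ler_wpM2l// [leLHS]mulrDr [leRHS]mulrDr; apply: lerD.
    have -> : 2 * (2 * c ^+ 2 * sg ^+ r * (1 + KG)) = (4 * c ^+ 2 * (1 + KG)) * sg ^+ r by ring.
    by rewrite ler_wpM2r ?exprn_ge0 ?(ltW sg0)//; rewrite /B; lra.
  have -> : 2 * (4 * (M `^ (- kappa) * (c `^ (2 + kappa) * KG))) = 8 * q' * M `^ (- kappa).
    by rewrite /q'; ring.
  by rewrite ler_wpM2r ?powR_ge0//; rewrite /B; lra.
- move=> a b n.
  have [iGG EGG] := G_GG k0 mG G0 iG EG n n.
  apply: le_trans (_ : Ex P (fun w => c ^+ 2 * (G n w * G n w)) <= _).
    apply: Ex_le_ae => //; first exact: L1Z.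
    apply: filterS (ap_dom (aZ a b) n) => w hw.
    apply: le_trans (ler_norm _) _; rewrite normrM.
    have -> : c ^+ 2 * (G n w * G n w) = (c * G n w) * (c * G n w) by ring.
    by apply: ler_pM.
  rewrite ExZ//; apply: le_trans (_ : c ^+ 2 * (1 + KG) <= _).
    by rewrite ler_wpM2l ?sqr_ge0.
  by rewrite /B; lra.
Qed.

Lemma sum_mxvec (F : 'I_q -> R) : \sum_x F x = \sum_k \sum_j F (mxvec_index k j).
Proof.
rewrite (reindex _ (curry_mxvec_bij (p nu) d)) /=.
by rewrite pair_bigA /=; apply: eq_bigr => -[].
Qed.

(** A regressor involves only times before tm n, where [HH_future] applies. Centred scores have
    second moments equal to their covariances. *)
Lemma cross_mean0 i x n : Ex P (procZ (inl i) (inr x) n) = 0.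
Proof.
have [K2 hK2] := mt2.
case/mxvec_indexP: x => k j.
transitivity (HH P Y eps (tm n - k.+1%:Z) (tm n) j i).
  by apply: eq_Ex => w; rewrite /procZ procV_index mulrC.
apply: (HH_future hs meps mY hsum hcv hmean hvar huncorr (fun t => (hK2 t).1) (fun t => (hK2 t).2)).
by rewrite ltrBlDr ltrDl.
Qed.

Definition Smat : 'M[R]_q := \matrix_(x, y) Ex P (procZ (inr x) (inr y) 0).

(** A kernel vector v makes the combination f = v X_0 vanish in mean square, hence uncorrelated with
    every innovation. Testing f against the innovations of the regressor times, latest first, kills
    the blocks of v one by one. *)
Lemma Smat_unit : Smat \in unitmx.
Proof.
have [K2 hK2] := mt2; have hK21 t := (hK2 t).1; have hK22 t := (hK2 t).2.
have [B [sg [g mf]]] := model_factsP.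
have iYe t u a b : L1 P (fun w => Y t w a ord0 * eps u w b ord0).
  by have [] := HH_lim hs meps mY hsum hcv hK21 hK22 t u a b.
rewrite -row_free_unit; apply: inj_row_free => v vS.
pose f w := \sum_x v 0 x * procV (inr x) 0 w.
have f2 w : f w ^+ 2 = \sum_x \sum_y (v 0 x * v 0 y) * procZ (inr x) (inr y) 0 w.
  rewrite expr2 mulr_suml; apply: eq_bigr => x _; rewrite mulr_sumr.
  by apply: eq_bigr => y _; rewrite /procZ; ring.
have if2 : L1 P (fun w => f w ^+ 2).
  under eq_fun do rewrite f2.
  by apply: L1_sum => x _; apply: L1_sum => y _; apply: L1Z; exact: (mf_L1 mf).
have Ef2 : Ex P (fun w => f w ^+ 2) = 0.
  under eq_fun do rewrite f2.
  rewrite Ex_sum; last first.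
    by move=> x _; apply: L1_sum => y _; apply: L1Z; exact: (mf_L1 mf).
  rewrite (eq_bigr (fun x => \sum_y v 0 x * v 0 y * Smat x y)); last first.
    move=> x _; rewrite Ex_sum; last by move=> y _; apply: L1Z; exact: (mf_L1 mf).
    by apply: eq_bigr => y _; rewrite ExZ ?mxE//; exact: (mf_L1 mf).
  rewrite exchange_big /= big1// => y _.
  have := congr1 (fun M : 'rV_q => M 0 y) vS; rewrite !mxE => h.
  rewrite (eq_bigr (fun x => v 0 y * (v 0 x * Smat x y))) -?mulr_sumr ?h ?mulr0//.
  by move=> x _; ring.
have mf' : measurable_fun setT f.
  apply: measurable_sum => x; apply: measurable_funM => //.
  case/mxvec_indexP: x => k j.
  rewrite (_ : procV _ _ = fun w => Y (tm 0 - k.+1%:Z) w j ord0); first exact: mY.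
  by apply/funext => w; rewrite procV_index.
have fe u b : Ex P (fun w => f w * eps u w b ord0) = 0.
  have ie : L1 P (fun w => eps u w b ord0 ^+ 2).
    have := L1_eps2 meps hK21 u u b b.
    by under eq_fun do rewrite -expr2.
  have E0 : 0 <= Ex P (fun w => eps u w b ord0 ^+ 2).
    by apply: Ex_ge0 => w; exact: sqr_ge0.
  pose bb := 1 + Ex P (fun w => eps u w b ord0 ^+ 2).
  have b0 : 0 < bb by rewrite ltr_wpDr.
  apply/eqP; rewrite -normr_le0; apply/ler_addgt0Pr => /= x x0; rewrite add0r.
  have a0 : 0 < x / bb by rewrite divr_gt0.
  have [||i E] := Ex_CS a0 b0 mf' (meps u b ord0) if2 ie.
  - by rewrite Ef2 sqr_ge0.
  - apply: (@le_trans _ _ bb); first by rewrite /bb lerDr.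
    by rewrite expr2 ler_peMr ?(ltW b0)// /bb lerDl.
  apply: le_trans (Ex_norm i) _; apply: le_trans E _.
  by rewrite divfK// gt_eqF.
have fHH u b : \sum_k \sum_j v 0 (mxvec_index k j) * HH P Y eps (tm 0 - k.+1%:Z) u j b = 0.
  rewrite -[RHS](fe u b).
  have -> : (fun w => f w * eps u w b ord0) = (fun w =>
      \sum_k \sum_j v 0 (mxvec_index k j) * (Y (tm 0 - k.+1%:Z) w j ord0 * eps u w b ord0)).
    apply/funext => w; rewrite /f sum_mxvec mulr_suml; apply: eq_bigr => k _.
    by rewrite mulr_suml; apply: eq_bigr => j _; rewrite procV_index mulrA.
  rewrite Ex_sum; last by move=> k _; apply: L1_sum => j _; apply: L1Z.
  apply: eq_bigr => k _; rewrite Ex_sum; last by move=> j _; apply: L1Z.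
  by apply: eq_bigr => j _; rewrite ExZ.
(* At u = tm 0 - (k + 1), blocks before k vanish by induction and blocks after k are older than u,
   so only v_k times the variance at u is left, and that variance is invertible. *)
have key m : forall k : 'I_(p nu), (k < m)%N -> forall j, v 0 (mxvec_index k j) = 0.
  elim: m => // m IH k; rewrite ltnS leq_eqVlt => /predU1P[km|]; last exact: IH.
  pose u := tm 0 - k.+1%:Z.
  have fut t a b : t < u -> HH P Y eps t u a b = 0.
    exact: (HH_future hs meps mY hsum hcv hmean hvar huncorr hK21 hK22).
  have huu a b : HH P Y eps u u a b = Sg s Sigma u a b.
    rewrite (HH_rec hs meps mY hrec hsum hcv hmean hvar huncorr hK21 hK22) eqxx.
    rewrite big_nat big1 ?add0r// => l /andP[l1 _]; rewrite big1// => i _.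
    by rewrite fut ?mulr0// ltrBlDr ltrDl.
  pose vk : 'rV[R]_d := \row_j v 0 (mxvec_index k j).
  have : vk *m Sg s Sigma u = 0.
    apply/rowP => b; rewrite !mxE -[RHS](fHH u b).
    rewrite [RHS](bigD1 k)//= [X in _ = _ + X]big1 ?addr0.
      by apply: eq_bigr => j _; rewrite mxE huu.
    move=> k' k'k; rewrite big1// => j _.
    have [lt|ge] := ltnP k' m; first by rewrite IH ?mul0r.
    rewrite fut ?mulr0// /u ltrD2l ltrN2 ltz_nat ltnS.
    by rewrite ltn_neqAle eq_sym (inj_eq val_inj) k'k km.
  have uS : Sg s Sigma u \in unitmx by apply: hunit; exact: sea_bound.
  move/(congr1 (mulmx^~ (invmx (Sg s Sigma u)))); rewrite mulmxK// mul0mx => vk0 j.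
  by have := congr1 (fun M : 'rV_d => M 0 j) vk0; rewrite !mxE.
apply/rowP => x; case/mxvec_indexP: x => k j.
by rewrite mxE; exact: key (ltn_ord k) j.
Qed.

Definition Bmat : 'M[R]_(d, q) := \matrix_(i, x) 
  Phi (enum_val (cast_ord (esym (mxvec_cast (p nu) d)) x)).1.+1 nu i
      (enum_val (cast_ord (esym (mxvec_cast (p nu) d)) x)).2.

Lemma Bmat_rec n : {ae P, forall w,
  Y (tm n) w = Bmat *m Xreg s p Y nu n w + eps (tm n) w}.
Proof.
apply: filterS (hrec n hnu) => w ->; congr (_ + _).
apply/colP => i; rewrite summxE mxE sum_mxvec big_add1 /= big_mkord.
apply: eq_bigr => k _; rewrite mxE; apply: eq_bigr => j _.
rewrite !mxE mxvecE !mxE; congr (_ * _).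
by rewrite /mxvec_index cast_ordK enum_rankK.
Qed.

End Model.

(** * Perturbation of invertible matrices *)

Section MatrixBounds.
Context {R : realType}.

Lemma mx_norm_leP m n (A : 'M[R]_(m, n)) c : 0 <= c ->
  (forall i j, `|A i j| <= c) -> `|A| <= c.
Proof.
move=> c0 h; rewrite [leLHS]mx_normrE; apply/bigmax_leP; split=> // -[i j] _.
Qed.

(** The matrix norm is the largest absolute entry, which is submultiplicative only up to the inner
    dimension. *)
Lemma mulmx_norm m n k (A : 'M[R]_(m, n)) (B : 'M[R]_(n, k)) :
  `|A *m B| <= n%:R * (`|A| * `|B|).
Proof.
apply: mx_norm_leP => [|i j]; first by rewrite !mulr_ge0.
rewrite mxE; apply: le_trans (ler_norm_sum _ _ _) _.
apply: (@le_trans _ _ (\sum_(l < n) `|A| * `|B|)).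
  by apply: ler_sum => l _; rewrite normrM; apply: ler_pM => //; exact: mx_entry_le.
by rewrite sumr_const card_ord mulr_natl.
Qed.

(** A row vector v with v A = 0 satisfies v = v (1 - A), so its norm is at most half of itself; the
    same splitting of the inverse bounds its norm. *)
Lemma near_id_unit n (A : 'M[R]_n) : n%:R * `|1%:M - A| <= 2^-1 ->
  A \in unitmx /\ `|invmx A| <= 2 * `|1%:M : 'M[R]_n|.
Proof.
move=> hA.
have uA : A \in unitmx.
  rewrite -row_free_unit; apply: inj_row_free => v vA.
  have e : v = v *m (1%:M - A) by rewrite mulmxBr mulmx1 vA subr0.
  apply/eqP; rewrite -normr_le0.
  have h : `|v| <= 2^-1 * `|v|.
    rewrite {1}e; apply: le_trans (mulmx_norm _ _) _.
    by rewrite mulrCA mulrC ler_wpM2r.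
  lra.
split=> //.
have e : invmx A = 1%:M + (1%:M - A) *m invmx A.
  by rewrite mulmxBl mul1mx mulmxV// addrC subrK.
have h : `|invmx A| <= `|1%:M : 'M[R]_n| + 2^-1 * `|invmx A|.
  rewrite {1}e; apply: le_trans (ler_normD _ _) _; rewrite lerD2l.
  by apply: le_trans (mulmx_norm _ _) _; rewrite mulrA ler_wpM2r.
lra.
Qed.

Lemma near_unit n (S : 'M[R]_n) : S \in unitmx -> exists eta C : R,
  [/\ 0 < eta, 0 <= C & forall S', `|S' - S| <= eta ->
    S' \in unitmx /\ `|invmx S'| <= C].
Proof.
move=> uS; set I1 := `|1%:M : 'M[R]_n|; set V := `|invmx S|.
pose k := 1 + n%:R * (n%:R * V).
have V0 : 0 <= V by exact: normr_ge0.
have k0 : 0 < k by rewrite /k ltr_wpDr ?ltr01// mulr_ge0// mulr_ge0.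
exists (2^-1 / k), (n%:R * (2 * I1 * V)); split.
- by rewrite divr_gt0// invr_gt0.
- by rewrite mulr_ge0// mulr_ge0// mulr_ge0// normr_ge0.
move=> S' hS'.
have e : 1%:M - invmx S *m S' = invmx S *m (S - S').
  by rewrite mulmxBr mulVmx.
have [|uA hA] := @near_id_unit _ (invmx S *m S').
  rewrite e; apply: le_trans (_ : n%:R * (n%:R * (V * (2^-1 / k))) <= _).
    rewrite ler_wpM2l//; apply: le_trans (mulmx_norm _ _) _.
    by rewrite !ler_wpM2l// distrC.
  have -> : n%:R * (n%:R * (V * (2^-1 / k))) = (n%:R * (n%:R * V)) / k * 2^-1.
    by field; rewrite gt_eqF.
  rewrite ler_piMl ?invr_ge0// ler_pdivrMr// mul1r /k lerDr//.
have eS : S' = S *m (invmx S *m S') by rewrite mulmxA mulmxV// mul1mx.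
have uS' : S' \in unitmx by rewrite eS unitmx_mul uS.
split=> //.
have -> : invmx S' = invmx (invmx S *m S') *m invmx S.
  apply: (can_inj (mulKmx uS')); rewrite mulmxV// mulmxA.
  rewrite {1}eS -[S *m _ *m _]mulmxA mulmxV// mulmx1 mulmxV//.
by apply: le_trans (mulmx_norm _ _) _; rewrite ler_wpM2l// ler_wpM2r.
Qed.

End MatrixBounds.

(** * Measurability of matrix-valued functions *)

Section MeasurableMatrix.
Context {R : realType} {dT : measure_display} {T : measurableType dT}.

Definition mxmeas m n (A : T -> 'M[R]_(m, n)) :=
  forall i j, measurable_fun setT (fun w => A w i j).

Lemma mxmeas_cst m n (A : 'M[R]_(m, n)) : mxmeas (fun=> A).
Proof. by move=> i j. Qed.

Lemma mxmeasD m n (A B : T -> 'M[R]_(m, n)) : mxmeas A -> mxmeas B ->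
  mxmeas (fun w => A w + B w).
Proof.
by move=> hA hB i j; under eq_fun do rewrite mxE; exact: measurable_funD.
Qed.

Lemma mxmeasN m n (A : T -> 'M[R]_(m, n)) : mxmeas A -> mxmeas (fun w => - A w).
Proof.
by move=> hA i j; under eq_fun do rewrite mxE; exact: measurableT_comp.
Qed.

Lemma mxmeasZ m n c (A : T -> 'M[R]_(m, n)) : mxmeas A -> mxmeas (fun w => c *: A w).
Proof.
by move=> hA i j; under eq_fun do rewrite mxE; exact: measurable_funM.
Qed.

Lemma mxmeas_tr m n (A : T -> 'M[R]_(m, n)) : mxmeas A -> mxmeas (fun w => (A w)^T).
Proof. by move=> hA i j; under eq_fun do rewrite mxE; exact: hA. Qed.

Lemma mxmeasM m n k (A : T -> 'M[R]_(m, n)) (B : T -> 'M[R]_(n, k)) :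
  mxmeas A -> mxmeas B -> mxmeas (fun w => A w *m B w).
Proof.
move=> hA hB i j; under eq_fun do rewrite mxE.
by apply: measurable_sum => l; exact: measurable_funM.
Qed.

Lemma mxmeas_sum I (r : seq I) m n (A : I -> T -> 'M[R]_(m, n)) :
  (forall i, mxmeas (A i)) -> mxmeas (fun w => \sum_(i <- r) A i w).
Proof.
move=> hA i j; under eq_fun do rewrite summxE.
by apply: measurable_sum => l; exact: hA.
Qed.

Lemma measurable_det n (A : T -> 'M[R]_n) : mxmeas A ->
  measurable_fun setT (fun w => \det (A w)).
Proof.
move=> hA; apply: measurable_sum => s; apply: measurable_funM => //.
by apply: measurable_prod => i _; exact: hA.
Qed.

(** The identity 1 / f = f (f^2)^(-1) brings in [powR], measurable in its base; at f = 0 both sides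
    are 0 by convention. *)
Lemma measurable_inv (f : T -> R) : measurable_fun setT f ->
  measurable_fun setT (fun w => (f w)^-1).
Proof.
move=> mf; rewrite (_ : (fun w => _) = (fun w => f w * (f w ^+ 2) `^ (-1))).
  apply: measurable_funM => //.
  apply: (@measurableT_comp _ _ _ _ _ _ (@powR R ^~ (-1))) => //.
  exact: measurable_funX.
apply/funext => w; rewrite powR_inv1 ?sqr_ge0//.
have [->|f0] := eqVneq (f w) 0; first by rewrite invr0 mul0r.
by field.
Qed.

Lemma measurable_gt (f : T -> R) e : measurable_fun setT f ->
  measurable [set w | e < f w].
Proof.
move=> mf; rewrite (_ : [set w | _] = setT `&` f @^-1` `]e, +oo[).
  exact: (mf measurableT).
by rewrite setTI; apply/seteqP; split=> w /=; rewrite in_itv/= andbT.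
Qed.

(** Cramer's formula off the zero set of the determinant; on it [invmx] returns the matrix
    itself. *)
Lemma mxmeas_inv n (A : T -> 'M[R]_n) : mxmeas A -> mxmeas (fun w => invmx (A w)).
Proof.
move=> hA i j.
rewrite (_ : (fun w => _) = (fun w => if \det (A w) == 0 then A w i j
    else (\det (A w))^-1 * cofactor (A w) j i)); last first.
  apply/funext => w; rewrite /invmx unitmxE unitfE; case: eqP => //= _.
  by rewrite !mxE.
apply: measurable_fun_ifT => //.
- apply: measurable_fun_eqr => //; exact: measurable_det.
- apply: measurable_funM.
    by apply: measurable_inv; exact: measurable_det.
  apply: measurable_funM => //; apply: measurable_det => k l.
  by under eq_fun do rewrite !mxE; exact: hA.
Qed.

Lemma measurable_norm_gt m n (A : T -> 'M[R]_(m, n)) (e : R) : mxmeas A -> 0 <= e ->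
  measurable [set w | e < `|A w|].
Proof.
move=> hA e0.
rewrite (_ : [set w | _] = \bigcup_(ij in [set: 'I_m * 'I_n])
    [set w | e < `|A w ij.1 ij.2|]).
  apply: fin_bigcup_measurable => // -[i j] _.
  by apply: measurable_gt; exact: measurableT_comp.
apply/seteqP; split=> w /=.
  move=> h; apply: contrapT => hn; move: h; apply/negP; rewrite -leNgt.
  apply: mx_norm_leP => // i j; rewrite leNgt; apply/negP => h.
  by apply: hn; exists (i, j).
move=> [[i j] _ h]; exact: lt_le_trans h (mx_entry_le _ _ _).
Qed.

End MeasurableMatrix.

(** * Limits of series with a growing range *)

Section Limits.
Context {R : realType}.

Lemma sum_sym (V : nmodType) (F : int -> V) H :
  \sum_(i < (2 * H).+1) F (i%:Z - H%:Z) =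
  F 0 + \sum_(h < H) (F h.+1%:Z + F (- h.+1%:Z)).
Proof.
elim: H => [|H IH]; first by rewrite big_ord1 big_ord0 subrr addr0.
have -> : (2 * H.+1).+1 = (2 * H).+3 by lia.
rewrite big_ord_recl big_ord_recr /= [in RHS]big_ord_recr /=.
rewrite (eq_bigr (fun i : 'I_(2 * H).+1 => F (i%:Z - H%:Z))); last first.
  by move=> i _; congr F; rewrite /bump /=; lia.
rewrite IH addrC -!addrA; congr (_ + (_ + _)).
by congr (F _ + F _); rewrite /bump /=; lia.
Qed.

(** Cut at an H beyond which the tails of the majorant and of the limit series are below e / 3: the
    head converges termwise, and the rest of the sum up to T N is under the tail of the majorant. *)
Lemma tannery (x : nat -> nat -> R) (y G : nat -> R) (T : nat -> nat) C :
  (forall N h, `|x N h| <= G h) -> (forall N, \sum_(h < N) G h <= C) ->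
  (forall h, (fun N => x N h) @ \oo --> y h) ->
  (forall H : nat, \forall N \near \oo, (H <= T N)%N) ->
  exists2 l : R, series y @ \oo --> l & (fun N => \sum_(h < T N) x N h) @ \oo --> l.
Proof.
move=> xG GC xy TH.
have G0 h : 0 <= G h by exact: le_trans (normr_ge0 _) (xG 0%N h).
have cG : cvgn (series G).
  apply: nondecreasing_is_cvgn.
    by apply: nondecreasing_series => k _ _.
  by exists C => _ [n _ <-]; rewrite /series /= big_mkord.
have yG h : `|y h| <= G h.
  have cv : (fun N => `|x N h|) @ \oo --> `|y h| by exact: cvg_norm.
  rewrite -(cvg_lim _ cv)//; apply: limr_le; first exact: (cvgP _ cv).
  exact: nearW.
have cy : cvgn (series y).
  by apply: normed_cvg; apply: (@series_le_cvg _ (fun n => `|y n|) G) => // n.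
exists (limn (series y)); first exact: cy.
apply/cvgrPdist_le => e e0.
have e3 : 0 < e / 3 by rewrite divr_gt0.
have tail : \forall H \near \oo, `|limn (series G) - series G H| <= e / 3.
  by move/cvgrPdist_le : (cG) => /(_ _ e3).
have taily : \forall H \near \oo, `|limn (series y) - series y H| <= e / 3.
  by move/cvgrPdist_le : (cy) => /(_ _ e3).
have [H [hH hy]] : exists H, `|limn (series G) - series G H| <= e / 3 /\
    `|limn (series y) - series y H| <= e / 3.
  case: tail => H1 _ h1; case: taily => H2 _ h2; exists (H1 + H2)%N.
  by split; [apply: h1 => /=; exact: leq_addr|apply: h2 => /=; exact: leq_addl].
have fin : (fun N => \sum_(h < H) x N h) @ \oo --> \sum_(h < H) y h.
  elim: (H) => [|H' IH]; first by under eq_fun do rewrite big_ord0; rewrite big_ord0; exact: cvg_cst.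
  under eq_fun do rewrite big_ord_recr /=; rewrite big_ord_recr /=.
  by apply: cvgD => //; exact: xy.
near=> N.
have TN : (H <= T N)%N by near: N; exact: TH.
have hf : `|\sum_(h < H) y h - \sum_(h < H) x N h| <= e / 3.
  by near: N; move/cvgrPdist_le : fin => /(_ _ e3).
have ht : `|\sum_(h < T N) x N h - \sum_(h < H) x N h| <= e / 3.
  rewrite -(subnKC TN) big_split_ord /= [X in X - _]addrC addrK.
  apply: le_trans hH; apply: le_trans (ler_norm_sum _ _ _) _.
  apply: le_trans (ler_norm _).
  apply: (@le_trans _ _ (series G (T N) - series G H)).
    have -> : series G (T N) = series G H + \sum_(i < T N - H) G (H + i)%N.
      by rewrite /series /= !big_mkord -[in LHS](subnKC TN) big_split_ord.
    by rewrite [X in X - _]addrC addrK; exact: ler_sum.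
  rewrite lerD2r; apply: nondecreasing_cvgn_le cG _.
  by apply: nondecreasing_series => k _ _.
have -> : limn (series y) - \sum_(h < T N) x N h =
  (limn (series y) - series y H) + ((\sum_(h < H) y h - \sum_(h < H) x N h) -
   (\sum_(h < T N) x N h - \sum_(h < H) x N h)).
  by rewrite /series /= big_mkord; ring.
have -> : e = e / 3 + (e / 3 + e / 3) by field.
apply: le_trans (ler_normD _ _) _; apply: lerD => //.
by apply: le_trans (ler_normB _ _) _; exact: lerD.
Unshelve. all: by end_near. Qed.

Lemma mul_exp_le (t : R) n : 0 <= t -> t < 1 -> n%:R * t ^+ n <= (1 - t)^-1.
Proof.
move=> t0 t1; apply: le_trans (sum_geo_le n t0 t1).
have -> : n%:R * t ^+ n = \sum_(i < n) t ^+ n by rewrite sumr_const card_ord mulr_natl.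
apply: ler_sum => i _.
by apply: ler_wiXn2l; rewrite ?(ltW t1)// ltnW.
Qed.

(** With s = t^2, the product n t^n stays bounded and the remaining factor t^n tends to 0. *)
Lemma mul_exp_to0 (s : R) : 0 < s -> s < 1 ->
  (fun n => n.+1%:R * s ^+ n) @ \oo --> 0.
Proof.
move=> s0 s1; pose t := Num.sqrt s.
have t0 : 0 < t by rewrite sqrtr_gt0.
have t1 : t < 1 by rewrite -sqrtr1 ltr_sqrt.
have ts n : s ^+ n = t ^+ n * t ^+ n by rewrite -exprMn -expr2 sqr_sqrtr// ltW.
have ub n : n.+1%:R * s ^+ n <= ((1 - t)^-1 + 1) * t ^+ n.
  rewrite ts mulrA ler_wpM2r ?exprn_ge0 ?(ltW t0)// -natr1 mulrDl mul1r.
  by apply: lerD; [apply: mul_exp_le => //; exact: ltW|rewrite exprn_ile1// ltW].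
apply: (@squeeze_cvgr _ _ _ _ (cst 0) (fun n => ((1 - t)^-1 + 1) * t ^+ n)).
- by apply: nearW => n; rewrite ub mulr_ge0// exprn_ge0// ltW.
- exact: cvg_cst.
- rewrite -[X in _ --> X](mulr0 ((1 - t)^-1 + 1)).
  by apply: cvgMr; apply: cvg_expr; rewrite gtr0_norm.
Qed.

End Limits.

Lemma sum_shift_add {R : realType} (x y : nat -> R) A K :
  \sum_(h < K) (A + x h + (A + y h)) =
  K%:R * (A + A) + (\sum_(h < K) x h + \sum_(h < K) y h).
Proof.
elim: K => [|K IH]; first by rewrite !big_ord0 mul0r !addr0.
by rewrite !big_ord_recr /= IH -natr1; ring.
Qed.

(** * Algebra of residuals and of the HAC sum for one outcome *)

Section Residuals.
Context {R : realType} {dT : measure_display} {T : measurableType dT}.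
Variables (P : probability T R) (d s : nat).
Variables (p : nat -> nat) (Phi : nat -> nat -> 'M[R]_d).
Variables (Y eps : int -> T -> 'cV[R]_d) (nu : nat).

Local Notation tm n := (n * s%:Z + nu%:Z).
Local Notation q := (p nu * d)%N.
Local Notation V := (@procV R dT T d s p Y eps nu).
Local Notation Z := (@procZ R dT T d s p Y eps nu).

(** [vecc] stacks columns, so the regressor index is the outer one and comes first. *)
Definition Widx (I : 'I_d * 'I_q) : 'I_(q * d) := mxvec_index I.2 I.1.

Definition score (I : 'I_d * 'I_q) := Z (inl I.1) (inr I.2).

Definition score_avg N w : 'M[R]_(d, q) :=
  \matrix_(i, x) (N%:R^-1 * \sum_(n < N) Z (inl i) (inr x) n%:Z w).

Definition gram_avg N w : 'M[R]_q :=
  \matrix_(x, y) (N%:R^-1 * \sum_(n < N) Z (inr x) (inr y) n%:Z w).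

(** The squared norm of the vector of innovation and regressors; it dominates every [procZ] at time
    n. *)
Definition sqV n w := \sum_a Z a a n w.

Definition sqV_avg N w := N%:R^-1 * \sum_(n < N) sqV n%:Z w ^+ 2.

Definition acov_avg I J N h w : R :=
  N%:R^-1 * \sum_(j < N - h) score I (j%:Z + h%:Z) w * score J j%:Z w.

Definition acov I J (h : nat) : R := Ex P (fun w => score I h%:Z w * score J 0 w).

(** The sample autocovariance divides N - h terms by N, and this is the factor it puts on its
    expectation. *)
Definition acov_wt N h : R := (N - h)%N%:R / N%:R.

Definition acov_err H N w : R := \sum_I \sum_J \sum_(h < H.+1)
  `|acov_avg I J N h w - acov_wt N h * acov I J h|.

Lemma V_sqr_le a n w : V a n w ^+ 2 <= sqV n w.
Proof.
rewrite /sqV (bigD1 a)//= expr2 lerDl; apply: sumr_ge0 => c _.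
by rewrite /procZ -expr2 sqr_ge0.
Qed.

Lemma Z_le_sqV a c n w : `|Z a c n w| <= sqV n w.
Proof.
have h1 := V_sqr_le a n w; have h2 := V_sqr_le c n w.
rewrite /procZ normrM.
have := sqr_ge0 (`|V a n w| - `|V c n w|); rewrite sqrrB !real_normK ?num_real// => h3.
by lra.
Qed.

Lemma sqV_ge0 n w : 0 <= sqV n w.
Proof. by apply: sumr_ge0 => a _; rewrite /procZ -expr2 sqr_ge0. Qed.

Lemma sqV_avg_ge0 N w : 0 <= sqV_avg N w.
Proof. by rewrite mulr_ge0 ?invr_ge0//; apply: sumr_ge0 => n _; exact: sqr_ge0. Qed.

Lemma XmatE N w : Xmat s p Y nu N w *m (Xmat s p Y nu N w)^T = N%:R *: gram_avg N w.
Proof.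
apply/matrixP => x y; rewrite !mxE; case: N => [|N]; first by rewrite big_ord0 mul0r.
by rewrite mulVKf ?pnatr_eq0//; apply: eq_bigr => n _; rewrite /procZ /= !mxE.
Qed.

Section Fixed.
Variables (N : nat) (w : T).
Hypothesis N0 : (0 < N)%N.
Hypothesis rel : forall n, (n < N)%N ->
  Y (tm n%:Z) w = Bmat p Phi nu *m Xreg s p Y nu n%:Z w + eps (tm n%:Z) w.

Local Notation delta := (Bhat s p Y nu N w - Bmat p Phi nu).

Lemma Bhat_err : gram_avg N w \in unitmx ->
  delta = score_avg N w *m invmx (gram_avg N w).
Proof.
move=> uS; have NR : N%:R != 0 :> R by rewrite pnatr_eq0 -lt0n.
have uN : N%:R *: gram_avg N w \in unitmx by rewrite unitmxZ// unitfE.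
rewrite /Bhat XmatE invmxZ//.
have -> : Zmat s Y nu N w *m (Xmat s p Y nu N w)^T =
    N%:R *: (Bmat p Phi nu *m gram_avg N w + score_avg N w).
  have -> : Zmat s Y nu N w = Bmat p Phi nu *m Xmat s p Y nu N w +
      \matrix_(i < d, n < N) eps (tm n%:Z) w i ord0.
    apply/matrixP => i n; rewrite !mxE (rel (ltn_ord n)) !mxE; congr (_ + _).
    by apply: eq_bigr => x _; rewrite [Xmat _ _ _ _ _ _ _ _]mxE.
  rewrite mulmxDl scalerDr -mulmxA XmatE scalemxAr; congr (_ + _).
  apply/matrixP => i x; rewrite !mxE mulVKf//; apply: eq_bigr => n _.
  by rewrite /procZ /= !mxE.
by rewrite -scalemxAr -scalemxAl scalerA mulVf// scale1r mulmxDl mulmxK// addrC addKr.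
Qed.

Lemma WhatE I n : (n < N)%N -> What s p Y nu N n%:Z w (Widx I) ord0 =
  score I n%:Z w - \sum_y delta I.1 y * Z (inr y) (inr I.2) n%:Z w.
Proof.
move=> nN.
have E : ehat s p Y nu N n%:Z w = eps (tm n%:Z) w - delta *m Xreg s p Y nu n%:Z w.
  by rewrite /ehat (rel nN) mulmxBl opprB addrCA addrA.
rewrite /What E /vecc mxE mxvecE mxE mxE big_ord1.
rewrite [X in X * _]mxE [X in (_ + X) * _]mxE [X in (_ - X) * _]mxE [X in _ * X]mxE.
rewrite mulrBl mulr_suml; congr (_ - _); apply: eq_bigr => y _.
by rewrite /procZ /= mulrA.
Qed.

Lemma What_err D I n : (n < N)%N -> `|delta| <= D ->
  `|What s p Y nu N n%:Z w (Widx I) ord0 - score I n%:Z w| <= q%:R * D * sqV n%:Z w.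
Proof.
move=> nN hD; rewrite WhatE// addrAC subrr sub0r normrN.
apply: le_trans (ler_norm_sum _ _ _) _.
have -> : q%:R * D * sqV n%:Z w = \sum_(y < q) D * sqV n%:Z w.
  by rewrite sumr_const card_ord mulr_natl -mulrnAl.
apply: ler_sum => y _; rewrite normrM; apply: ler_pM => //.
  exact: le_trans (mx_entry_le _ _ _) hD.
exact: Z_le_sqV.
Qed.

(** Each replaced score costs q D [sqV]; the quadratic term in D is absorbed by D <= 1, which gives
    2 + q. Products at two times are bounded by half the sum of squares, and both sums of squares
    are parts of the full sum over N. *)
Lemma Lambdahat_nat_err D I J h : `|delta| <= D -> D <= 1 ->
  `|Lambdahat_nat s p Y nu N h w (Widx I) (Widx J) - acov_avg I J N h w| <=
  q%:R * (2 + q%:R) * D * sqV_avg N w.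
Proof.
move=> hD D1; have D0 : 0 <= D by exact: le_trans hD.
rewrite /Lambdahat_nat mxE summxE /acov_avg -mulrBr normrM ger0_norm ?invr_ge0//.
rewrite /sqV_avg [leRHS]mulrCA ler_wpM2l ?invr_ge0//.
have [hN|hN] := leqP N h.
  rewrite big_geq// (eqP (_ : (N - h)%N == 0%N)) ?subn_eq0// big_ord0 subrr normr0.
  by rewrite !mulr_ge0//; apply: sumr_ge0 => n _; exact: sqr_ge0.
rewrite -{1}[h]add0n big_addn big_mkord -sumrB.
set c := q%:R * (2 + q%:R) * D.
have c0 : 0 <= c by rewrite !mulr_ge0.
apply: le_trans (_ : \sum_(j < N - h) c * ((sqV (j + h)%N%:Z w ^+ 2 + sqV j%:Z w ^+ 2) / 2) <= _).
  apply: le_trans (ler_norm_sum _ _ _) _; apply: ler_sum => j _.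
  have jh : (j + h < N)%N by have := ltn_ord j; lia.
  rewrite mxE big_ord1 [X in _ * X - _]mxE addnK -PoszD.
  have e1 := What_err I jh hD; have e2 := What_err J (leq_ltn_trans (leq_addr _ _) jh) hD.
  move: e1 e2; set A := What _ _ _ _ _ _ _ _ _; set A' := What _ _ _ _ _ _ _ _ _.
  have s1 : `|score I (j + h)%N%:Z w| <= sqV (j + h)%N%:Z w := Z_le_sqV _ _ _ _.
  have s2 : `|score J j%:Z w| <= sqV j%:Z w := Z_le_sqV _ _ _ _.
  move: s1 s2 (sqV_ge0 (j + h)%N%:Z w) (sqV_ge0 j%:Z w).
  set x := score I _ _; set y := score J _ _; set u := sqV _ _; set v := sqV _ _.
  move=> s1 s2 u0 v0 e1 e2.
  have qD0 : 0 <= q%:R * D by rewrite mulr_ge0.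
  have -> : A * A' - x * y = (A - x) * (A' - y) + (x * (A' - y) + (A - x) * y) by ring.
  apply: le_trans (_ : (q%:R * D * u) * (q%:R * D * v) +
      (u * (q%:R * D * v) + (q%:R * D * u) * v) <= _).
    apply: le_trans (ler_normD _ _) _; apply: lerD.
      by rewrite normrM; apply: ler_pM.
    apply: le_trans (ler_normD _ _) _; apply: lerD.
      by rewrite normrM; apply: ler_pM.
    by rewrite normrM; apply: ler_pM.
  have -> : (q%:R * D * u) * (q%:R * D * v) + (u * (q%:R * D * v) + (q%:R * D * u) * v) =
    q%:R * (2 + q%:R * D) * D * (u * v) by ring.
  apply: ler_pM; rewrite ?mulr_ge0 ?addr_ge0//.
    by rewrite /c ler_wpM2r// ler_wpM2l// lerD2l ler_piMr.
  by have := sqr_ge0 (u - v); rewrite sqrrB; lra.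
rewrite -mulr_sumr ler_wpM2l// -mulr_suml big_split /= ler_pdivrMr// mulr_natr mulr2n.
have sub (F : nat -> R) k : (forall n, 0 <= F n) -> (k <= N)%N ->
    \sum_(j < N - k) F (j + k)%N <= \sum_(n < N) F n.
  move=> F0 kN; rewrite -(big_mkord xpredT (fun j => F (j + k)%N)) -(big_mkord xpredT F).
  have -> : \sum_(0 <= i < N - k) F (i + k)%N = \sum_(k <= i < N) F i.
    by rewrite -[in RHS](add0n k) big_addn.
  rewrite (@big_cat_nat _ _ _ k 0 N)//= lerDr.
  by apply: sumr_ge0.
apply: lerD; first exact: (sub (fun n => sqV n%:Z w ^+ 2) h (fun n => sqr_ge0 _) (ltnW hN)).
rewrite -!(big_mkord xpredT (fun n => sqV n%:Z w ^+ 2)).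
rewrite (@big_cat_nat _ _ _ (N - h) 0 N)//= ?leq_subr// lerDl.
by apply: sumr_ge0 => i _; exact: sqr_ge0.
Qed.

End Fixed.

Section Kernel.
Variables (f : R -> R) (a : R) (b : nat -> R).

Local Notation TN N := (Num.truncn (a / b N)).

(** The HAC sum folded onto nonnegative lags: the estimator at lag -h is a transpose, hence the
    exchanged indices. *)
Definition kernel_sum (N : nat) (x : 'I_d * 'I_q -> 'I_d * 'I_q -> nat -> R) I J : R :=
  f 0 * x I J 0%N + \sum_(h < TN N)
    (f (h.+1%:R * b N) * x I J h.+1 + f (- (h.+1%:R * b N)) * x J I h.+1).

Lemma PsiHACE N w I J : PsiHAC s p Y nu f a b N w (Widx I) (Widx J) =
  kernel_sum N (fun I J h => Lambdahat_nat s p Y nu N h w (Widx I) (Widx J)) I J.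
Proof.
rewrite /PsiHAC /=.
rewrite (sum_sym (fun h : int => f (h%:~R * b N) *: Lambdahat s p Y nu N h w)).
rewrite mxE summxE mxE mul0r /kernel_sum; congr (_ * _ + _).
by apply: eq_bigr => h _; rewrite !mxE -mulNr; congr (_ + f (_ * _) * _); rewrite mxE.
Qed.

Lemma kernel_sum_err N x y M e I J : (forall t, `|f t| <= M) ->
  (forall I J h, (h <= TN N)%N -> `|x I J h - y I J h| <= e I J h) ->
  `|kernel_sum N x I J - kernel_sum N y I J| <=
  M * (e I J 0%N + \sum_(h < TN N) (e I J h.+1 + e J I h.+1)).
Proof.
move=> hf hxy; rewrite /kernel_sum opprD addrACA -mulrBr -sumrB [leRHS]mulrDr.
apply: le_trans (ler_normD _ _) _; apply: lerD.
  by rewrite normrM; apply: ler_pM => //; exact: hxy.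
rewrite mulr_sumr; apply: le_trans (ler_norm_sum _ _ _) _; apply: ler_sum => h _.
rewrite opprD addrACA -!mulrBr [leRHS]mulrDr; apply: le_trans (ler_normD _ _) _.
by apply: lerD; rewrite normrM; apply: ler_pM => //; apply: hxy; exact: ltn_ord.
Qed.

Lemma PsiHAC_err N w D M I J : (0 < N)%N ->
  (forall n, (n < N)%N ->
    Y (tm n%:Z) w = Bmat p Phi nu *m Xreg s p Y nu n%:Z w + eps (tm n%:Z) w) ->
  `|Bhat s p Y nu N w - Bmat p Phi nu| <= D -> D <= 1 -> (forall t, `|f t| <= M) ->
  `|PsiHAC s p Y nu f a b N w (Widx I) (Widx J) -
    kernel_sum N (fun I J h => acov_wt N h * acov I J h) I J| <=
  M * ((2 * TN N)%N.+1%:R * (q%:R * (2 + q%:R) * D * sqV_avg N w) +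
       2 * acov_err (TN N) N w).
Proof.
move=> N0 rel hD D1 hf; rewrite PsiHACE.
set A := q%:R * _ * D * _.
pose e I J h := `|acov_avg I J N h w - acov_wt N h * acov I J h|.
have M0 : 0 <= M by exact: le_trans (normr_ge0 _) (hf 0).
apply: le_trans (kernel_sum_err (e := fun I J h => A + e I J h) _ _ hf _) _.
  move=> I' J' h _.
  rewrite -(subrK (acov_avg I' J' N h w) (Lambdahat_nat _ _ _ _ _ _ _ _ _)) -addrA.
  by apply: le_trans (ler_normD _ _) _; rewrite lerD2r; exact: Lambdahat_nat_err.
have eS I' J' : \sum_(h < (TN N).+1) e I' J' h <= acov_err (TN N) N w.
  rewrite /acov_err (bigD1 I')//= (bigD1 J')//= -addrA lerDl addr_ge0//.
    by apply: sumr_ge0 => j _; apply: sumr_ge0.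
  by apply: sumr_ge0 => i _; apply: sumr_ge0 => j _; apply: sumr_ge0.
rewrite ler_wpM2l//; move: (TN N) eS => K eS.
rewrite (sum_shift_add (fun h => e I J h.+1) (fun h => e J I h.+1)).
have e0 : 0 <= e J I 0%N by exact: normr_ge0.
have := eS I J; have := eS J I; rewrite !big_ord_recl /= /bump /=.
rewrite -[in X in _ -> _ -> _ <= X * _ + _]natr1 natrM.
set S1 := \sum_(i < K) e I J _; set S2 := \sum_(i < K) e J I _; set t := K%:R.
move=> h1 h2.
have -> : (2%:R * t + 1) * A = A + t * (A + A) by ring.
by lra.
Qed.

End Kernel.
End Residuals.

(** * Rates implied by the bandwidth condition *)

Section Bandwidth.
Context {R : realType}.
Variables (kappa a B : R) (b : nat -> R).
Hypothesis k0 : 0 < kappa.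
Hypothesis a0 : 0 < a.
Hypothesis B1 : 1 <= B.
Hypothesis b_gt0 : forall N, 0 < b N.
Hypothesis b_to0 : b @ \oo --> 0.
Hypothesis b_rate :
  (fun N => N%:R * b N `^ ((10 + 4 * kappa) / kappa)) @ \oo --> +oo.

Local Notation TN N := (Num.truncn (a / b N)).

Definition rateL N := N%:R * b N `^ ((10 + 4 * kappa) / kappa).
Definition rateK := B * (2 * a + B) * (a + 1) ^+ 2.
(** The common scale of the fluctuation bounds: the bandwidth condition gives tau -> 0, and [rateK]
    is the constant that makes [tau_acov] hold. *)
Definition tau N := Num.sqrt (rateK / rateL N).
(* Truncation level M of the scores: both T_N * M ^ (- kappa) and
   T_N * M ^ 2 * sqrt (T_N / N) must vanish. *)
Definition clipM N := b N `^ (- (kappa^-1 + 4^-1)).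

Lemma powR_seq_to0 r : 0 < r -> (fun N => b N `^ r) @ \oo --> 0.
Proof.
move=> r0; apply: (@cvg_comp _ _ _ b (fun x : R => x `^ r) _ 0^'+); last exact: powR_cvg0.
move=> A hA; have h : \forall N \near \oo, 0 < b N -> A (b N) := b_to0 hA.
by change (\forall N \near \oo, A (b N)); apply: filterS h => N /=; apply.
Qed.

Lemma truncn_le_ab N : (TN N)%:R <= a / b N.
Proof. by rewrite truncn_le divr_ge0// ltW. Qed.

Lemma truncn_to_oo H : \forall N \near \oo, (H <= TN N)%N.
Proof.
have e0 : 0 < a / H.+1%:R by rewrite divr_gt0.
move/cvgrPdist_le: b_to0 => /(_ _ e0); apply: filterS => N.
rewrite sub0r normrN gtr0_norm// => h.
rewrite truncn_ge_nat ?divr_ge0 ?(ltW a0) ?(ltW (b_gt0 N))// ler_pdivlMr//.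
apply: le_trans (_ : H.+1%:R * b N <= _); last by rewrite mulrC -ler_pdivlMr.
by rewrite ler_wpM2r ?(ltW (b_gt0 N))// ler_nat.
Qed.

Lemma b_le1 : \forall N \near \oo, b N <= 1.
Proof.
move/cvgrPdist_le: b_to0 => /(_ _ ltr01); apply: filterS => N.
by rewrite sub0r normrN gtr0_norm.
Qed.

Lemma K_gt0 : 0 < rateK.
Proof. by rewrite /rateK !mulr_gt0 ?exprn_gt0//; have := B1; have := a0; lra. Qed.

Lemma K_ge : B <= rateK.
Proof.
rewrite /rateK -mulrA ler_peMr//; first by have := B1; lra.
have h1 : 1 <= 2 * a + B by have := B1; have := a0; lra.
have h2 : 1 <= (a + 1) ^+ 2 by rewrite exprn_ege1// lerDr ltW.
by rewrite -[leLHS]mulr1; apply: ler_pM.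
Qed.

Lemma L_gt0 N : (0 < N)%N -> 0 < rateL N.
Proof. by move=> N0; rewrite mulr_gt0 ?ltr0n// powR_gt0. Qed.

Lemma tau_gt0 N : (0 < N)%N -> 0 < tau N.
Proof. by move=> N0; rewrite sqrtr_gt0 divr_gt0 ?K_gt0 ?L_gt0. Qed.

Lemma tau_sqr N : (0 < N)%N -> tau N ^+ 2 = rateK / rateL N.
Proof. by move=> N0; rewrite sqr_sqrtr// divr_ge0// ltW ?K_gt0 ?L_gt0. Qed.

Lemma tau_to0 : tau @ \oo --> 0.
Proof.
have h : (fun N => (rateL N)^-1) @ \oo --> 0.
  apply/gtr0_cvgV0; last exact: b_rate.
  by exists 1%N => // N /= N1; exact: L_gt0.
rewrite /tau -[X in _ --> X](@sqrtr0 R).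
apply: (@cvg_comp _ _ _ (fun N => rateK / rateL N) (@Num.sqrt R) _ (nbhs (0 : R))).
  have h2 : (fun N => rateK * (rateL N)^-1) @ \oo --> rateK * 0 by exact: cvgMr.
  by rewrite mulr0 in h2.
exact: sqrt_continuous.
Qed.

Lemma kdivE : (10 + 4 * kappa) / kappa = 4 + 10 / kappa.
Proof. by have := k0; move=> h; field; exact: lt0r_neq0. Qed.

Lemma rateL_le N : b N <= 1 -> rateL N <= N%:R * b N ^+ 4.
Proof.
move=> b1; rewrite /rateL ler_wpM2l// kdivE.
rewrite -[X in _ <= X]powR_mulrn ?(ltW (b_gt0 N))//.
apply: ger_powR; first by rewrite b_gt0.
by rewrite lerDl divr_ge0// ltW.
Qed.

(** The average score is thus of mean size b^2 tau. The spare b^2 later pays for summing over T_N =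
    O(1 / b) lags. *)
Lemma tau_var N : (0 < N)%N -> b N <= 1 -> B / N%:R <= (b N ^+ 2 * tau N) ^+ 2.
Proof.
move=> N0 b1; have NR : 0 < N%:R :> R by rewrite ltr0n.
rewrite exprMn tau_sqr// mulrCA ler_pM// ?invr_ge0//; rewrite ?K_ge//.
  by have := B1; lra.
by rewrite -exprM ler_pdivlMr ?L_gt0// ler_pdivrMl// rateL_le.
Qed.

(** With accuracy N tau / (T_N + 1), the errors of T_N + 1 lags divided by N add up to tau. M^4
    T_N^3 / N has order b^(-(4 + 4/kappa)) / N, while the rate has exponent 4 + 10/kappa; the spare
    power 6/kappa of b is dropped using b <= 1. *)
Lemma tau_acov N : (0 < N)%N -> b N <= 1 ->
  N%:R * (B * clipM N ^+ 4 * ((TN N + TN N)%:R + B)) <=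
  (N%:R * tau N / (TN N).+1%:R) ^+ 2.
Proof.
move=> N0 b1; have NR : 0 < N%:R :> R by rewrite ltr0n.
have bp := b_gt0 N; have bn : b N != 0 by rewrite gt_eqF.
rewrite exprMn exprMn tau_sqr// /rateL exprVn ler_pdivlMr ?exprn_gt0//.
set be := b N `^ _.
have be0 : 0 < be by rewrite powR_gt0.
have -> : N%:R ^+ 2 * (rateK / (N%:R * be)) = N%:R * (rateK / be).
  by field; rewrite !gt_eqF.
rewrite -[leLHS]mulrA ler_wpM2l ?(ltW NR)// ler_pdivlMr//.
have Mb : clipM N ^+ 4 * be <= b N ^+ 3.
  rewrite /clipM /be -powR_mulrn ?powR_ge0// -powRrM -powRD ?bn ?implybT//.
  rewrite -(powR_mulrn 3 (ltW bp)); apply: ger_powR; rewrite ?bp//.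
  rewrite kdivE; have ki : 0 < kappa^-1 by rewrite invr_gt0.
  by lra.
have tab : (TN N)%:R <= a / b N := truncn_le_ab N.
have t1 : (TN N).+1%:R * b N <= a + 1.
  by rewrite -natr1 mulrDl mul1r; apply: lerD => //; rewrite -ler_pdivlMr.
have t2 : ((TN N + TN N)%:R + B) * b N <= 2 * a + B.
  rewrite mulrDl; apply: lerD; last by rewrite ler_piMr//; have := B1; lra.
  by rewrite natrD mulrDl mulrDl !mul1r; apply: lerD; rewrite -ler_pdivlMr.
have t20 : 0 <= (TN N + TN N)%:R + B by rewrite addr_ge0//; have := B1; lra.
have B0 : 0 <= B by have := B1; lra.
apply: le_trans (_ : B * (((TN N + TN N)%:R + B) * b N) * ((TN N).+1%:R * b N) ^+ 2 <= _).
  have -> : B * (((TN N + TN N)%:R + B) * b N) * ((TN N).+1%:R * b N) ^+ 2 =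
    B * ((TN N + TN N)%:R + B) * (TN N).+1%:R ^+ 2 * b N ^+ 3 by ring.
  have -> : B * clipM N ^+ 4 * ((TN N + TN N)%:R + B) * (TN N).+1%:R ^+ 2 * be =
    B * ((TN N + TN N)%:R + B) * (TN N).+1%:R ^+ 2 * (clipM N ^+ 4 * be) by ring.
  by rewrite ler_wpM2l// !mulr_ge0.
rewrite /rateK; apply: ler_pM; rewrite ?exprn_ge0 ?mulr_ge0 ?(ltW bp)//.
  by rewrite ler_wpM2l.
by rewrite lerXn2r ?nnegrE ?mulr_ge0 ?addr_ge0 ?(ltW bp) ?(ltW a0).
Qed.

(** M^(-kappa) is b^(1 + kappa/4): one power of b compensates T_N + 1, the rest still tends to 0. *)
Lemma clipM_rate N : b N <= 1 ->
  (TN N).+1%:R * clipM N `^ (- kappa) <= (a + 1) * b N `^ (kappa / 4).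
Proof.
move=> b1; have bp := b_gt0 N; have bn : b N != 0 by rewrite gt_eqF.
have -> : clipM N `^ (- kappa) = b N * b N `^ (kappa / 4).
  have -> : b N * b N `^ (kappa / 4) = b N `^ (1 + kappa / 4).
    by rewrite powRD ?bn ?implybT// powRr1// ltW.
  rewrite /clipM -powRrM.
  by congr (_ `^ _); have h := k0; field; rewrite gt_eqF.
rewrite mulrA ler_wpM2r ?powR_ge0//.
rewrite -natr1 mulrDl mul1r; apply: lerD => //.
by rewrite -ler_pdivlMr ?truncn_le_ab.
Qed.

Lemma truncn_exp_to0 (sg : R) : 0 < sg -> sg < 1 ->
  (fun N => (TN N).+1%:R * sg ^+ (TN N)) @ \oo --> 0.
Proof.
move=> s0 s1; apply: (@cvg_comp _ _ _ (fun N => TN N) (fun n => n.+1%:R * sg ^+ n) _ \oo).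
  move=> A [H _ hA]; apply: filterS (truncn_to_oo H) => N /= hN; exact: hA.
exact: mul_exp_to0.
Qed.

End Bandwidth.

(** * The long-run variance as limit of the weighted autocovariances *)

Section LongRunVariance.
Context {R : realType} {dT : measure_display} {T : measurableType dT}.
Variables (P : probability T R) (d s : nat) (p : nat -> nat).
Variables (Y eps : int -> T -> 'cV[R]_d) (kappa : R) (nu : nat).
Variables (B sg : R) (g : nat -> R).
Hypothesis mf : model_facts P s p Y eps kappa nu B sg g.
Hypothesis cross0 : forall i x n, Ex P (@procZ R dT T d s p Y eps nu (inl i) (inr x) n) = 0.

Local Notation q := (p nu * d)%N.
Local Notation acov := (@acov R dT T P d s p Y eps nu).
Local Notation Widx := (@Widx d p nu).

Lemma mx_cvg_entry m n (A : nat -> 'M[R]_(m, n)) (l : 'M[R]_(m, n)) :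
  (forall i j, (fun N => A N i j) @ \oo --> l i j) -> A @ \oo --> l.
Proof.
move=> h; apply/cvgrPdist_le => e e0.
have hh : \forall N \near \oo, forall ij : 'I_m * 'I_n, `|l ij.1 ij.2 - A N ij.1 ij.2| <= e.
  by apply: filter_forall => -[i j]; move/cvgrPdist_le: (h i j) => /(_ _ e0).
apply: filterS hh => N hN; apply: mx_norm_leP; first exact: ltW.
by move=> i j; rewrite !mxE; exact: (hN (i, j)).
Qed.

Lemma WscoreE n w (I : 'I_d * 'I_q) : Wscore s p Y eps nu n w (Widx I) ord0 =
  score s Y eps I n w.
Proof. by rewrite /Wscore /vecc mxE mxvecE mxE mxE big_ord1 [X in _ * X]mxE. Qed.

Lemma LambdaE h (I J : 'I_d * 'I_q) : Lambda P s p Y eps nu h (Widx I) (Widx J) =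
  Ex P (fun w => score s Y eps I 0 w * score s Y eps J (- h) w).
Proof.
rewrite mxE; apply: eq_Ex => w.
by rewrite mxE big_ord1 [X in _ * X]mxE !WscoreE.
Qed.

Lemma Lambda_nat (h : nat) I J : Lambda P s p Y eps nu h%:Z (Widx I) (Widx J) = acov I J h.
Proof.
rewrite LambdaE -(mf_statZ mf _ _ _ _ 0 (- h%:Z) h%:Z) add0r addNr.
by [].
Qed.

Lemma Lambda_opp (h : nat) I J : Lambda P s p Y eps nu (- h%:Z) (Widx I) (Widx J) =
  acov J I h.
Proof. by rewrite LambdaE opprK; apply: eq_Ex => w; rewrite mulrC. Qed.

Lemma acov_le I J h : `|acov I J h| <= g h.
Proof.
have := mf_cov mf (inl I.1) (inr I.2) (inl J.1) (inr J.2) h.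
by rewrite /cov cross0 mul0r subr0.
Qed.

(** [Psi] is a [limn], so its entries are known only once the matrices of symmetric partial sums are
    shown to converge. *)
Lemma PsiE (l : 'I_d * 'I_q -> 'I_d * 'I_q -> R) :
  (forall I J, series (fun h => acov I J h.+1 + acov J I h.+1) @ \oo --> l I J) ->
  forall I J, Psi P s p Y eps nu (Widx I) (Widx J) = acov I J 0 + l I J.
Proof.
move=> hl.
(* The inverse of [Widx], needed to write the limit as a matrix. *)
pose idx (x : 'I_(q * d)) : 'I_d * 'I_q :=
  let u := enum_val (cast_ord (esym (mxvec_cast q d)) x) in (u.2, u.1).
have idxK I : idx (Widx I) = I.
  by case: I => i x; rewrite /idx /Widx /mxvec_index cast_ordK enum_rankK.
pose L : 'M[R]_(q * d) := \matrix_(x, y) (acov (idx x) (idx y) 0 + l (idx x) (idx y)).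
suff cL : (fun H : nat => \sum_(i < (2 * H).+1) Lambda P s p Y eps nu (i%:Z - H%:Z)) @ \oo --> L.
  by move=> I J; rewrite /Psi (cvg_lim _ cL)// mxE !idxK.
apply: mx_cvg_entry => x y.
case/mxvec_indexP: x => x1 x2; case/mxvec_indexP: y => y1 y2.
rewrite -[mxvec_index x1 x2]/(Widx (x2, x1)) -[mxvec_index y1 y2]/(Widx (y2, y1)).
rewrite mxE !idxK.
rewrite (_ : (fun N => _) = (fun H => acov (x2, x1) (y2, y1) 0 +
    series (fun h => acov (x2, x1) (y2, y1) h.+1 + acov (y2, y1) (x2, x1) h.+1) H)).
  by apply: cvgD; [exact: cvg_cst|exact: hl].
apply/funext => H; rewrite (sum_sym (Lambda P s p Y eps nu)) mxE summxE Lambda_nat.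
rewrite /series /= big_mkord; congr (_ + _); apply: eq_bigr => h _.
by rewrite mxE Lambda_nat Lambda_opp.
Qed.

Lemma acov_wt_cvg (h : nat) : (fun N => acov_wt N h : R) @ \oo --> (1 : R).
Proof.
apply/cvgrPdist_le => e e0.
have [K hK] : exists K : nat, h%:R / e <= K%:R.
  exists (Num.truncn (h%:R / e)).+1; exact: ltW (truncnS_gt _).
exists (K + h).+1 => // N /= hN.
have N0 : 0 < N%:R :> R by rewrite ltr0n; lia.
rewrite /acov_wt natrB; last by lia.
have -> : 1 - (N%:R - h%:R) / N%:R = h%:R / N%:R :> R by field; rewrite gt_eqF.
rewrite ger0_norm ?divr_ge0// ler_pdivrMr// mulrC -ler_pdivrMr//.
by apply: le_trans hK _; rewrite ler_nat; lia.
Qed.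

Lemma acov_wt_bound N h : 0 <= (acov_wt N h : R) <= 1.
Proof.
rewrite /acov_wt divr_ge0//=; case: N => [|N]; first by rewrite invr0 mulr0.
by rewrite ler_pdivrMr// mul1r ler_nat leq_subr.
Qed.

Lemma kernel_sum_cvg (f : R -> R) (a : R) (b : nat -> R) M : 0 < a ->
  (forall N, 0 < b N) -> b @ \oo --> 0 -> (forall x, `|f x| <= M) ->
  {for 0, continuous f} -> f 0 = 1 ->
  forall I J, (fun N => kernel_sum f a b N (fun I J h => acov_wt N h * acov I J h) I J)
    @ \oo --> Psi P s p Y eps nu (Widx I) (Widx J).
Proof.
move=> a0 b0 bto0 fM fc f0.
have fb h c : (fun N => f (c * (h.+1%:R * b N))) @ \oo --> (1 : R).
  have h2 : (fun N => c * (h.+1%:R * b N)) @ \oo --> c * (h.+1%:R * 0).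
    by apply: cvgMr; apply: cvgMr.
  rewrite !mulr0 in h2.
  have h3 : (fun N => f (c * (h.+1%:R * b N))) @ \oo --> f 0 by exact: cvg_comp h2 fc.
  by rewrite f0 in h3.
have M0 : 0 <= M by exact: le_trans (fM 0).
pose x I J N h := f (h.+1%:R * b N) * (acov_wt N h.+1 * acov I J h.+1) +
  f (- (h.+1%:R * b N)) * (acov_wt N h.+1 * acov J I h.+1).
have xb I J N h : `|x I J N h| <= M * (g h.+1 + g h.+1).
  have w0 t := acov_wt_bound N t.
  have e1 c c' t : `|f t * (acov_wt N h.+1 * acov c c' h.+1)| <= M * g h.+1.
    rewrite normrM; apply: ler_pM => //; rewrite normrM -[leRHS]mul1r.
    have /andP[w1 w2] := w0 h.+1.
    by apply: ler_pM => //; [rewrite ger0_norm|exact: acov_le].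
  by apply: le_trans (ler_normD _ _) _; rewrite mulrDr; exact: lerD.
have ex I J := @tannery _ (x I J) (fun h => acov I J h.+1 + acov J I h.+1)
  (fun h => M * (g h.+1 + g h.+1)) (fun N => Num.truncn (a / b N)) (M * (B + B)).
have {}ex I J : exists2 l : R, series (fun h => acov I J h.+1 + acov J I h.+1) @ \oo --> l &
    (fun N => \sum_(h < Num.truncn (a / b N)) x I J N h) @ \oo --> l.
  apply: ex.
  - exact: xb.
  - move=> N; rewrite -mulr_sumr ler_wpM2l// big_split /=.
    have h1 : \sum_(h < N) g h.+1 <= B.
      apply: le_trans (mf_gsum mf N.+1); rewrite big_ord_recl /= lerDr.
      exact: (mf_g0 mf).
    exact: lerD.
  - move=> h; rewrite /x.
    have w1 := acov_wt_cvg h.+1.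
    have f1 := fb h 1; have f2 := fb h (-1).
    have -> : acov I J h.+1 + acov J I h.+1 =
      1 * (1 * acov I J h.+1) + 1 * (1 * acov J I h.+1) by rewrite !mul1r.
    apply: cvgD; apply: cvgM.
    + by under eq_fun do rewrite -[h.+1%:R * _]mul1r; exact: f1.
    + by apply: cvgM => //; exact: cvg_cst.
    + by under eq_fun do rewrite -mulN1r; exact: f2.
    + by apply: cvgM => //; exact: cvg_cst.
  - exact: truncn_to_oo.
(* [PsiE] wants the limits for all index pairs at once, so they are chosen as a function. *)
pose l I J := sval (cid2 (ex I J)).
have hl I J : series (fun h => acov I J h.+1 + acov J I h.+1) @ \oo --> l I J.
  by rewrite /l; case: cid2.
have hx I J : (fun N => \sum_(h < Num.truncn (a / b N)) x I J N h) @ \oo --> l I J.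
  by rewrite /l; case: cid2.
move=> I J; rewrite (PsiE hl); rewrite /kernel_sum; apply: cvgD; last exact: hx.
rewrite f0 -[X in _ --> X]mul1r; apply: cvgM; first exact: cvg_cst.
rewrite -[X in _ --> X]mul1r; apply: cvgM; last exact: cvg_cst.
exact: acov_wt_cvg.
Qed.

End LongRunVariance.

(** * Mean bounds for the sample averages *)

Section Consistency.
Context {R : realType} {dT : measure_display} {T : measurableType dT}.
Variables (P : probability T R) (d s : nat) (p : nat -> nat).
Variables (Phi : nat -> nat -> 'M[R]_d).
Variables (Y eps : int -> T -> 'cV[R]_d) (kappa : R) (nu : nat).
Variables (B sg : R) (g : nat -> R).
Hypothesis k0 : 0 < kappa.
Hypothesis mf : model_facts P s p Y eps kappa nu B sg g.
Hypothesis cross0 : forall i x n, Ex P (@procZ R dT T d s p Y eps nu (inl i) (inr x) n) = 0.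

Local Notation tm n := (n * s%:Z + nu%:Z).
Local Notation q := (p nu * d)%N.
Local Notation Z := (@procZ R dT T d s p Y eps nu).
Local Notation acov := (@acov R dT T P d s p Y eps nu).
Local Notation acov_avg := (@acov_avg R dT T d s p Y eps nu).
Local Notation acov_err := (@acov_err R dT T P d s p Y eps nu).
Local Notation score_avg := (@score_avg R dT T d s p Y eps nu).
Local Notation gram_avg := (@gram_avg R dT T d s p Y eps nu).
Local Notation sqV := (@sqV R dT T d s p Y eps nu).
Local Notation sqV_avg := (@sqV_avg R dT T d s p Y eps nu).
Local Notation Smat := (@Smat R dT T P d s p Y eps nu).
Local Notation Widx := (@Widx d p nu).

Lemma Z_avg_dev u v (N : nat) t : (0 < N)%N -> 0 < t -> B / N%:R <= t ^+ 2 ->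
  let D w := N%:R^-1 * \sum_(n < N) Z u v n%:Z w - Ex P (Z u v 0) in
  L1 P D /\ Ex P (fun w => `|D w|) <= t.
Proof.
move=> N0 t0 hB D; have NR : 0 < N%:R :> R by rewrite ltr0n.
have [i2 e2] := mf_var mf u v N.
have iD : L1 P D.
  apply: L1B; last exact: L1_cst.
  by apply: L1Z; apply: L1_sum => n _; exact: (mf_L1 mf).
have DE w : D w ^+ 2 = N%:R^-1 ^+ 2 *
    (\sum_(n < N) Z u v n%:Z w - N%:R * Ex P (Z u v 0)) ^+ 2.
  by rewrite -exprMn /D; congr (_ ^+ 2); field; rewrite gt_eqF.
have iD2 : L1 P (fun w => D w ^+ 2) by under eq_fun do rewrite DE; exact: L1Z.
have eD2 : Ex P (fun w => D w ^+ 2) <= t ^+ 2.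
  apply: le_trans hB; under eq_fun do rewrite DE.
  rewrite ExZ// [N%:R^-1 ^+ 2]expr2 -[leLHS]mulrA [leRHS]mulrC ler_wpM2l ?invr_ge0//.
  by rewrite ler_pdivrMl.
have [|||i1 e1] := Ex_CS (P := P) (Y := fun=> 1) t0 ltr01 (L1_meas iD) (measurable_cst _) iD2.
- by under eq_fun do rewrite expr1n; exact: L1_cst.
- exact: eD2.
- by under eq_fun do rewrite expr1n; rewrite Ex_cst expr1n.
split=> //; rewrite mulr1 in e1; apply: le_trans e1.
by rewrite (eq_Ex P (Y := fun w => `|D w * 1|))// => w; rewrite mulr1.
Qed.

Lemma Ex_sum_norm m n (A : T -> 'M[R]_(m, n)) t :
  (forall i j, L1 P (fun w => A w i j) /\ Ex P (fun w => `|A w i j|) <= t) ->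
  let D w := \sum_i \sum_j `|A w i j| in
  L1 P D /\ Ex P (fun w => `|D w|) <= (m * n)%:R * t.
Proof.
move=> h D; have iA i : L1 P (fun w => \sum_j `|A w i j|).
  by apply: L1_sum => j _; apply: L1_norm; exact: (h i j).1.
split; first by apply: L1_sum => i _; exact: iA.
rewrite (eq_Ex P (Y := D)); last first.
  by move=> w; rewrite ger0_norm//; apply: sumr_ge0 => i _; exact: sumr_ge0.
rewrite Ex_sum//; apply: le_trans (_ : \sum_(i < m) \sum_(j < n) t <= _).
  apply: ler_sum => i _; rewrite Ex_sum; last by move=> j _; apply: L1_norm; exact: (h i j).1.
  by apply: ler_sum => j _; exact: (h i j).2.
by rewrite natrM -mulrA !mulr_natl !sumr_const !card_ord.
Qed.

Lemma score_avg_dev N t : (0 < N)%N -> 0 < t -> B / N%:R <= t ^+ 2 ->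
  let D w := \sum_i \sum_x `|score_avg N w i x| in
  L1 P D /\ Ex P (fun w => `|D w|) <= (d * q)%:R * t.
Proof.
move=> N0 t0 hB; apply: Ex_sum_norm => i x.
have eqw w : score_avg N w i x =
    N%:R^-1 * (\sum_(n < N) Z (inl i) (inr x) n w) - Ex P (Z (inl i) (inr x) 0).
  by rewrite mxE cross0 subr0.
have [i1 e1] := Z_avg_dev (inl i) (inr x) N0 t0 hB.
by split; [rewrite (funext eqw)|under eq_fun do rewrite eqw].
Qed.

Lemma gram_avg_dev N t : (0 < N)%N -> 0 < t -> B / N%:R <= t ^+ 2 ->
  let D w := \sum_x \sum_y `|(gram_avg N w - Smat) x y| in
  L1 P D /\ Ex P (fun w => `|D w|) <= (q * q)%:R * t.
Proof.
move=> N0 t0 hB; apply: (Ex_sum_norm (A := fun w => gram_avg N w - Smat)) => x y.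
have eqw w : (gram_avg N w - Smat) x y =
    N%:R^-1 * (\sum_(n < N) Z (inr x) (inr y) n w) - Ex P (Z (inr x) (inr y) 0).
  by rewrite !mxE.
have [i1 e1] := Z_avg_dev (inr x) (inr y) N0 t0 hB.
by split; [rewrite (funext eqw)|under eq_fun do rewrite eqw].
Qed.

Definition sqV_bound : R := \sum_(u : 'I_d + 'I_q) \sum_(v : 'I_d + 'I_q) B.

Lemma sqV_avg_mom N : (0 < N)%N -> L1 P (sqV_avg N) /\
  Ex P (fun w => `|sqV_avg N w|) <= sqV_bound.
Proof.
move=> N0; have NR : 0 < N%:R :> R by rewrite ltr0n.
have VE n w : sqV n w ^+ 2 = \sum_u \sum_v Z u u n w * Z v v n w.
  by rewrite expr2 /sqV mulr_suml; apply: eq_bigr => u _; rewrite mulr_sumr.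
have iV n : L1 P (fun w => sqV n w ^+ 2).
  under eq_fun do rewrite VE.
  by apply: L1_sum => u _; apply: L1_sum => v _; exact: (mf_L1Z mf).
have eV n : Ex P (fun w => sqV n w ^+ 2) <= sqV_bound.
  under eq_fun do rewrite VE.
  rewrite Ex_sum; last by move=> u _; apply: L1_sum => v _; exact: (mf_L1Z mf).
  apply: ler_sum => u _; rewrite Ex_sum; last by move=> v _; exact: (mf_L1Z mf).
  apply: ler_sum => v _.
  apply: le_trans (_ : Ex P (fun w => 2^-1 *
      (Z u u n w * Z u u n w + Z v v n w * Z v v n w)) <= _).
    apply: Ex_le; first exact: (mf_L1Z mf).
      by apply: L1Z; apply: L1D; exact: (mf_L1Z mf).
    by move=> w; have := sqr_ge0 (Z u u n w - Z v v n w); rewrite sqrrB !expr2; lra.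
  rewrite ExZ; last by apply: L1D; exact: (mf_L1Z mf).
  rewrite ExD; [|exact: (mf_L1Z mf)..].
  by have := mf_sqr mf u u n; have := mf_sqr mf v v n; lra.
have iA : L1 P (sqV_avg N) by apply: L1Z; apply: L1_sum => n _; exact: iV.
split=> //; rewrite (eq_Ex P (Y := sqV_avg N)); last first.
  by move=> w; rewrite ger0_norm// sqV_avg_ge0.
rewrite ExZ; last by apply: L1_sum => n _; exact: iV.
rewrite Ex_sum; last by move=> n _; exact: iV.
rewrite ler_pdivrMl//; apply: le_trans (_ : \sum_(n < N) sqV_bound <= _).
  by apply: ler_sum => n _; exact: eV.
by rewrite sumr_const card_ord mulr_natl.
Qed.

(** The average at lag k has N - k terms, so [mf_avg] is used with N - k; its condition and its
    bound only improve with fewer terms. The depth of approximation is set equal to the largest lag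
    H. *)
Lemma acov_err_mom N H M x : (0 < N)%N -> 0 < M -> 0 < x ->
  N%:R * (B * M ^+ 4 * ((H + H)%:R + B)) <= x ^+ 2 ->
  L1 P (acov_err H N) /\ Ex P (fun w => `|acov_err H N w|) <=
    ((d * q) * (d * q))%:R * (H.+1%:R * (x / N%:R + B * (sg ^+ H + M `^ (- kappa)))).
Proof.
move=> N0 M0 x0 hx; have NR : 0 < N%:R :> R by rewrite ltr0n.
have B0 : 0 <= B by have := mf_B mf; lra.
have sgk : 0 <= sg ^+ H + M `^ (- kappa).
  by rewrite addr_ge0 ?powR_ge0// exprn_ge0// ltW// (mf_sg0 mf).
set rho := x / N%:R + _.
have h I J k : (k <= H)%N ->
  L1 P (fun w => acov_avg I J N k w - acov_wt N k * acov I J k) /\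
  Ex P (fun w => `|acov_avg I J N k w - acov_wt N k * acov I J k|) <= rho.
  move=> kH.
  have [|i1 e1] := mf_avg mf (inl I.1) (inr I.2) (inl J.1) (inr J.2)
    (h := k) (r := H) (N := N - k) M0 x0.
    apply: le_trans hx; apply: ler_pM => //.
    - by rewrite mulr_ge0 ?mulr_ge0 ?exprn_ge0 ?addr_ge0 ?(ltW M0).
    - by rewrite ler_nat leq_subr.
    - rewrite ler_wpM2l ?lerD2r ?ler_nat ?leq_add2r//.
      by rewrite mulr_ge0// exprn_ge0// ltW.
  have eqw w : acov_avg I J N k w - acov_wt N k * acov I J k = N%:R^-1 *
    (\sum_(j < N - k) Z (inl I.1) (inr I.2) (j%:Z + k%:Z) w * Z (inl J.1) (inr J.2) j%:Z w -
    (N - k)%:R * Ex P (fun w => Z (inl I.1) (inr I.2) k%:Z w * Z (inl J.1) (inr J.2) 0 w)).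
    by rewrite mulrBr /acov_wt mulrA [_ / N%:R]mulrC.
  split; first by rewrite (funext eqw); exact: L1Z.
  under eq_fun do rewrite eqw normrM ger0_norm ?invr_ge0//.
  rewrite ExZ; last exact: L1_norm.
  rewrite /rho ler_pdivrMl// mulrDr mulrCA divff ?gt_eqF// mulr1.
  apply: le_trans e1 _; rewrite lerD2l ler_wpM2r ?mulr_ge0//.
  by rewrite ler_nat leq_subr.
have iT I J (k : 'I_H.+1) : L1 P (fun w => `|acov_avg I J N k w - acov_wt N k * acov I J k|).
  by apply: L1_norm; exact: (h I J k (ltn_ord k)).1.
have iA : L1 P (acov_err H N).
  by apply: L1_sum => I _; apply: L1_sum => J _; apply: L1_sum => k _; exact: iT.
split=> //; rewrite (eq_Ex P (Y := acov_err H N)); last first.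
  move=> w; rewrite ger0_norm//; apply: sumr_ge0 => I _; apply: sumr_ge0 => J _.
  exact: sumr_ge0.
rewrite Ex_sum; last by move=> I _; apply: L1_sum => J _; apply: L1_sum => k _; exact: iT.
apply: le_trans (_ : \sum_(I : 'I_d * 'I_q) \sum_(J : 'I_d * 'I_q) \sum_(k < H.+1) rho <= _).
  apply: ler_sum => I _; rewrite Ex_sum; last by move=> J _; apply: L1_sum => k _; exact: iT.
  apply: ler_sum => J _; rewrite Ex_sum; last by move=> k _; exact: iT.
  by apply: ler_sum => k _; exact: (h I J k (ltn_ord k)).2.
by rewrite !sumr_const !card_prod !card_ord !mulr_natl -!mulrnA mulnC mulnA.
Qed.

End Consistency.

(** * Consistency of the HAC estimator *)

Section HAC.
Context {R : realType} {dT : measure_display} {T : measurableType dT}.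
Variables (P : probability T R) (d s : nat) (p : nat -> nat).
Variables (Phi : nat -> nat -> 'M[R]_d).
Variables (Y eps : int -> T -> 'cV[R]_d) (kappa : R) (nu : nat).
Variables (B sg : R) (g : nat -> R).
Hypothesis k0 : 0 < kappa.
Hypothesis mY : forall t i j, measurable_fun setT (fun w => Y t w i j).
Hypothesis mf : model_facts P s p Y eps kappa nu B sg g.
Hypothesis cross0 : forall i x n, Ex P (@procZ R dT T d s p Y eps nu (inl i) (inr x) n) = 0.
Hypothesis rel : forall n : int, {ae P, forall w,
  Y (n * s%:Z + nu%:Z) w = Bmat p Phi nu *m Xreg s p Y nu n w + eps (n * s%:Z + nu%:Z) w}.
Hypothesis Sunit : Smat P s p Y eps nu \in unitmx.
Variables (f : R -> R) (a : R) (b : nat -> R) (F : R).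
Hypothesis a0 : 0 < a.
Hypothesis fF : forall x, `|f x| <= F.
Hypothesis fc : {for 0, continuous f}.
Hypothesis f0 : f 0 = 1.
Hypothesis b_gt0 : forall N, 0 < b N.
Hypothesis b_to0 : b @ \oo --> 0.
Hypothesis b_rate :
  (fun N => N%:R * b N `^ ((10 + 4 * kappa) / kappa)) @ \oo --> +oo.

Local Notation tm n := (n * s%:Z + nu%:Z).
Local Notation q := (p nu * d)%N.
Local Notation TN N := (Num.truncn (a / b N)).
Local Notation tau := (tau kappa a B b).
Local Notation rb N := (b N `^ 2^-1).
Local Notation hac N w := (PsiHAC s p Y nu f a b N w).
Local Notation lrv := (Psi P s p Y eps nu).

(** The final probability is compared with that of a larger event, and monotonicity of [P] asks for
    measurable events. *)
Lemma mxmeas_PsiHAC N : mxmeas (fun w => hac N w).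
Proof.
have mX n : mxmeas (fun w => Xreg s p Y nu n w).
  move=> i j; case/mxvec_indexP: i => k l; rewrite (ord1 j).
  by under eq_fun do rewrite /Xreg mxE mxvecE !mxE; exact: mY.
have mXm : mxmeas (fun w => Xmat s p Y nu N w).
  by move=> i j; under eq_fun do rewrite mxE; exact: mX.
have mZm : mxmeas (fun w => Zmat s Y nu N w).
  by move=> i j; under eq_fun do rewrite mxE; exact: mY.
have mB : mxmeas (fun w => Bhat s p Y nu N w).
  apply: mxmeasM; first by apply: mxmeasM => //; exact: mxmeas_tr.
  by apply: mxmeas_inv; apply: mxmeasM => //; exact: mxmeas_tr.
have mW n : mxmeas (fun w => What s p Y nu N n w).
  have mE : mxmeas (fun w => ehat s p Y nu N n w *m (Xreg s p Y nu n w)^T).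
    apply: mxmeasM; last exact: mxmeas_tr.
    apply: mxmeasD; last by apply: mxmeasN; exact: mxmeasM.
    exact: mY.
  move=> i j; case/mxvec_indexP: i => k l; rewrite (ord1 j).
  by under eq_fun do rewrite /What /vecc mxE mxvecE mxE; exact: mE.
have mL h : mxmeas (fun w => Lambdahat_nat s p Y nu N h w).
  apply: mxmeasZ; apply: mxmeas_sum => n; apply: mxmeasM => //; exact: mxmeas_tr.
apply: mxmeas_sum => i; apply: mxmeasZ.
by case: (_ - _) => h; [exact: mL|apply: mxmeas_tr; exact: mL].
Qed.

Lemma rb_sqr N : rb N * rb N = b N.
Proof. by rewrite powR12_sqrt ?ltW// -expr2 sqr_sqrtr// ltW. Qed.

Lemma rb_gt0 N : 0 < rb N. Proof. exact: powR_gt0. Qed.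

Local Notation score_avg N w := (score_avg s p Y eps nu N w).
Local Notation gram_dev N w := (gram_avg s p Y eps nu N w - Smat P s p Y eps nu).
Local Notation sqV_avg N w := (sqV_avg s p Y eps nu N w).
Local Notation acov_err N w := (acov_err P s p Y eps nu (TN N) N w).
Local Notation model_at n w := (Y (tm n) w =
  Bmat p Phi nu *m Xreg s p Y nu n w + eps (tm n) w).

Lemma mx_norm_le_sum m n (A : 'M[R]_(m, n)) : `|A| <= \sum_i \sum_j `|A i j|.
Proof.
apply: mx_norm_leP; first by apply: sumr_ge0 => i _; exact: sumr_ge0.
move=> i j; rewrite (bigD1 i)//= (bigD1 j)//= -addrA lerDl addr_ge0//.
  exact: sumr_ge0.
by apply: sumr_ge0 => k _; exact: sumr_ge0.
Qed.

Lemma Bhat_dev (eta C : R) N w :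
  (forall S' : 'M[R]_q, `|S' - Smat P s p Y eps nu| <= eta ->
     S' \in unitmx /\ `|invmx S'| <= C) ->
  (0 < N)%N -> (forall n, (n < N)%N -> model_at n%:Z w) ->
  \sum_i \sum_x `|score_avg N w i x| < b N ^+ 2 ->
  \sum_x \sum_y `|gram_dev N w x y| < eta ->
  `|Bhat s p Y nu N w - Bmat p Phi nu| <= q%:R * (b N ^+ 2 * C).
Proof.
move=> hS N0 hm h1 h2.
have [uS iS] := hS _ (le_trans (mx_norm_le_sum _) (ltW h2)).
rewrite (Bhat_err N0 hm uS); apply: le_trans (mulmx_norm _ _) _.
rewrite ler_wpM2l//; apply: ler_pM => //.
exact: le_trans (mx_norm_le_sum _) (ltW h1).
Qed.

(** The deterministic estimate on the good event: |Bhat - B| = O(b^2), O(1 / b) lags and [sqV_avg]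
    below b^(-1/2) leave O(b^(1/2)) for the residuals. *)
Lemma hac_dev (eta C e e4 : R) N w : 0 <= C ->
  (forall S' : 'M[R]_q, `|S' - Smat P s p Y eps nu| <= eta ->
     S' \in unitmx /\ `|invmx S'| <= C) ->
  (0 < N)%N -> b N <= 1 -> 0 <= e ->
  (forall I J, `|kernel_sum f a b N (fun I J h => acov_wt N h * acov P s Y eps I J h) I J -
    lrv (Widx I) (Widx J)| <= e / 2) ->
  q%:R * C * rb N <= 1 ->
  F * ((2 * a + 1) * (q%:R * (2 + q%:R) * (q%:R * C)) * rb N + 2 * e4) <= e / 2 ->
  (forall n, (n < N)%N -> model_at n%:Z w) ->
  \sum_i \sum_x `|score_avg N w i x| < b N ^+ 2 ->
  \sum_x \sum_y `|gram_dev N w x y| < eta ->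
  sqV_avg N w < (rb N)^-1 -> acov_err N w < e4 ->
  `|hac N w - lrv| <= e.
Proof.
move=> C0 hS N0 b1 e0 hk hD hF hm h1 h2 h3 h4.
have bp := b_gt0 N; have rp := rb_gt0 N.
have r1 : rb N <= 1 by rewrite powR12_sqrt ?(ltW bp)// -[leRHS](@sqrtr1 R) ler_sqrt.
have hB := Bhat_dev hS N0 hm h1 h2.
have F0 : 0 <= F by exact: le_trans (fF 0).
set D := q%:R * (b N ^+ 2 * C) in hB.
have brb : b N ^+ 2 <= b N * rb N.
  by rewrite expr2 ler_wpM2l ?(ltW bp)// -[leLHS]rb_sqr ler_piMr ?(ltW rp).
have D1 : D <= 1.
  apply: le_trans hD; rewrite /D mulrCA mulrC ler_wpM2l ?mulr_ge0//.
  by apply: (le_trans brb); rewrite ler_piMl ?(ltW rp).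
apply: mx_norm_leP => // x y.
case/mxvec_indexP: x => x1 x2; case/mxvec_indexP: y => y1 y2.
have hE := PsiHAC_err P (f := f) a b (x2, x1) (y2, y1) N0 hm hB D1 fF.
have hK := hk (x2, x1) (y2, y1).
rewrite -[mxvec_index x1 x2]/(Widx (x2, x1)) -[mxvec_index y1 y2]/(Widx (y2, y1)).
rewrite mxE [X in _ + X]mxE.
rewrite -(subrKA (kernel_sum f a b N (fun I J h => acov_wt N h * acov P s Y eps I J h)
  (x2, x1) (y2, y1))).
apply: le_trans (ler_normD _ _) _; rewrite [leRHS]splitr; apply: lerD => //.
apply: le_trans hE _; apply: le_trans hF; rewrite ler_wpM2l//; apply: lerD; last first.
  by rewrite ler_wpM2l// ltW.
set c := q%:R * (2 + q%:R).
have c0 : 0 <= c by rewrite mulr_ge0.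
apply: le_trans (_ : (2 * TN N)%N.+1%:R * (c * D * (rb N)^-1) <= _).
  by rewrite ler_wpM2l// ler_wpM2l ?(ltW h3)// mulr_ge0// (le_trans _ hB).
have -> : (2 * TN N)%N.+1%:R * (c * D * (rb N)^-1) =
   ((2 * TN N)%N.+1%:R * b N) * (c * (q%:R * C)) * (b N * (rb N)^-1) by rewrite /D; ring.
rewrite -[X in X * (rb N)^-1]rb_sqr mulfK ?gt_eqF// ler_wpM2r ?(ltW rp)//.
rewrite ler_wpM2r ?mulr_ge0// -natr1 natrM mulrDl mul1r lerD//.
rewrite -mulrA ler_wpM2l// -ler_pdivlMr//; exact: truncn_le_ab.
Qed.

Lemma to0D (u v : nat -> R) : u @ \oo --> 0 -> v @ \oo --> 0 ->
  (fun N => u N + v N) @ \oo --> 0.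
Proof.
move=> hu hv; have h : (fun N => u N + v N) @ \oo --> (0 + 0 : R) by exact: cvgD.
by rewrite addr0 in h.
Qed.

Lemma to0Z c (u : nat -> R) : u @ \oo --> 0 -> (fun N => c * u N) @ \oo --> 0.
Proof.
move=> hu; have h : (fun N => c * u N) @ \oo --> c * 0 by exact: cvgMr.
by rewrite mulr0 in h.
Qed.

Lemma rb_to0 : (fun N => rb N) @ \oo --> 0.
Proof. by apply: (powR_seq_to0 b_gt0 b_to0); rewrite invr_gt0. Qed.

Lemma rb_small c e : 0 < e -> \forall N \near \oo, c * rb N <= e.
Proof.
move=> e0; move/cvgrPdist_le : (to0Z c rb_to0) => /(_ _ e0).
by apply: filterS => N; rewrite sub0r normrN; apply: le_trans; exact: ler_norm.
Qed.

Lemma B_ge1 : 1 <= B. Proof. exact: (mf_B mf). Qed.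

(** Four Markov bounds, for the average score, the Gram matrix, the fourth-order average and the
    autocovariances, in the order of the events below. *)
Definition bad_prob (eta e4 : R) N : R :=
  (d * q)%:R * tau N + eta^-1 * ((q * q)%:R * tau N) +
  sqV_bound d p nu B * rb N +
  e4^-1 * (((d * q) * (d * q))%:R * (tau N + B * ((TN N).+1%:R * sg ^+ TN N) +
    B * ((a + 1) * b N `^ (kappa / 4)))).

Lemma bad_prob_to0 eta e4 : bad_prob eta e4 @ \oo --> 0.
Proof.
have t0 := tau_to0 a B b_gt0 b_rate.
have s0 := truncn_exp_to0 a0 b_gt0 b_to0 (mf_sg0 mf) (mf_sg1 mf).
have p0 : (fun N => b N `^ (kappa / 4)) @ \oo --> 0.
  by apply: (powR_seq_to0 b_gt0 b_to0); rewrite divr_gt0.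
apply: to0D; [apply: to0D; [apply: to0D|]|].
- exact: to0Z.
- by apply: to0Z; exact: to0Z.
- by apply: to0Z; exact: rb_to0.
- apply: to0Z; apply: to0Z; apply: to0D; [apply: to0D => //|].
    exact: to0Z.
  by apply: to0Z; exact: to0Z.
Qed.

Lemma bad_event_prob eta e4 N : 0 < eta -> 0 < e4 -> (0 < N)%N -> b N <= 1 ->
  exists2 E, measurable E & (P E <= (bad_prob eta e4 N)%:E)%E /\
   forall w, ~ E w -> [/\ \sum_i \sum_x `|score_avg N w i x| < b N ^+ 2,
     \sum_x \sum_y `|gram_dev N w x y| < eta,
     sqV_avg N w < (rb N)^-1 & acov_err N w < e4].
Proof.
move=> eta0 e40 N0 b1; have bp := b_gt0 N; have rp := rb_gt0 N.
have NR : 0 < N%:R :> R by rewrite ltr0n.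
have t0 : 0 < tau N := tau_gt0 kappa a0 B_ge1 b_gt0 N0.
have T0 : 0 < (TN N).+1%:R :> R by rewrite ltr0n.
have bt0 : 0 < b N ^+ 2 * tau N by rewrite mulr_gt0// exprn_gt0.
have hv := tau_var k0 a0 B_ge1 b_gt0 N0 b1.
have [i1 e1] := score_avg_dev mf cross0 N0 bt0 hv.
have [i2 e2] := gram_avg_dev mf N0 bt0 hv.
have [i3 e3] := sqV_avg_mom mf N0.
have M0 : 0 < clipM kappa b N by exact: powR_gt0.
have x0 : 0 < N%:R * tau N / (TN N).+1%:R by rewrite divr_gt0 ?mulr_gt0.
have [i4 e4'] := acov_err_mom mf N0 M0 x0 (tau_acov k0 a0 B_ge1 b_gt0 N0 b1).
have p1 := markov_Ex i1 (exprn_gt0 2 bp); have p2 := markov_Ex i2 eta0.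
have rp' : 0 < (rb N)^-1 by rewrite invr_gt0.
have p3 := markov_Ex i3 rp'; have p4 := markov_Ex i4 e40.
have mE X c : L1 P X -> measurable [set w | c <= `|X w|].
  move=> iX; rewrite -[X in measurable X]setTI.
  have := measurableT_comp (@normr_measurable R setT) (L1_meas iX).
  move=> /(_ measurableT `[c, +oo[%classic (measurable_itv _)).
  by congr measurable; apply/seteqP; split => w /= [_ h]; split=> //; move: h; rewrite in_itv /= andbT.
move: p1 p2 p3 p4.
set E1 := [set w | _]; set E2 := [set w | _]; set E3 := [set w | _]; set E4 := [set w | _].
move=> p1 p2 p3 p4.
have m1 : measurable E1 by exact: mE.
have m2 : measurable E2 by exact: mE.
have m3 : measurable E3 by exact: mE.
have m4 : measurable E4 by exact: mE.
exists (E1 `|` E2 `|` E3 `|` E4); first by do !apply: measurableU.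
split.
  apply: le_trans (measureU2 _ _ _) _ => //; first by do !apply: measurableU.
  rewrite /bad_prob EFinD; apply: leeD; last first.
    apply: le_trans p4 _; rewrite lee_fin ler_wpM2l ?invr_ge0 ?(ltW e40)//.
    apply: le_trans e4' _; rewrite ler_wpM2l//.
    have -> : N%:R * tau N / (TN N).+1%:R / N%:R = tau N / (TN N).+1%:R.
      by field; rewrite !gt_eqF.
    rewrite mulrDr mulrC divfK ?gt_eqF// -addrA lerD2l.
    rewrite mulrCA mulrDr mulrDr lerD2l ler_wpM2l; last 2 first.
    - by have := B_ge1; lra.
    - exact: (clipM_rate k0 a0 b_gt0 b1).
    by [].
  apply: le_trans (measureU2 _ _ _) _ => //; first by do !apply: measurableU.
  rewrite EFinD; apply: leeD; last first.
    by apply: le_trans p3 _; rewrite lee_fin invrK mulrC ler_wpM2r ?(ltW rp).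
  apply: le_trans (measureU2 _ _ _) _ => //.
  rewrite EFinD; apply: leeD.
    apply: le_trans p1 _; rewrite lee_fin ler_pdivrMl ?exprn_gt0//.
    by apply: le_trans e1 _; rewrite mulrCA.
  apply: le_trans p2 _; rewrite lee_fin ler_wpM2l ?invr_ge0 ?(ltW eta0)//.
  apply: le_trans e2 _; by rewrite ler_wpM2l// ler_piMl ?(ltW t0)// exprn_ile1 ?(ltW bp).
move=> w hw.
have n1 : ~ E1 w by move=> h; apply: hw; left; left; left.
have n2 : ~ E2 w by move=> h; apply: hw; left; left; right.
have n3 : ~ E3 w by move=> h; apply: hw; left; right.
have n4 : ~ E4 w by move=> h; apply: hw; right.
have gt (X : T -> R) c : ~ (c <= `|X w|) -> X w < c.
  by move=> /negP; rewrite -ltNge; apply: le_lt_trans; exact: ler_norm.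
split.
- exact: (gt (fun w => \sum_i \sum_x `|score_avg N w i x|)).
- exact: (gt (fun w => \sum_x \sum_y `|gram_dev N w x y|)).
- exact: (gt (fun w => sqV_avg N w)).
- exact: (gt (fun w => acov_err N w)).
Qed.

Lemma PsiHAC_consistent e : 0 < e ->
  (fun N => P [set w | e < `|hac N w - lrv|]) @ \oo --> 0%E.
Proof.
move=> e0.
have F1 : 1 <= F by have := fF 0; rewrite f0 normr1.
have [eta [C [eta0 C0 hS]]] := near_unit Sunit.
(* Half of e goes to the bias, a quarter to the residuals, and 2 F e4 = e / 4 to the
   autocovariances. *)
pose e4 := e / (8 * F).
have e40 : 0 < e4 by rewrite divr_gt0// mulr_gt0//; lra.
(* Countably many almost sure equations hold together off a single null set. *)
have [N0 mN0 [PN0 hN0]] : exists2 E, measurable E & P E = 0%E /\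
    forall w, ~ E w -> forall n : nat, model_at n%:Z w.
  have [E [mE PE hE]] := ae_foralln (fun n => rel n%:Z).
  exists E => //; split=> // w hw n.
  by apply: contrapT => h; apply: hw; apply: hE => /= hh; apply: h; exact: hh.
have PN0' : (P N0 <= 0)%E by rewrite PN0.
pose c5 := F * ((2 * a + 1) * (q%:R * (2 + q%:R) * (q%:R * C))).
have kc : \forall N \near \oo, forall IJ : ('I_d * 'I_q) * ('I_d * 'I_q),
   `|kernel_sum f a b N (fun I J h => acov_wt N h * acov P s Y eps I J h) IJ.1 IJ.2 -
    lrv (Widx IJ.1) (Widx IJ.2)| <= e / 2.
  apply: filter_forall => -[I J] /=.
  have := kernel_sum_cvg mf cross0 a0 b_gt0 b_to0 fF fc f0 (I := I) (J := J).
  move/cvgrPdist_le => /(_ (e / 2)); rewrite divr_gt0// => /(_ isT).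
  by apply: filterS => N; rewrite distrC.
have r1 := @rb_small (q%:R * C) 1 ltr01.
have e4p : 0 < e / 4 by rewrite divr_gt0.
have r2 := rb_small c5 e4p.
have bad : \forall N \near \oo, (P [set w | (e < `|hac N w - lrv|)%R] <= (bad_prob eta e4 N)%:E)%E.
  near=> N.
  have N1 : (0 < N)%N by near: N; exists 1%N.
  have b1 : b N <= 1 by near: N; exact: b_le1.
  have [E mE [PE hE]] := bad_event_prob eta0 e40 N1 b1.
  apply: le_trans (_ : P (N0 `|` E) <= _)%E.
    apply: le_measure; rewrite ?inE.
    - apply: measurable_norm_gt; last exact: ltW.
      by apply: mxmeasD; [exact: mxmeas_PsiHAC|exact: mxmeas_cst].
    - exact: measurableU.
    move=> w /= hw; apply: contrapT => hn.
    have nN0 : ~ N0 w by move=> h; apply: hn; left.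
    have nE : ~ E w by move=> h; apply: hn; right.
    have [h1 h2 h3 h4] := hE _ nE.
    move: hw; rewrite ltNge => /negP; apply.
    apply: (hac_dev C0 hS N1 b1 (ltW e0) _ _ _ _ h1 h2 h3 h4).
    + move=> I J; have : forall IJ : ('I_d * 'I_q) * ('I_d * 'I_q),
        `|kernel_sum f a b N (fun I J h => acov_wt N h * acov P s Y eps I J h) IJ.1 IJ.2 -
        lrv (Widx IJ.1) (Widx IJ.2)| <= e / 2 by near: N.
      by move=> /(_ (I, J)).
    + by near: N.
    + rewrite mulrDr mulrA -/c5.
      have -> : F * (2 * e4) = e / 4 by rewrite /e4; field; rewrite gt_eqF//; lra.
      have : c5 * rb N <= e / 4 by near: N.
      lra.
    + by move=> n _; exact: hN0.
  apply: le_trans (measureU2 _ _ _) _ => //.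
  by apply: le_trans (leeD PN0' PE) _; rewrite add0e.
apply: (@squeeze_cvge _ _ _ _ (fun=> 0%E) _ (fun N => (bad_prob eta e4 N)%:E)).
- by apply: filterS bad => N ->; rewrite measure_ge0.
- exact: cvg_cst.
- by apply: cvg_EFin; [exact: nearW|exact: bad_prob_to0].
Unshelve. all: by end_near. Qed.

End HAC.

Theorem theorem3
  (R : realType) (dT : measure_display) (T : measurableType dT)
  (P : probability T R)
  (d s : nat) (p : nat -> nat) (Phi : nat -> nat -> 'M[R]_d)
  (Y eps : int -> T -> 'cV[R]_d) (kappa : R)
  (f : R -> R) (a : R) (b : nat -> R)
  (* dimensions and orders *)
  (hd : (1 <= d)%N) (hs : (1 <= s)%N)
  (hp : forall nu, (1 <= nu <= s)%N -> (1 <= p nu)%N)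
  (hPhi0 : forall l nu, (p nu < l)%N -> Phi l nu = 0)
  (* eps and Y are random vectors *)
  (heps_meas : forall t i j, measurable_fun setT (fun w => eps t w i j))
  (hY_meas : forall t i j, measurable_fun setT (fun w => Y t w i j))
  (* Y satisfies the PVAR equations (a.s.) ... *)
  (hrec : forall (n : int) (nu : nat), (1 <= nu <= s)%N ->
     {ae P, forall w,
       Y (n * s%:Z + nu%:Z) w =
       \sum_(1 <= k < (p nu).+1) Phi k nu *m Y (n * s%:Z + nu%:Z - k%:Z) w
       + eps (n * s%:Z + nu%:Z) w})
  (* ... and is the causal solution:
     Y_{ns+nu} = sum_{j >= 0} Psi_j(nu) eps_{ns+nu-j} a.s.,
     with absolutely summable Psi_j(nu) *)
  (hcausal : exists PsiC : nat -> nat -> 'M[R]_d,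
     (forall nu, (1 <= nu <= s)%N -> cvgn (series (fun j => `|PsiC j nu|))) /\
     (forall (n : int) (nu : nat), (1 <= nu <= s)%N ->
       {ae P, forall w,
         (fun J => \sum_(j < J) PsiC j nu *m eps (n * s%:Z + nu%:Z - j%:Z) w)
           @ \oo --> Y (n * s%:Z + nu%:Z) w}))
  (* (A0) *)
  (hA0_mean : forall t, Emx P (eps t) = 0)
  (hA0_var : exists Sigma : nat -> 'M[R]_d,
     forall nu, (1 <= nu <= s)%N ->
       Sigma nu \in unitmx /\
       forall n : int,
         Covmx P (eps (n * s%:Z + nu%:Z)) (eps (n * s%:Z + nu%:Z)) = Sigma nu)
  (hA0_uncorr : forall t h : int, h != 0 -> Covmx P (eps t) (eps (t - h)) = 0)
  (* (A1) *)
  (hA1 : forall z : R[i], `|z| <= 1 -> \det (Phistar_poly s p Phi z) != 0)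
  (* (A2) *)
  (hA2_stat : strictly_stationary P (estar_path s eps))
  (hA2_erg : ergodic P (estar_path s eps))
  (* (A3) *)
  (hkappa : 0 < kappa)
  (hA3_mom : forall n : int,
     (\int[P]_w ((sqnorm (estar s eps n w)) `^ (2 + kappa))%:E < +oo)%E)
  (hA3_mix : cvgn (series (fun k =>
     (alpha_mixing P (estar s eps) k) `^ (kappa / (2 + kappa)))))
  (* kernel f *)
  (hf_bdd : exists M : R, forall x, `|f x| <= M)
  (hf_supp : forall x, a < `|x| -> f x = 0)
  (hf_cont : {for 0, continuous f})
  (hf0 : f 0 = 1)
  (* bandwidth *)
  (hb_pos : forall N, 0 < b N)
  (hb_0 : b @ \oo --> 0)
  (hb_rate : (fun N => N%:R * b N `^ ((10 + 4 * kappa) / kappa)) @ \oo --> +oo)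
  :
  forall nu, (1 <= nu <= s)%N ->
  forall e : R, 0 < e ->
    (fun N => P [set w | e < `|PsiHAC s p Y nu f a b N w - Psi P s p Y eps nu|])
      @ \oo --> 0%E.
Proof.
move=> nu hnu e e0.
have [PsiC [hsum hcv]] := hcausal.
have [Sigma hSig] := hA0_var.
have hunit nu' h := (hSig nu' h).1.
have hvar nu' h := (hSig nu' h).2.
have [B [sg [g mf]]] := model_factsP hs heps_meas hY_meas hPhi0 hrec hsum hcv
  hA0_mean hunit hvar hA0_uncorr hA2_stat hkappa hA3_mom hA3_mix hnu.
have cross0 := cross_mean0 hs heps_meas hY_meas hsum hcv hA0_mean hvar hA0_uncorr
  hA2_stat hkappa hA3_mom.
have uS := Smat_unit hs heps_meas hY_meas hPhi0 hrec hsum hcv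
  hA0_mean hunit hvar hA0_uncorr hA2_stat hkappa hA3_mom hA3_mix hnu.
have [F fF] := hf_bdd.
(* If a <= 0, then f vanishes off 0, which contradicts continuity at 0 with f 0 = 1. *)
have a0 : 0 < a.
  rewrite ltNge; apply/negP => a0.
  move/cvgrPdist_lt : hf_cont => /(_ _ ltr01) /nbhs_ballP[r /= r0 hr].
  have := hr (r / 2); rewrite /ball /= sub0r normrN gtr0_norm ?divr_gt0//.
  rewrite ltr_pdivrMr// mulr_natr mulr2n ltrDl => /(_ r0).
  rewrite hf0 hf_supp ?subr0 ?normr1 ?ltxx//.
  by rewrite (le_lt_trans a0)// normr_gt0 gt_eqF// divr_gt0.
exact: (PsiHAC_consistent hkappa hY_meas mf (@cross0 p nu) (Bmat_rec hrec hnu) uS a0 fF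
  hf_cont hf0 hb_pos hb_0 hb_rate e0).
Qed.
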